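(* Let $\mathcal A\subseteq\mathbb B(\mathcal H)$ be an operator algebra, let $G$ be a discrete group, and let $\delta$ be a normal coaction of $G$ on $\mathcal A$. Then there is a completely isometric isomorphism $$\Psi\colon\mathcal A\rtimes_\delta G\rtimes^r_{\hat\delta}G\to\delta_\lambda(\mathcal A)\otimes\mathbb K$$ which conjugates the reduced coaction $\hat{\hat\delta}$ of $G$ on the reduced double crossed product to the reduced coaction $\tilde\delta$ of $G$ on $\delta_\lambda(\mathcal A)\otimes\mathbb K$ (that is, $\tilde\delta\circ\Psi=(\Psi\otimes\mathrm{id}_{C^*_\lambda(G)})\circ\hat{\hat\delta}$) given by $$\tilde\delta(x)=(I_{\mathcal H}\otimes I_{\ell^2(G)}\otimes U^* )\big[(\delta_\lambda\otimes\Sigma)\circ(\delta_\lambda\otimes\mathrm{id}_{\mathbb K})\circ(\delta_\lambda^{-1}\otimes\mathrm{id}_{\mathbb K})(x)\big](I_{\mathcal H}\otimes I_{\ell^2(G)}\otimes U)$$ for all $x\in\delta_\lambda(\mathcal A)\otimes\mathbb K$, where $\Sigma\colon C^*_\lambda(G)\otimes\mathbb K\to\mathbb K\otimes C^*_\lambda(G)$ is the flip map.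
   Context: An operator algebra is a norm-closed subalgebra of $\mathbb B(\mathcal H)$. $\otimes$ is the minimal (spatial) tensor product and $\mathbb K=\mathbb K(\ell^2(G))$. For a discrete group $G$, $u_g\in C^*(G)$ are the canonical unitaries, $\lambda$ denotes both the left regular representation of $G$ on $\ell^2(G)$ and the quotient map $C^*(G)\to C^*_\lambda(G)$, $\Delta(u_g)=u_g\otimes u_g$ and $\Delta_\lambda(\lambda_g)=\lambda_g\otimes\lambda_g$ are the comultiplications on $C^*(G)$ and $C^*_\lambda(G)$. A coaction of $G$ on $\mathcal A$ is a completely contractive homomorphism $\delta\colon\mathcal A\to\mathcal A\otimes C^*(G)$ with $(\delta\otimes\mathrm{id})\circ\delta=(\mathrm{id}_{\mathcal A}\otimes\Delta)\circ\delta$ and $\overline{\delta(\mathcal A)(I\otimes C^*(G))}=\mathcal A\otimes C^*(G)$ (closed linear span). It is normal if $\delta_\lambda:=(\mathrm{id}_{\mathcal A}\otimes\lambda)\circ\delta$ is completely isometric. A reduced coaction of $G$ on an operator algebra $\mathcal B$ is a completely isometric homomorphism $\varepsilon\colon\mathcal B\to\mathcal B\otimes C^*_\lambda(G)$ with $(\varepsilon\otimes\mathrm{id})\circ\varepsilon=(\mathrm{id}_{\mathcal B}\otimes\Delta_\lambda)\circ\varepsilon$ and $\overline{\varepsilon(\mathcal B)(I\otimes C^*_\lambda(G))}=\mathcal B\otimes C^*_\lambda(G)$. View $\delta_\lambda$ as a homomorphism $\mathcal A\to\mathbb B(\mathcal H\otimes\ell^2(G))$. Let $M\colon c_0(G)\to\mathbb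 B(\ell^2(G))$ be the representation by diagonal multiplication operators. The crossed product is $\mathcal A\rtimes_\delta G=\overline{\mathrm{alg}}\{\delta_\lambda(a)(I\otimes M_f):a\in\mathcal A,f\in c_0(G)\}\subseteq\mathbb B(\mathcal H\otimes\ell^2(G))$; with $\rho$ the right regular representation of $G$, its dual action is $\hat\delta_g(x)=(I\otimes\rho_g^* )x(I\otimes\rho_g)$. Define $k_{\mathcal A}(a)=\delta_\lambda(a)\otimes I_{\ell^2(G)}$ for $a\in\mathcal A$; $k_{c_0(G)}(f)=I\otimes((M\otimes M)\circ\nu(f))$ for $f\in c_0(G)$, where $\nu(f)(g,h)=f(gh^{-1})$ (with $M\otimes M$ extended to bounded functions on $G\times G$ as multiplication operators); and $k_G(g)=I\otimes I\otimes\lambda_g$ for $g\in G$. The reduced double crossed product is $$\mathcal A\rtimes_\delta G\rtimes^r_{\hat\delta}G=\overline{\mathrm{alg}}\big(k_{\mathcal A}(\mathcal A)k_{c_0(G)}(c_0(G))k_G(G)\big)\subseteq\mathbb B(\mathcal H\otimes\ell^2(G)\otimes\ell^2(G)).$$ Let $U\in\mathcal U(\ell^2(G)\otimes\ell^2(G))$ be the unitary $U(e_g\otimes e_h)=e_g\otimes e_{gh}$. The reduced coaction $\hat{\hat\delta}$ of $G$ on the double crossed product is $\hat{\hat\delta}(x)=(I_{\mathcal H}\otimes I_{\ell^2(G)}\otimes U)(x\otimes I_{\ell^2(G)})(I_{\mathcal H}\otimes I_{\ell^2(G)}\otimes U^* )$; it satisfies $\hat{\hat\delta}(k_{\mathcal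 A}(a)k_{c_0(G)}(f)k_G(g))=k_{\mathcal A}(a)k_{c_0(G)}(f)k_G(g)\otimes\lambda_g$. *)

(* Defs.v *)
From HB Require Import structures.
From mathcomp Require Import all_boot all_order all_algebra finmap complex.
From mathcomp Require Import all_classical all_reals.
From mathcomp Require Import ereal numfun topology normedtype sequences esum.
From mathcomp Require Import ring lra.

Set Implicit Arguments.
Unset Strict Implicit.
Unset Printing Implicit Defensive.

Import Order.TTheory GRing.Theory Num.Theory.
Import numFieldNormedType.Exports.

Local Open Scope classical_set_scope.
Local Open Scope ring_scope.

(* The inner product is linear in its first argument. *)
HB.mixin Record Lmodule_isPreHilbert (R : realType) V of GRing.Lmodule R[i] V :=
  { hdot : V -> V -> R[i];
    hdotC : forall x y : V, hdot y x = (hdot x y)^*%C;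
    hdotPl : forall (a : R[i]) (x y z : V),
      hdot (a *: x + y) z = a * hdot x z + hdot y z;
    hdot_gt0 : forall x : V, x != 0 -> 0 < hdot x x }.

#[short(type="preHilbertType")]
HB.structure Definition PreHilbert (R : realType) :=
  { V of GRing.Lmodule R[i] V & Lmodule_isPreHilbert R V }.

Definition hnorm (R : realType) (V : preHilbertType R) (x : V) : R :=
  Num.sqrt (complex.Re (hdot x x)).

Definition hcvg (R : realType) (V : preHilbertType R) (u : nat -> V) (l : V) :=
  forall e : R, 0 < e ->
    exists N : nat, forall n : nat, (N <= n)%N -> hnorm (u n - l) < e.

Definition hcauchy (R : realType) (V : preHilbertType R) (u : nat -> V) :=
  forall e : R, 0 < e ->
    exists N : nat, forall m n : nat, (N <= m)%N -> (N <= n)%N ->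
      hnorm (u m - u n) < e.

HB.mixin Record PreHilbert_isHilbert (R : realType) V of PreHilbert R V :=
  { hcomplete : forall u : nat -> V, hcauchy u -> exists l : V, hcvg u l }.

#[short(type="hilbertType")]
HB.structure Definition Hilbert (R : realType) :=
  { V of PreHilbert R V & PreHilbert_isHilbert R V }.

Section PreHilbertTheory.
Variables (R : realType) (V : preHilbertType R).
Implicit Types (x y z : V) (a : R[i]).

Definition hsq x : R := complex.Re (hdot x x).

Lemma hdot0l z : hdot 0 z = 0 :> R[i].
Proof.
have := hdotPl (-1) (0 : V) 0 z.
by rewrite scaler0 addr0 mulN1r addNr.
Qed.

Lemma hdotDl x y z : hdot (x + y) z = hdot x z + hdot y z.
Proof. by rewrite -{1}(scale1r x) hdotPl mul1r. Qed.

Lemma hdotZl a x z : hdot (a *: x) z = a * hdot x z.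
Proof. by rewrite -{1}(addr0 (a *: x)) hdotPl hdot0l addr0. Qed.

Lemma hdotDr x y z : hdot x (y + z) = hdot x y + hdot x z.
Proof. by rewrite [LHS]hdotC hdotDl rmorphD/= -!hdotC. Qed.

Lemma hdotZr a x y : hdot x (a *: y) = a^*%C * hdot x y.
Proof. by rewrite [LHS]hdotC hdotZl rmorphM/= -hdotC. Qed.

Lemma hdot_ge0 x : 0 <= hdot x x.
Proof.
have [->|/hdot_gt0/ltW//] := eqVneq x 0.
by rewrite hdot0l.
Qed.

Lemma hsq_ge0 x : 0 <= hsq x.
Proof. by have := hdot_ge0 x; rewrite lecE => /andP[]. Qed.

Lemma hdot_hsq x : hdot x x = (hsq x)%:C%C.
Proof.
have := hdot_ge0 x; rewrite lecE => /andP[/eqP/= h _].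
by rewrite /hsq; case: (hdot x x) h => r i /= ->.
Qed.

Lemma hnorm_sq x : hnorm x ^+ 2 = hsq x.
Proof. by rewrite /hnorm sqr_sqrtr// -/(hsq x) hsq_ge0. Qed.

Lemma hnorm_ge0 x : 0 <= hnorm x.
Proof. exact: sqrtr_ge0. Qed.

Lemma hsq0 : hsq 0 = 0.
Proof. by rewrite /hsq hdot0l. Qed.

Lemma hsqZ a x : hsq (a *: x) = (complex.Re a ^+ 2 + complex.Im a ^+ 2) * hsq x.
Proof.
rewrite /hsq hdotZl hdotZr hdot_hsq/=.
case: a => s t /=; rewrite /hsq/=.
by ring.
Qed.

Lemma ReC (z : R[i]) : complex.Re z^*%C = complex.Re z.
Proof. by case: z. Qed.

Lemma ReD (z w : R[i]) : complex.Re (z + w) = complex.Re z + complex.Re w.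
Proof. by case: z; case: w. Qed.

Lemma ImD (z w : R[i]) : complex.Im (z + w) = complex.Im z + complex.Im w.
Proof. by case: z; case: w. Qed.

Lemma hsqD x y : hsq (x + y) = hsq x + hsq y + complex.Re (hdot x y) *+ 2.
Proof.
rewrite {1}/hsq hdotDl !hdotDr !ReD -/(hsq x) -/(hsq y).
by rewrite (hdotC x y) ReC; ring.
Qed.

Lemma hsqN x : hsq (- x) = hsq x.
Proof. by rewrite -scaleN1r hsqZ/= oppr0 expr0n addr0 sqrrN expr1n mul1r. Qed.

Lemma hsqDN x y : hsq (x - y) = hsq x + hsq y - complex.Re (hdot x y) *+ 2.
Proof.
rewrite hsqD hsqN -scaleN1r hdotZr/= -mulNrn; congr (_ + _ *+ _).
by case: (hdot x y) => s t /=; ring.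
Qed.

Lemma hsqD_le x y : hsq (x + y) <= hsq x *+ 2 + hsq y *+ 2.
Proof.
by have := hsq_ge0 (x - y); rewrite hsqDN hsqD; lra.
Qed.

Lemma Rehdot_le x y : `|complex.Re (hdot x y)| <= hsq x + hsq y.
Proof.
have := hsq_ge0 (x - y); have := hsq_ge0 (x + y).
have := hsq_ge0 x; have := hsq_ge0 y.
by rewrite hsqDN hsqD ler_norml => *; apply/andP; split; lra.
Qed.

Lemma Imhdot_le x y : `|complex.Im (hdot x y)| <= hsq x + hsq y.
Proof.
have := Rehdot_le x ('i%C *: y).
rewrite hdotZr hsqZ/= expr0n add0r expr1n mul1r.
by case: (hdot x y) => s t /=; rewrite mul0r sub0r mulN1r opprK.
Qed.

Lemma hnorm_lt x (e : R) : 0 < e -> (hnorm x < e) = (hsq x < e ^+ 2).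
Proof.
move=> e0; rewrite -hnorm_sq; apply/idP/idP.
  by move=> h; rewrite ltr_pXn2r// ?nnegrE ?hnorm_ge0// ltW.
by rewrite ltr_pXn2r// ?nnegrE ?hnorm_ge0// ltW.
Qed.

End PreHilbertTheory.

Section ComplexHilbert.
Variable R : realType.

Let cdot (x y : R[i]^o) : R[i] := (x : R[i]) * (y : R[i])^*%C.

Let cdotC x y : cdot y x = (cdot x y)^*%C.
Proof. by rewrite /cdot rmorphM/= conjcK mulrC. Qed.

Let cdotPl a x y z : cdot (a *: x + y) z = a * cdot x z + cdot y z.
Proof. by rewrite /cdot mulrDl -mulrA. Qed.

Let cdot_gt0 x : x != 0 -> 0 < cdot x x.
Proof. by move=> x0; rewrite /cdot -sqr_normc exprn_gt0// normr_gt0. Qed.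

HB.instance Definition _ :=
  Lmodule_isPreHilbert.Build R (R[i]^o) cdotC cdotPl cdot_gt0.

Let chsq (x : R[i]^o) : hsq x = complex.Re x ^+ 2 + complex.Im x ^+ 2.
Proof. by rewrite /hsq /hdot/= /cdot; case: x => s t /=; rewrite mulrN opprK. Qed.

Let real_complete (u : nat -> R) :
  (forall e : R, 0 < e -> exists N : nat, forall m n : nat,
    (N <= m)%N -> (N <= n)%N -> `|u m - u n| < e) ->
  exists l : R, forall e : R, 0 < e -> exists N : nat, forall n : nat,
    (N <= n)%N -> `|u n - l| < e.
Proof.
move=> cu.
have : cvgn u.
  apply/cauchy_cvgP/cauchy_exP => e e0; have [N hN] := cu e e0.
  by exists (u N), N => // n /= Nn; exact: hN.
move/cvg_ex => [l /cvgrPdist_lt ul]; exists l => e e0.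
have [N _ hN] := ul e e0.
by exists N => n Nn; rewrite distrC; exact: hN.
Qed.

Let sq_lt (r e : R) : 0 < e -> r ^+ 2 < e ^+ 2 -> `|r| < e.
Proof.
move=> e0; rewrite -[r ^+ 2]real_normK ?num_real// => h.
by rewrite -(@ltr_pXn2r _ 2%N) ?nnegrE// ltW.
Qed.

Let complex_complete (u : nat -> R[i]^o) : hcauchy u -> exists l, hcvg u l.
Proof.
move=> cu.
have [|l1 h1] := @real_complete (fun n => complex.Re (u n)).
  move=> e e0; have [N hN] := cu e e0; exists N => m n Nm Nn.
  have := hN m n Nm Nn; rewrite hnorm_lt// chsq => h.
  apply: sq_lt => //; apply: le_lt_trans h; rewrite -[X in X ^+ 2 <= _](_ : complex.Re (u m - u n) = _).
    by rewrite lerDl sqr_ge0.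
  by case: (u m); case: (u n).
have [|l2 h2] := @real_complete (fun n => complex.Im (u n)).
  move=> e e0; have [N hN] := cu e e0; exists N => m n Nm Nn.
  have := hN m n Nm Nn; rewrite hnorm_lt// chsq => h.
  apply: sq_lt => //; apply: le_lt_trans h; rewrite -[X in X ^+ 2 <= _](_ : complex.Im (u m - u n) = _).
    by rewrite lerDr sqr_ge0.
  by case: (u m); case: (u n).
exists (l1 +i* l2)%C => e e0.
have e20 : 0 < e / 2 by rewrite divr_gt0.
have [N1 hN1] := h1 _ e20; have [N2 hN2] := h2 _ e20.
exists (maxn N1 N2) => n; rewrite geq_max => /andP[/hN1 a1 /hN2 a2].
rewrite hnorm_lt// chsq.
have -> : complex.Re (u n - (l1 +i* l2)%C) = complex.Re (u n) - l1.
  by case: (u n).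
have -> : complex.Im (u n - (l1 +i* l2)%C) = complex.Im (u n) - l2.
  by case: (u n).
set s := _ - l1 in a1 *; set t := _ - l2 in a2 *.
have sq (r : R) : `|r| < e / 2 -> r ^+ 2 < (e / 2) ^+ 2.
  move=> h; rewrite -[r ^+ 2]real_normK ?num_real//.
  by rewrite ltr_pXn2r// ?nnegrE// ltW.
apply: (lt_le_trans (ltrD (sq _ a1) (sq _ a2))).
by have := sqr_ge0 e; lra.
Qed.

HB.instance Definition _ :=
  PreHilbert_isHilbert.Build R (R[i]^o) complex_complete.

End ComplexHilbert.

Section RealSum.
Variables (R : realType) (I : choiceType).
Implicit Types (p q : I -> R).

Definition rsum p : R :=
  fine (\esum_(i in [set: I]) (EFin \o p)^\+%E i -
        \esum_(i in [set: I]) (EFin \o p)^\-%E i)%E.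

Definition rsummable p := summable [set: I] (EFin \o p).

Definition nsum p : R := fine (\esum_(i in [set: I]) (p i)%:E)%E.

Lemma esum_nsum p : rsummable p -> (forall i, 0 <= p i) ->
  (\esum_(i in [set: I]) (p i)%:E)%E = (nsum p)%:E.
Proof.
move=> sp p0; rewrite fineK//; move: sp; rewrite /rsummable summableE.
by under eq_esum do rewrite /= ger0_norm//.
Qed.

Lemma rsummable_le p q : (forall i, `|p i| <= q i) -> rsummable q ->
  rsummable p.
Proof.
move=> pq; apply: le_lt_trans; apply: le_esum => i _ /=.
by rewrite lee_fin (le_trans (pq i))// ler_norm.
Qed.

Lemma rsummableD p q : rsummable p -> rsummable q ->
  rsummable (fun i => p i + q i).
Proof. by move=> sp sq; have := summableD sp sq. Qed.

Lemma rsummableMn p n : rsummable p -> rsummable (fun i => p i *+ n).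
Proof.
move=> sp; elim: n => [|n ih].
  rewrite /rsummable /summable esum1 ?ltry// => i _ /=.
  by rewrite mulr0n normr0.
by under eq_fun do rewrite mulrS; exact: rsummableD.
Qed.

Lemma rsummableZ p (c : R) : rsummable p -> rsummable (fun i => c * p i).
Proof.
move=> sp; pose n := Num.bound `|c|.
apply: (@rsummable_le _ (fun i => `|p i| *+ n)).
  move=> i; rewrite normrM -mulr_natl ler_wpM2r//.
  exact/ltW/archi_boundP/normr_ge0.
apply: rsummableMn; apply: le_lt_trans sp; apply: le_esum => i _ /=.
by rewrite normr_id.
Qed.

Lemma rsumB p q : rsummable p -> rsummable q ->
  (forall i, 0 <= p i) -> (forall i, 0 <= q i) ->
  rsum (fun i => p i - q i) = nsum p - nsum q.
Proof.
move=> sp sq p0 q0.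
rewrite /rsum (_ : EFin \o _ = (EFin \o p) \- (EFin \o q))%E; last first.
  by apply/funext => i /=; rewrite EFinB.
rewrite esumB//; try by move=> i _; rewrite /= lee_fin.
by rewrite !esum_nsum// -EFinB.
Qed.

Lemma nsumD p q : rsummable p -> rsummable q ->
  (forall i, 0 <= p i) -> (forall i, 0 <= q i) ->
  nsum (fun i => p i + q i) = nsum p + nsum q.
Proof.
move=> sp sq p0 q0; rewrite {1}/nsum.
under eq_esum do rewrite EFinD.
by rewrite esumD ?esum_nsum//= => i _; rewrite lee_fin.
Qed.

Definition rpos p i := Num.max (p i) 0.
Definition rneg p i := Num.max (- p i) 0.

Lemma rposneg p i : p i = rpos p i - rneg p i.
Proof.
rewrite /rpos /rneg; have /orP[h|h] := le_total (p i) 0.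
  by rewrite max_r// max_l ?oppr_ge0// sub0r opprK.
by rewrite max_l// max_r ?oppr_le0// subr0.
Qed.

Lemma rpos_ge0 p i : 0 <= rpos p i.
Proof. by rewrite /rpos le_max lexx orbT. Qed.

Lemma rneg_ge0 p i : 0 <= rneg p i.
Proof. by rewrite /rneg le_max lexx orbT. Qed.

Lemma rsummable_abs p : rsummable p -> rsummable (fun i => `|p i|).
Proof.
apply: le_lt_trans; apply: le_esum => i _ /=.
by rewrite normr_id.
Qed.

Lemma rsummable_pos p : rsummable p -> rsummable (rpos p).
Proof.
move=> /rsummable_abs; apply: rsummable_le => i.
rewrite ger0_norm ?rpos_ge0// /rpos ge_max normr_ge0 andbT.
exact: ler_norm.
Qed.

Lemma rsummable_neg p : rsummable p -> rsummable (rneg p).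
Proof.
move=> /rsummable_abs; apply: rsummable_le => i.
rewrite ger0_norm ?rneg_ge0// /rneg ge_max normr_ge0 andbT.
by rewrite -normrN ler_norm.
Qed.

Lemma rsumE p : rsummable p -> rsum p = nsum (rpos p) - nsum (rneg p).
Proof.
move=> sp; rewrite -rsumB//.
- by congr rsum; apply/funext => i; exact: rposneg.
- exact: rsummable_pos.
- exact: rsummable_neg.
- exact: rpos_ge0.
- exact: rneg_ge0.
Qed.

Lemma rsumD p q : rsummable p -> rsummable q ->
  rsum (fun i => p i + q i) = rsum p + rsum q.
Proof.
move=> sp sq; rewrite (rsumE sp) (rsumE sq).
have [sp1 sp2] := (rsummable_pos sp, rsummable_neg sp).
have [sq1 sq2] := (rsummable_pos sq, rsummable_neg sq).
rewrite (_ : (fun i => _) =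
    fun i => (rpos p i + rpos q i) - (rneg p i + rneg q i)); last first.
  by apply/funext => i; rewrite {1}(rposneg p) {1}(rposneg q); ring.
have [p1 p2] := (rpos_ge0 p, rneg_ge0 p).
have [q1 q2] := (rpos_ge0 q, rneg_ge0 q).
rewrite rsumB ?nsumD//; first by ring.
- exact: rsummableD.
- exact: rsummableD.
- by move=> i; rewrite addr_ge0.
- by move=> i; rewrite addr_ge0.
Qed.

Lemma nsumZ p (c : R) : 0 <= c -> rsummable p -> (forall i, 0 <= p i) ->
  nsum (fun i => c * p i) = c * nsum p.
Proof.
rewrite le_eqVlt => /predU1P[<-|c0] sp p0.
  by rewrite mul0r /nsum esum1// => i _; rewrite mul0r.
have cp0 i : 0 <= c * p i by rewrite mulr_ge0// ltW.
have H (d : R) (q : I -> R) : 0 < d -> rsummable q -> (forall i, 0 <= q i) ->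
    nsum (fun i => d * q i) <= d * nsum q.
  move=> d0 sq q0.
  have dq0 i : 0 <= d * q i by rewrite mulr_ge0// ltW.
  rewrite -lee_fin -esum_nsum//; last exact: rsummableZ.
  apply: ge_ereal_sup => _ [X [finX _] <-].
  under eq_fsbigr do rewrite EFinM.
  rewrite -ge0_mule_fsumr; last by move=> i; rewrite lee_fin.
  rewrite EFinM; apply: lee_pmul => //.
  - by rewrite lee_fin ltW.
  - by apply: fsume_ge0 => i _; rewrite lee_fin.
  - by rewrite -esum_nsum//; apply: ereal_sup_ubound; exists X.
apply/eqP; rewrite eq_le H//=.
have := H c^-1 (fun i => c * p i); rewrite invr_gt0 => /(_ c0).
move=> /(_ (rsummableZ c sp) cp0).
under [X in nsum X]eq_fun do rewrite mulKf ?gt_eqF//.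
by rewrite ler_pdivlMl.
Qed.

Lemma rsumZ p (c : R) : rsummable p -> rsum (fun i => c * p i) = c * rsum p.
Proof.
move=> sp; rewrite (rsumE sp).
have [sp1 sp2] := (rsummable_pos sp, rsummable_neg sp).
have [p1 p2] := (rpos_ge0 p, rneg_ge0 p).
have [c0|c0] := leP 0 c.
  rewrite mulrBr -!nsumZ// -rsumB//.
  - by congr rsum; apply/funext => i; rewrite {1}(rposneg p); ring.
  - exact: rsummableZ.
  - exact: rsummableZ.
  - by move=> i; rewrite mulr_ge0.
  - by move=> i; rewrite mulr_ge0.
rewrite -[c]opprK mulNr -mulrN opprB mulrBr.
have c1 : 0 <= - c by rewrite oppr_ge0 ltW.
rewrite -!nsumZ// -rsumB//.
- by congr rsum; apply/funext => i; rewrite {1}(rposneg p); ring.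
- exact: rsummableZ.
- exact: rsummableZ.
- by move=> i; rewrite mulr_ge0.
- by move=> i; rewrite mulr_ge0.
Qed.

Lemma rsum_ge0E p : rsummable p -> (forall i, 0 <= p i) -> rsum p = nsum p.
Proof.
move=> sp p0; rewrite rsumE// [X in _ - X](_ : _ = 0).
  rewrite subr0; congr nsum; apply/funext => i; rewrite /rpos.
  exact/max_idPl.
rewrite /nsum esum1// => i _; congr EFin; apply/max_idPr.
by rewrite oppr_le0.
Qed.

Lemma rsumN p : rsummable p -> rsum (fun i => - p i) = - rsum p.
Proof.
move=> sp; rewrite -mulN1r -rsumZ//; congr rsum.
by apply/funext => i; rewrite mulN1r.
Qed.

Lemma rsum_lin3 p q r (c d : R) : rsummable p -> rsummable q -> rsummable r ->
  rsum (fun i => c * p i + d * q i + r i) = c * rsum p + d * rsum q + rsum r.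
Proof.
move=> sp sq sr; have scp := rsummableZ c sp; have sdq := rsummableZ d sq.
by rewrite (rsumD (rsummableD scp sdq) sr) (rsumD scp sdq) !rsumZ.
Qed.

End RealSum.

Section L2.
Variables (R : realType) (I : choiceType) (H : hilbertType R).
Implicit Types (f g : I -> H).

Definition l2pred : {pred I -> H} :=
  [pred f | (\esum_(i in [set: I]) (hnorm (f i) ^+ 2)%:E < +oo)%E].

(* The Hilbert space of square-summable families of vectors of H, that is
   H \otimes l^2(I); the family f stands for the sum of the f i \otimes e_i.
   In particular L2 I R[i]^o is l^2(I), and L2 J (L2 I H) stands for
   H \otimes l^2(I) \otimes l^2(J), the innermost index coming first. *)
Record L2 := MkL2 { l2fun :> I -> H ; l2funP : l2fun \in l2pred }.

HB.instance Definition _ := [isSub for l2fun].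
HB.instance Definition _ := [Choice of L2 by <:].

Lemma l2predP f : (f \in l2pred) = rsummable (fun i => hsq (f i)).
Proof.
rewrite /rsummable /summable inE; congr (_ < _)%E.
by apply: eq_esum => i _ /=; rewrite hnorm_sq ger0_norm ?hsq_ge0.
Qed.

Lemma l2_submod_closed : submod_closed l2pred.
Proof.
split=> [|a f g].
  rewrite l2predP; apply: (@rsummable_le _ _ _ (fun=> 0)).
    by move=> i; rewrite hsq0 normr0.
  by rewrite /rsummable /summable esum1 ?ltry// => i _ /=; rewrite normr0.
rewrite !l2predP => sf sg.
pose c := complex.Re a ^+ 2 + complex.Im a ^+ 2.
apply: (@rsummable_le _ _ _ (fun i => (c * hsq (f i)) *+ 2 + hsq (g i) *+ 2)).
  move=> i; rewrite ger0_norm ?hsq_ge0// -hsqZ; exact: hsqD_le.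
by apply: rsummableD; apply: rsummableMn => //; exact: rsummableZ.
Qed.

HB.instance Definition _ :=
  GRing.isSubmodClosed.Build R[i] (I -> H) l2pred l2_submod_closed.
HB.instance Definition _ := [SubChoice_isSubLmodule of L2 by <:].

Implicit Types (x y z : L2).

Lemma l2_hsq x : rsummable (fun i => hsq (x i)).
Proof. by rewrite -l2predP l2funP. Qed.

Lemma l2_Re x y : rsummable (fun i => complex.Re (hdot (x i) (y i))).
Proof.
apply: (@rsummable_le _ _ _ (fun i => hsq (x i) + hsq (y i))).
  by move=> i; exact: Rehdot_le.
by apply: rsummableD; exact: l2_hsq.
Qed.

Lemma l2_Im x y : rsummable (fun i => complex.Im (hdot (x i) (y i))).
Proof.
apply: (@rsummable_le _ _ _ (fun i => hsq (x i) + hsq (y i))).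
  by move=> i; exact: Imhdot_le.
by apply: rsummableD; exact: l2_hsq.
Qed.

Definition l2dot x y : R[i] :=
  (rsum (fun i => complex.Re (hdot (x i) (y i))) +i*
   rsum (fun i => complex.Im (hdot (x i) (y i))))%C.

Let l2dotC x y : l2dot y x = (l2dot x y)^*%C.
Proof.
rewrite /l2dot/=; congr Complex.
  by congr rsum; apply/funext => i; rewrite hdotC ReC.
rewrite -rsumN; last exact: l2_Im.
by congr rsum; apply/funext => i; rewrite hdotC; case: (hdot _ _).
Qed.

Let l2dotPl (a : R[i]) x y z : l2dot (a *: x + y) z = a * l2dot x z + l2dot y z.
Proof.
case: a => s t; rewrite /l2dot.
have [r1 r2] := (l2_Re x z, l2_Im x z).
have [q1 q2] := (l2_Re y z, l2_Im y z).
apply/eqP; rewrite eq_complex/=; apply/andP; split; apply/eqP.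
  rewrite -mulNr -rsum_lin3//.
  congr rsum; apply/funext => i /=; rewrite hdotPl.
  by case: (hdot (x i) _) => ? ?; case: (hdot (y i) _) => ? ? /=; ring.
rewrite -rsum_lin3//.
congr rsum; apply/funext => i /=; rewrite hdotPl.
by case: (hdot (x i) _) => ? ?; case: (hdot (y i) _) => ? ? /=; ring.
Qed.

Lemma l2dot_hsq x : l2dot x x = (nsum (fun i => hsq (x i)))%:C%C.
Proof.
congr Complex.
  by rewrite rsum_ge0E//; [exact: l2_Re|move=> i; exact: hsq_ge0].
rewrite (_ : (fun i => _) = fun=> 0); last first.
  by apply/funext => i; rewrite hdot_hsq.
rewrite rsum_ge0E//; last first.
  by rewrite /rsummable /summable esum1 ?ltry// => i _ /=; rewrite normr0.
by rewrite /nsum esum1.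
Qed.

Lemma hsq_le_nsum x i : hsq (x i) <= nsum (fun i => hsq (x i)).
Proof.
rewrite -lee_fin -esum_nsum; [|exact: l2_hsq|by move=> j; exact: hsq_ge0].
apply: esum_ge; exists [set i]; first by split => //; exact: finite_set1.
by rewrite fsbig_set1.
Qed.

Lemma hsq_gt0 (v : H) : v != 0 -> 0 < hsq v.
Proof. by move=> /hdot_gt0; rewrite hdot_hsq ltcR. Qed.

Let l2dot_gt0 x : x != 0 -> 0 < l2dot x x.
Proof.
move=> x0; rewrite l2dot_hsq ltcR.
have [i xi] : exists i, x i != 0.
  apply: contrapT => /forallNP h; case/negP: x0; apply/eqP/val_inj/funext => i.
  by apply/eqP; move: (h i) => /negP; rewrite negbK.
exact: lt_le_trans (hsq_gt0 xi) (hsq_le_nsum x i).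
Qed.

HB.instance Definition _ :=
  Lmodule_isPreHilbert.Build R L2 l2dotC l2dotPl l2dot_gt0.

Lemma l2_hsqE x : hsq x = nsum (fun i => hsq (x i)).
Proof. by rewrite -[LHS]/(complex.Re (l2dot x x)) l2dot_hsq. Qed.

Lemma l2_esumE x :
  (\esum_(i in [set: I]) (hsq (x i))%:E)%E = (hsq x)%:E.
Proof.
by rewrite l2_hsqE esum_nsum//; [exact: l2_hsq|move=> i; exact: hsq_ge0].
Qed.

Let l2_complete (u : nat -> L2) : hcauchy u -> exists l, hcvg u l.
Proof.
move=> cu.
have ci i : hcauchy (fun n => u n i).
  move=> e e0; have [N hN] := cu e e0; exists N => m n Nm Nn.
  have := hN m n Nm Nn; rewrite !hnorm_lt// l2_hsqE; apply: le_lt_trans.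
  exact: (hsq_le_nsum (u m - u n) i).
pose l i := projT1 (cid (hcomplete _ (ci i))).
have ul i : hcvg (fun n => u n i) (l i) by exact: (projT2 (cid _)).
have near_s (s : seq I) (d : R) : 0 < d -> exists M : nat,
    forall m : nat, (M <= m)%N -> forall i, i \in s -> hsq (u m i - l i) <= d ^+ 2.
  move=> d0; elim: s => [|i s [M hM]]; first by exists 0%N.
  have [M' hM'] := ul i _ d0; exists (maxn M M') => m.
  rewrite geq_max => /andP[Mm M'm] j; rewrite inE => /predU1P[->|]; last exact: hM.
  by apply: ltW; rewrite -hnorm_lt//; exact: hM'.
have close (e : R) : 0 < e -> exists N : nat, forall n : nat, (N <= n)%N ->
    (\esum_(i in [set: I]) (hsq (u n i - l i))%:E <= (4 * e ^+ 2)%:E)%E.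
  move=> e0; have [N hN] := cu _ e0; exists N => n Nn.
  apply: ge_ereal_sup => _ [X [finX _] <-].
  rewrite fsbig_finite//= sumEFin lee_fin.
  set s := fset_set X.
  pose k : R := (size s).+1%:R.
  have k0 : 0 < k by rewrite ltr0n.
  have [M hM] := near_s s _ (divr_gt0 e0 k0).
  pose m := maxn N M.
  have Nm : (N <= m)%N by rewrite leq_maxl.
  have Mm : (M <= m)%N by rewrite leq_maxr.
  have h1 : \sum_(i <- s) hsq (u n i - u m i) <= e ^+ 2.
    apply: le_trans (ltW (_ : hsq (u n - u m) < _)); last first.
      by rewrite -hnorm_lt//; exact: hN.
    rewrite -lee_fin -l2_esumE -sumEFin -fsbig_finite//.
    by apply: ereal_sup_ubound; exists X.
  have h2 : \sum_(i <- s) hsq (u m i - l i) <= e ^+ 2.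
    apply: (@le_trans _ _ (\sum_(i <- s) (e / k) ^+ 2)).
      by rewrite big_seq [leRHS]big_seq; apply: ler_sum => i; exact: hM.
    rewrite big_const_seq count_predT iter_addr addr0 -mulr_natr expr_div_n.
    rewrite -mulrA ler_piMr ?sqr_ge0// ler_pdivrMl ?exprn_gt0// mulr1.
    by rewrite -natrX ler_nat; apply: leq_trans (leqnSn _) _; exact: leq_pmulr.
  apply: (@le_trans _ _ (\sum_(i <- s)
      (hsq (u n i - u m i) *+ 2 + hsq (u m i - l i) *+ 2))).
    apply: ler_sum => i _; apply: le_trans (hsqD_le _ _).
    by rewrite addrA subrK.
  by rewrite big_split/= !sumrMnl; lra.
have l2ul n : (exists M : R,
    (\esum_(i in [set: I]) (hsq (u n i - l i))%:E <= M%:E)%E) ->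
    (fun i => u n i - l i) \in l2pred.
  case=> M hM; rewrite inE; apply: le_lt_trans (ltry M).
  by apply: le_trans hM; apply: le_esum => i _; rewrite hnorm_sq.
have [N hN] := close 1 ltr01.
have l2l : l \in l2pred.
  have := l2ul N (ex_intro _ (4 * 1 ^+ 2) (hN N (leqnn _))) => h.
  rewrite (_ : l = (u N : I -> H) - (fun i => u N i - l i)); last first.
    by apply/funext => i; rewrite !fctE opprB addrC subrK.
  by apply: rpredB => //; exact: l2funP.
exists (MkL2 l2l) => e e0.
have e30 : 0 < e / 3 by rewrite divr_gt0.
have [M hM] := close _ e30; exists M => n Mn.
rewrite hnorm_lt// -lte_fin -l2_esumE.
apply: le_lt_trans (hM n Mn) _; rewrite lte_fin.
by have : 0 < e ^+ 2 by [rewrite exprn_gt0//]; lra.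
Qed.

HB.instance Definition _ := PreHilbert_isHilbert.Build R L2 l2_complete.

End L2.

Notation ell2 R I := (L2 I R[i]^o).

(* The element of L2 I H with entries f i; 0 if they are not square-summable. *)
Definition mkl2 (R : realType) (I : choiceType) (H : hilbertType R)
    (f : I -> H) : L2 I H :=
  insubd (0 : L2 I H) f.

(* Operators are plain functions, with the pointwise linear structure. *)
Notation op H := (H -> H).

Section Operators.
Variables (R : realType).
Implicit Types (H K L : hilbertType R).

Definition opnorm H (T : op H) : R :=
  sup [set hnorm (T x) | x in [set x : H | hnorm x <= 1]].

Definition bounded_op H (T : op H) : Prop :=
  linear T /\ exists M : R, forall x : H, hnorm (T x) <= M * hnorm x.

Definition closed_subspace H (V : set (op H)) : Prop :=
  [/\ V `<=` @bounded_op H,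
      V 0,
      forall (c : R[i]) (S T : op H), V S -> V T -> V (c *: S + T)
    & forall T : op H, bounded_op T ->
        (forall e : R, 0 < e -> exists2 S : op H, V S & opnorm (T - S) < e) ->
        V T].

Definition operator_algebra H (A : set (op H)) : Prop :=
  closed_subspace A /\ forall S T : op H, A S -> A T -> A (S \o T).

Definition clspan H (S : set (op H)) : set (op H) :=
  smallest (@closed_subspace H) S.

Definition clalg H (S : set (op H)) : set (op H) :=
  smallest (@operator_algebra H) S.

Definition compact_op H (T : op H) : Prop :=
  bounded_op T /\
  forall x : nat -> H, (forall n : nat, hnorm (x n) <= 1) ->
    exists s : nat -> nat,
      (forall m n : nat, (m < n)%N -> (s m < s n)%N) /\
      exists l : H, hcvg (fun n : nat => T (x (s n))) l.

Definition unitary_op H (U : op H) : Prop :=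
  [/\ linear U, forall x y : H, hdot (U x) (U y) = hdot x y
    & forall y : H, exists x : H, U x = y].

Definition adj H (T : op H) : op H :=
  xget 0 [set S : op H | forall x y : H, hdot (T x) y = hdot x (S y)].

Definition linear_on H K (D : set (op H)) (phi : op H -> op K) : Prop :=
  forall (c : R[i]) (S T : op H), D S -> D T ->
    phi (c *: S + T) = c *: phi S + phi T.

Definition hom_on H K (A : set (op H)) (phi : op H -> op K) : Prop :=
  linear_on A phi /\
  forall S T : op H, A S -> A T -> phi (S \o T) = phi S \o phi T.

Definition bounded_linear_on H K (D : set (op H)) (phi : op H -> op K) : Prop :=
  linear_on D phi /\
  exists M : R, forall T : op H, D T ->
    bounded_op (phi T) /\ opnorm (phi T) <= M * opnorm T.

(* M_n(B(H)) acts on H^n = L2 'I_n H. *)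
Definition mxop H n (a : 'M[op H]_n) : op (L2 'I_n H) :=
  fun x => mkl2 (fun i : 'I_n => \sum_(j < n) a i j (x j)).

Definition completely_contractive H K (A : set (op H)) (phi : op H -> op K) :
    Prop :=
  forall (n : nat) (a : 'M[op H]_n), (forall i j : 'I_n, A (a i j)) ->
    opnorm (mxop (map_mx phi a)) <= opnorm (mxop a).

Definition completely_isometric H K (A : set (op H)) (phi : op H -> op K) :
    Prop :=
  forall (n : nat) (a : 'M[op H]_n), (forall i j : 'I_n, A (a i j)) ->
    opnorm (mxop (map_mx phi a)) = opnorm (mxop a).

Definition completely_isometric_iso H K (A : set (op H)) (B : set (op K))
    (phi : op H -> op K) : Prop :=
  [/\ hom_on A phi, completely_isometric A phi & phi @` A = B].

(* The unique bounded linear map, on the closed span of the S with P (S, T),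
   that sends S to T whenever P (S, T); its values elsewhere are unspecified. *)
Definition lin_ext H K (P : set (op H * op K)) : op H -> op K :=
  xget 0 [set phi : op H -> op K |
    bounded_linear_on (clspan [set p.1 | p in P]) phi /\
    forall p : op H * op K, P p -> phi p.1 = p.2].

Definition tensv (I : choiceType) H (v : H) (w : ell2 R I) : L2 I H :=
  mkl2 (fun i : I => (w i : R[i]) *: v).

(* v \otimes w for w in l^2(I) \otimes l^2(J). *)
Definition tensv2 (I J : choiceType) H (v : H) (w : L2 J (ell2 R I)) :
    L2 J (L2 I H) :=
  mkl2 (fun j : J => tensv v (w j)).

(* S \otimes T on H \otimes l^2(I), for S and T bounded. *)
Definition tens (I : choiceType) H (S : op H) (T : op (ell2 R I)) :
    op (L2 I H) :=
  xget 0 [set X : op (L2 I H) | bounded_op X /\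
    forall (v : H) (w : ell2 R I), X (tensv v w) = tensv (S v) (T w)].

(* S \otimes T on H \otimes (l^2(I) \otimes l^2(J)), this space being
   identified with (H \otimes l^2(I)) \otimes l^2(J) = L2 J (L2 I H). *)
Definition tens2 (I J : choiceType) H (S : op H) (T : op (L2 J (ell2 R I))) :
    op (L2 J (L2 I H)) :=
  xget 0 [set X : op (L2 J (L2 I H)) | bounded_op X /\
    forall (v : H) (w : L2 J (ell2 R I)), X (tensv2 v w) = tensv2 (S v) (T w)].

(* The spatial tensor product of two operator spaces, according to t = tens or
   t = tens2. *)
Definition mintens H K L (t : op H -> op K -> op L)
    (A : set (op H)) (B : set (op K)) : set (op L) :=
  clspan [set T | exists a b, [/\ A a, B b & T = t a b]].

(* phi \otimes psi on the spatial tensor product of A and B. *)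
Definition tensmap H K L H' K' L' (t : op H -> op K -> op L)
    (t' : op H' -> op K' -> op L') (A : set (op H)) (B : set (op K))
    (phi : op H -> op H') (psi : op K -> op K') : op L -> op L' :=
  lin_ext [set p : op L * op L' |
    exists a b, [/\ A a, B b & p = (t a b, t' (phi a) (psi b))]].

End Operators.

Section Groups.
Variables (R : realType) (G : groupType).
Implicit Types (H K : hilbertType R) (I : choiceType).
Local Open Scope group_scope.

Definition unitary_rep H (w : G -> op H) : Prop :=
  (forall g : G, unitary_op (w g)) /\ forall g h : G, w (g * h) = w g \o w h.

Definition group_alg H (w : G -> op H) : set (op H) :=
  clspan [set w g | g in [set: G]].

(* C^*(G) is the completion of C[G] in the largest norm coming from a unitary
   representation of G.  A representation u on l^2(I) realizes it faithfully,
   as group_alg u, when its norm on C[G] is the largest one. *)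
Definition full_group_rep I (u : G -> op (ell2 R I)) : Prop :=
  unitary_rep u /\
  forall K (w : G -> op K), unitary_rep w ->
  forall (n : nat) (g : 'I_n -> G) (c : 'I_n -> R[i]),
    opnorm (\sum_(i < n) c i *: w (g i))%R <=
    opnorm (\sum_(i < n) c i *: u (g i))%R.

Definition lreg (g : G) : op (ell2 R G) :=
  fun x => mkl2 (fun h : G => x (g^-1 * h)).

Definition reduced_alg : set (op (ell2 R G)) := group_alg lreg.

Definition comult I (w : G -> op (ell2 R I)) :
    op (ell2 R I) -> op (L2 I (ell2 R I)) :=
  lin_ext [set p | exists g : G, p = (w g, tens (w g) (w g))].

Definition lquot I (u : G -> op (ell2 R I)) : op (ell2 R I) -> op (ell2 R G) :=
  lin_ext [set p | exists g : G, p = (u g, lreg g)].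

Definition coaction_axioms I (w : G -> op (ell2 R I)) H (A : set (op H))
    (delta : op H -> op (L2 I H)) : Prop :=
  let C := group_alg w in
  let AC := mintens (@tens R I H) A C in
  [/\ operator_algebra A,
      hom_on A delta,
      forall a : op H, A a -> AC (delta a),
      (* (delta \otimes id) delta = (id \otimes Delta) delta *)
      forall a : op H, A a ->
        tensmap (@tens R I H) (@tens R I (L2 I H)) A C delta id (delta a) =
        tensmap (@tens R I H) (@tens2 R I I H) A C id (comult w) (delta a)
    & clspan [set T | exists a c,
        [/\ A a, C c & T = delta a \o tens (id : op H) c]] = AC].

Definition coaction I (u : G -> op (ell2 R I)) H (A : set (op H))
    (delta : op H -> op (L2 I H)) : Prop :=
  completely_contractive A delta /\ coaction_axioms u A delta.

Definition reduced_coaction H (B : set (op H)) (eps : op H -> op (L2 G H)) :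
    Prop :=
  completely_isometric B eps /\ coaction_axioms lreg B eps.

Definition delta_lambda I (u : G -> op (ell2 R I)) H (A : set (op H))
    (delta : op H -> op (L2 I H)) : op H -> op (L2 G H) :=
  fun a => tensmap (@tens R I H) (@tens R G H) A (group_alg u) id (lquot u)
    (delta a).

Definition normal_coaction I (u : G -> op (ell2 R I)) H (A : set (op H))
    (delta : op H -> op (L2 I H)) : Prop :=
  completely_isometric A (delta_lambda u A delta).

Definition c0 (f : G -> R[i]) : Prop :=
  forall e : R, (0 < e)%R ->
    finite_set [set g : G | ((e%:C)%C <= `|f g|)%R].

(* (M \otimes M)(F) on l^2(G) \otimes l^2(G), for a bounded function F on
   G x G; the entry of x at e_g \otimes e_h is x h g. *)
Definition mulop2 (F : G -> G -> R[i]) : op (L2 G (ell2 R G)) :=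
  fun x => mkl2 (fun h : G =>
    mkl2 (fun g : G => (F g h * (x h g : R[i]))%R : R[i]^o)).

(* U (e_g \otimes e_h) = e_g \otimes e_(gh) *)
Definition opU : op (L2 G (ell2 R G)) :=
  fun x => mkl2 (fun h : G => mkl2 (fun g : G => x (g^-1 * h) g)).

Section CrossedProduct.
Variables (H : hilbertType R) (A : set (op H)).
Variable dl : op H -> op (L2 G H).

Definition kA (a : op H) : op (L2 G (L2 G H)) :=
  tens (dl a) (id : op (ell2 R G)).

Definition kc0 (f : G -> R[i]) : op (L2 G (L2 G H)) :=
  tens2 (id : op H) (mulop2 (fun g h : G => f (g * h^-1))).

Definition kG (g : G) : op (L2 G (L2 G H)) :=
  tens (id : op (L2 G H)) (lreg g).

Definition double_crossed_product : set (op (L2 G (L2 G H))) :=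
  clalg [set T | exists a f g,
    [/\ A a, c0 f & T = kA a \o kc0 f \o kG g]].

Definition bidual_coaction (x : op (L2 G (L2 G H))) :
    op (L2 G (L2 G (L2 G H))) :=
  tens2 (id : op (L2 G H)) opU \o tens x (id : op (ell2 R G)) \o
  tens2 (id : op (L2 G H)) (adj opU).

Definition compacts : set (op (ell2 R G)) := [set T | compact_op T].

Definition stabilization : set (op (L2 G (L2 G H))) :=
  mintens (@tens R G (L2 G H)) (dl @` A) compacts.

Definition dl_inv (y : op (L2 G H)) : op H :=
  xget 0%R [set a : op H | A a /\ dl a = y].

Definition flip : op (L2 G (ell2 R G)) -> op (L2 G (ell2 R G)) :=
  lin_ext [set p | exists c k : op (ell2 R G),
    [/\ reduced_alg c, compacts k & p = (tens c k, tens k c)]].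

Definition stable_coaction (x : op (L2 G (L2 G H))) :
    op (L2 G (L2 G (L2 G H))) :=
  let t1 := @tens R G H in
  let t2 := @tens R G (L2 G H) in
  let x1 := tensmap t2 t1 (dl @` A) compacts dl_inv id x in
  let x2 := tensmap t1 t2 A compacts dl id x1 in
  let x3 := tensmap (@tens2 R G G H) (@tens2 R G G (L2 G H))
    A (mintens (@tens R G (ell2 R G)) reduced_alg compacts) dl flip x2 in
  tens2 (id : op (L2 G H)) (adj opU) \o x3 \o tens2 (id : op (L2 G H)) opU.

End CrossedProduct.

End Groups.

(* Main.v *)
Require Import Defs.
From mathcomp Require Import all_boot all_order all_algebra complex finmap.
From mathcomp Require Import all_classical all_reals.
From mathcomp Require Import ereal numfun esum.
From mathcomp Require Import ring lra.

Set Implicit Arguments.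
Unset Strict Implicit.
Unset Printing Implicit Defensive.

Import Order.TTheory GRing.Theory Num.Theory.

(* Since G is discrete, slicing delta(a) with the coefficient functionals
   c |-> <lambda(c) e_h, e_g> of C^*(G) gives elements b of A with
   delta(b) = b \otimes u_(gh^-1), and nondegeneracy shows that A is the closed
   span of such homogeneous elements, for which delta_lambda(b) = b \otimes lambda_s.
   Hence delta_lambda(A) \otimes K is the closed span of the operators
   b \otimes lambda_s \otimes e_(p,q), with b homogeneous of degree s.  The unitary
   V (e_g \otimes e_h) = e_g \otimes e_(g h^-1) conjugates the generator
   k_A(b) k_c0(delta_t) k_G(r) of the double crossed product to the operator with
   p = st and q = tr, so Psi = Ad(V).  On these generators both coactions are
   x |-> x \otimes lambda_r with r = p^-1 s q, and all the maps involved are bounded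
   and linear, so everything is checked on generators.
   An operator on H \otimes l^2(I) is handled through its matrix of operators on H;
   a completely contractive phi gives phi \otimes id by acting entrywise. *)

Local Open Scope classical_set_scope.
Local Open Scope ring_scope.

(** * Hilbert spaces and bounded operators *)

(** [A] need not be self-adjoint, so no C*-identity makes a homomorphism bounded: all norm control
    comes from complete contractivity of [delta] and from normality, and even the multiplicativity
    of [delta_lambda] is proved through homogeneous elements. An entry of [delta(a)] is homogeneous
    for the following reason. Apply the coefficient functional of [(g, h)] to the last leg of the
    coaction identity. On one side this gives [delta] of the entry; on the other, a term
    [a \otimes u_k \otimes u_k] survives only for [k = g h^-1], since only that [lambda_k] sends
    [e_h] to [e_g]. Nondegeneracy, applied to [a \otimes u_1], then recovers every [a] from such
    entries. Maps defined by extension are chosen values with default 0. Before such a map is used,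
    either a bounded extension is exhibited (from an implementing unitary or from complete
    contractivity), or the case of the default is treated separately. *)

Section HilbertBasics.
Variables (R : realType) (V : preHilbertType R).
Implicit Types (x y z : V) (a : R[i]).

Lemma hsq_cplx (z : R[i]^o) : hsq z = complex.Re z ^+ 2 + complex.Im z ^+ 2.
Proof. by rewrite /hsq /hdot/=; case: z => s t /=; rewrite mulrN opprK. Qed.

Lemma hsqZE a x : hsq (a *: x) = hsq (a : R[i]^o) * hsq x.
Proof. by rewrite hsqZ hsq_cplx. Qed.

Lemma hnormE x : hnorm x = Num.sqrt (hsq x).
Proof. by []. Qed.

Lemma hnormZ a x : hnorm (a *: x) = hnorm (a : R[i]^o) * hnorm x.
Proof. by rewrite !hnormE hsqZE sqrtrM// hsq_ge0. Qed.

Lemma hsq_eq0 x : hsq x = 0 -> x = 0.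
Proof.
move=> h; apply/eqP/negPn/negP => /hdot_gt0.
by rewrite hdot_hsq h ltxx.
Qed.

Lemma hnorm_eq0 x : hnorm x = 0 -> x = 0.
Proof. by move=> h; apply: hsq_eq0; rewrite -hnorm_sq h expr0n. Qed.

Lemma hnorm0 : hnorm (0 : V) = 0.
Proof. by rewrite hnormE hsq0 sqrtr0. Qed.

Lemma hnormN x : hnorm (- x) = hnorm x.
Proof. by rewrite !hnormE hsqN. Qed.

Lemma hnorm_le x (e : R) : 0 <= e -> (hnorm x <= e) = (hsq x <= e ^+ 2).
Proof.
by move=> e0; rewrite -hnorm_sq ler_pXn2r// nnegrE hnorm_ge0.
Qed.

Lemma hdotNr x y : hdot x (- y) = - hdot x y.
Proof. by rewrite -scaleN1r hdotZr rmorphN rmorph1 mulN1r. Qed.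

Lemma hdot0r x : hdot x (0 : V) = 0.
Proof. by rewrite hdotC hdot0l conjc0. Qed.

Lemma hdotBl x y z : hdot (x - y) z = hdot x z - hdot y z.
Proof. by rewrite hdotDl -scaleN1r hdotZl mulN1r. Qed.

Lemma hdot_sqC x y : hsq (hdot x y : R[i]^o) <= hsq x * hsq y.
Proof.
have [->|y0] := eqVneq y 0; first by rewrite hdot0r !hsq0 mulr0.
have n0 : 0 < hsq y by rewrite -ltcR -hdot_hsq hdot_gt0.
set c : R[i] := hdot x y.
(* This square norm equals [|y|^2 (|x|^2 |y|^2 - |c|^2)]; scaling [x] by [|y|^2] avoids a
   division. *)
have := hsq_ge0 ((hsq y)%:C%C *: x - c *: y).
rewrite hsqDN !hsqZE hdotZl hdotZr -/c.
have -> : hsq ((hsq y)%:C%C : R[i]^o) = hsq y ^+ 2.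
  by rewrite hsq_cplx/= expr0n addr0.
rewrite -[complex.Re _]/(complex.Re ((hsq y)%:C%C * (c^*%C * c))).
have -> : complex.Re ((hsq y)%:C%C * (c^*%C * c)) = hsq y * hsq (c : R[i]^o).
  by rewrite hsq_cplx; case: c => s t /=; ring.
rewrite expr2 => h.
rewrite -(ler_pM2l n0).
by move: h; rewrite -!mulrA; lra.
Qed.

End HilbertBasics.

Section HilbertNorm.
Variables (R : realType) (V : preHilbertType R).
Implicit Types (x y z : V) (a : R[i]).

Lemma Re_le_hnorm (z : R[i]^o) : complex.Re z <= hnorm z.
Proof.
apply: (le_trans (ler_norm _)).
rewrite -(@ler_pXn2r _ 2%N) ?nnegrE ?hnorm_ge0// hnorm_sq hsq_cplx.
by rewrite real_normK ?num_real// lerDl sqr_ge0.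
Qed.

Lemma hnorm_real (r : R) : hnorm (r%:C%C : R[i]^o) = `|r|.
Proof. by rewrite hnormE hsq_cplx/= expr0n addr0 sqrtr_sqr. Qed.

Lemma hdot_CS x y : hnorm (hdot x y : R[i]^o) <= hnorm x * hnorm y.
Proof.
rewrite hnorm_le ?mulr_ge0 ?hnorm_ge0//.
by rewrite exprMn !hnorm_sq hdot_sqC.
Qed.

Lemma hnorm_add x y : hnorm (x + y) <= hnorm x + hnorm y.
Proof.
rewrite hnorm_le ?addr_ge0 ?hnorm_ge0// hsqD sqrrD !hnorm_sq.
rewrite [leRHS]addrAC lerD2l lerMn2r/=.
exact: le_trans (Re_le_hnorm _) (hdot_CS _ _).
Qed.

Lemma hnorm_sub x y : hnorm (x - y) <= hnorm x + hnorm y.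
Proof. by rewrite -(hnormN y) hnorm_add. Qed.

Lemma hnorm_distC x y : hnorm (x - y) = hnorm (y - x).
Proof. by rewrite -hnormN opprB. Qed.

Lemma hnorm_split x y z : hnorm (x - z) <= hnorm (x - y) + hnorm (y - z).
Proof. by rewrite -{1}(subrK y x) -addrA hnorm_add. Qed.

Lemma hdot_suml (I : Type) (r : seq I) (F : I -> V) y :
  hdot (\sum_(i <- r) F i) y = \sum_(i <- r) hdot (F i) y.
Proof.
elim: r => [|i r ih]; first by rewrite !big_nil hdot0l.
by rewrite !big_cons hdotDl ih.
Qed.

Lemma hdot_sumr (I : Type) (r : seq I) (F : I -> V) y :
  hdot y (\sum_(i <- r) F i) = \sum_(i <- r) hdot y (F i).
Proof.
elim: r => [|i r ih]; first by rewrite !big_nil hdot0r.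
by rewrite !big_cons hdotDr ih.
Qed.

Lemma hdot_ext x y : (forall z, hdot x z = hdot y z) -> x = y.
Proof.
move=> h; apply/eqP; rewrite -subr_eq0; apply/eqP/hsq_eq0.
by rewrite /hsq hdotBl h subrr.
Qed.

Lemma hnorm_small x : (forall e : R, 0 < e -> hnorm x <= e) -> x = 0.
Proof.
move=> h; apply/hnorm_eq0/eqP; rewrite eq_le hnorm_ge0 andbT.
by apply/ler_addgt0Pr => e e0; rewrite add0r h.
Qed.

Lemma invS_lt_near (e : R) : 0 < e ->
  exists N : nat, forall n : nat, (N <= n)%N -> (n.+1%:R)^-1 <= e.
Proof.
move=> e0; exists (Num.trunc e^-1) => n Nn.
rewrite invf_ple ?posrE//; apply/ltW; apply: (lt_le_trans (truncnS_gt _)).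
by rewrite ler_nat ltnS.
Qed.

Lemma hcvg_unique (s : nat -> V) x y : hcvg s x -> hcvg s y -> x = y.
Proof.
move=> hx hy; apply/eqP; rewrite -subr_eq0; apply/eqP/hnorm_small => e e0.
have e20 : 0 < e / 2 by rewrite divr_gt0.
have [N hN] := hx _ e20; have [M hM] := hy _ e20.
have := hN (maxn N M) (leq_maxl _ _); have := hM (maxn N M) (leq_maxr _ _).
have := hnorm_split x (s (maxn N M)) y; rewrite (hnorm_distC x (s _)).
lra.
Qed.

End HilbertNorm.

Section Bounded.
Variable R : realType.
Implicit Types H K E : hilbertType R.

(* [bounded_op], for maps between different spaces. *)
Definition blin H K (T : H -> K) : Prop :=
  linear T /\ exists M : R, forall x : H, hnorm (T x) <= M * hnorm x.

Section Linear.
Variables (H K : hilbertType R) (T : H -> K).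
Hypothesis lT : linear T.

Lemma linear_add x y : T (x + y) = T x + T y.
Proof. by have := lT 1 x y; rewrite !scale1r. Qed.

Lemma linear_zero : T 0 = 0.
Proof. by have := lT (-1) 0 0; rewrite !scaleN1r !addNr. Qed.

Lemma linear_scale a x : T (a *: x) = a *: T x.
Proof. by have := lT a x 0; rewrite linear_zero !addr0. Qed.

Lemma linear_opp x : T (- x) = - T x.
Proof. by rewrite -scaleN1r linear_scale scaleN1r. Qed.

Lemma linear_sub x y : T (x - y) = T x - T y.
Proof. by rewrite linear_add linear_opp. Qed.

Lemma linear_bigsum (I : Type) (r : seq I) (F : I -> H) :
  T (\sum_(i <- r) F i) = \sum_(i <- r) T (F i).
Proof.
elim: r => [|i r ih]; first by rewrite !big_nil linear_zero.
by rewrite !big_cons linear_add ih.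
Qed.

End Linear.

Lemma blin_pos H K (T : H -> K) : blin T ->
  exists2 M : R, 0 <= M & forall x : H, hnorm (T x) <= M * hnorm x.
Proof.
move=> [_ [M hM]]; exists (Num.max M 0); first by rewrite le_max lexx orbT.
move=> x; apply: (le_trans (hM x)); apply: ler_wpM2r; first exact: hnorm_ge0.
by rewrite le_max lexx.
Qed.

Lemma blin_comp H K E (S : K -> E) (T : H -> K) :
  blin S -> blin T -> blin (S \o T).
Proof.
move=> bS bT; split.
  by move=> a x y /=; rewrite bT.1 bS.1.
have [M M0 hM] := blin_pos bS; have [N N0 hN] := blin_pos bT.
exists (M * N) => x /=; apply: (le_trans (hM _)).
by rewrite -mulrA ler_wpM2l.
Qed.

Lemma blin_lin H K (c : R[i]) (S T : H -> K) :
  blin S -> blin T -> blin (fun x => c *: S x + T x).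
Proof.
move=> bS bT; split.
  move=> a x y /=; rewrite bT.1 bS.1 !scalerDr !scalerA [c * a]mulrC.
  by rewrite !addrA; congr (_ + _); rewrite -!addrA; congr (_ + _); rewrite addrC.
have [M M0 hM] := blin_pos bS; have [N N0 hN] := blin_pos bT.
exists (hnorm (c : R[i]^o) * M + N) => x; apply: (le_trans (hnorm_add _ _)).
by rewrite mulrDl lerD// hnormZ -mulrA ler_wpM2l ?hnorm_ge0//.
Qed.

Lemma blin0 H K : blin (fun _ : H => 0 : K).
Proof.
split; first by move=> a x y; rewrite scaler0 addr0.
by exists 0 => x; rewrite hnorm0 mul0r.
Qed.

Lemma blin_id H : blin (fun x : H => x).
Proof. by split=> //; exists 1 => x; rewrite mul1r. Qed.

Lemma blin_sum H K (I : Type) (r : seq I) (F : I -> H -> K) :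
  (forall i, blin (F i)) -> blin (fun x => \sum_(i <- r) F i x).
Proof.
move=> bF; elim: r => [|i r ih].
  by under eq_fun do rewrite big_nil; exact: blin0.
under eq_fun do rewrite big_cons -[F i _]scale1r.
exact: blin_lin.
Qed.

Lemma bounded_comp H (S T : op H) :
  bounded_op S -> bounded_op T -> bounded_op (S \o T).
Proof. exact: blin_comp. Qed.

Lemma bounded_lin H c (S T : op H) :
  bounded_op S -> bounded_op T -> bounded_op (c *: S + T).
Proof. exact: blin_lin. Qed.

Lemma bounded0 H : bounded_op (0 : op H).
Proof. exact: blin0. Qed.

Lemma bounded_id H : bounded_op (id : op H).
Proof. exact: blin_id. Qed.

Lemma bounded_sub H (S T : op H) :
  bounded_op S -> bounded_op T -> bounded_op (S - T).
Proof. by move=> bS bT; rewrite addrC -scaleN1r; exact: bounded_lin. Qed.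

Lemma bounded_scale H c (S : op H) : bounded_op S -> bounded_op (c *: S).
Proof. by move=> bS; rewrite -[_ *: _]addr0; exact/bounded_lin/bounded0. Qed.

Section Opnorm.
Variable H : hilbertType R.
Implicit Types S T : op H.

Lemma opnorm_le T (M : R) : 0 <= M ->
  (forall x : H, hnorm (T x) <= M * hnorm x) -> opnorm T <= M.
Proof.
move=> M0 hM; apply: ge_sup.
  by exists (hnorm (T 0)), 0 => //=; rewrite hnorm0.
move=> _ [x /= x1 <-]; apply: (le_trans (hM x)).
by rewrite ler_piMr.
Qed.

(** A supremum is meaningful only for a set that is bounded above; hence the boundedness hypotheses
    in every estimate by [opnorm]. *)
Lemma opnorm_has_sup T : bounded_op T ->
  has_sup [set hnorm (T x) | x in [set x : H | hnorm x <= 1]].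
Proof.
move=> /blin_pos[M M0 hM]; split.
  by exists (hnorm (T 0)), 0 => //=; rewrite hnorm0.
exists M => _ [x /= x1 <-]; apply: (le_trans (hM x)).
by rewrite ler_piMr.
Qed.

Lemma opnorm_ge0 T : bounded_op T -> 0 <= opnorm T.
Proof.
move=> bT; apply: le_trans (hnorm_ge0 (T 0)) _.
apply: sup_upper_bound; first exact: opnorm_has_sup.
by exists 0 => //=; rewrite hnorm0.
Qed.

Lemma le_opnorm T x : bounded_op T -> hnorm (T x) <= opnorm T * hnorm x.
Proof.
move=> bT; have [->|x0] := eqVneq x 0.
  by rewrite (linear_zero bT.1) hnorm0 mulr0.
have n0 : 0 < hnorm x.
  rewrite lt_def hnorm_ge0 andbT; apply: contra x0 => /eqP h.
  exact/eqP/hnorm_eq0.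
rewrite -ler_pdivrMr//.
have -> : hnorm (T x) / hnorm x = hnorm (T (((hnorm x)^-1)%:C%C *: x)).
  rewrite (linear_scale bT.1) hnormZ mulrC; congr (_ * _).
  by rewrite hnorm_real ger0_norm// invr_ge0 ltW.
apply: sup_upper_bound; first exact: opnorm_has_sup.
exists (((hnorm x)^-1)%:C%C *: x) => //=.
by rewrite hnormZ hnorm_real ger0_norm ?invr_ge0 ?(ltW n0)// mulVf// gt_eqF.
Qed.

Lemma opnormD S T : bounded_op S -> bounded_op T ->
  opnorm (S + T) <= opnorm S + opnorm T.
Proof.
move=> bS bT; apply: opnorm_le; first by rewrite addr_ge0 ?opnorm_ge0.
move=> x; apply: (le_trans (hnorm_add _ _)).
by rewrite mulrDl lerD ?le_opnorm.
Qed.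

Lemma opnorm_comp S T : bounded_op S -> bounded_op T ->
  opnorm (S \o T) <= opnorm S * opnorm T.
Proof.
move=> bS bT; apply: opnorm_le; first by rewrite mulr_ge0 ?opnorm_ge0.
move=> x /=; apply: (le_trans (le_opnorm _ bS)).
by rewrite -mulrA ler_wpM2l ?opnorm_ge0 ?le_opnorm.
Qed.

Lemma opnorm0 : opnorm (0 : op H) = 0.
Proof.
apply/eqP; rewrite eq_le opnorm_ge0 ?andbT; last exact: bounded0.
by apply: opnorm_le => // x; rewrite mul0r hnorm0.
Qed.

Lemma opnormN S : opnorm (- S) = opnorm S.
Proof.
rewrite /opnorm; congr sup; apply/seteqP.
by split=> _ [x x1 <-]; exists x => //; rewrite hnormN.
Qed.

Lemma opnorm_eq0 S : bounded_op S -> opnorm S = 0 -> S = 0.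
Proof.
move=> bS h; apply/funext => x; apply/hnorm_eq0/eqP.
by rewrite eq_le hnorm_ge0 andbT (le_trans (le_opnorm _ bS))// h mul0r.
Qed.

End Opnorm.
End Bounded.

(** * Closed spans and bounded linear maps on them *)

Section ClosedSpans.
Variable R : realType.
Implicit Types H K E : hilbertType R.

Lemma closed_subspace_bounded H : closed_subspace (@bounded_op R H).
Proof.
by split=> //; [exact: bounded0|move=> c S T; exact: bounded_lin].
Qed.

(** Boundedness of [S] provides one closed subspace that contains it, namely all bounded operators.
    Without any, the intersection would be the set of all functions. *)
Lemma smallest_closed H (S : set (op H)) : S `<=` @bounded_op R H ->
  closed_subspace (clspan S).
Proof.
move=> bS; split.
- by apply: smallest_sub => //; exact: closed_subspace_bounded.
- by move=> V [[_ V0 _ _] _].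
- move=> c T1 T2 h1 h2 V [cV SV].
  by case: (cV) => _ _ + _; apply; [exact: h1|exact: h2].
- move=> T bT h V [cV SV]; case: (cV) => _ _ _; apply => // e e0.
  by have [T' h' le] := h e e0; exists T' => //; exact: h'.
Qed.

Lemma sub_clspan H (S : set (op H)) : S `<=` clspan S.
Proof. exact: sub_gen_smallest. Qed.

Lemma clspan_sub H (S V : set (op H)) :
  closed_subspace V -> S `<=` V -> clspan S `<=` V.
Proof. by move=> cV SV; exact: smallest_sub. Qed.

Lemma clspan_bounded H (S : set (op H)) : S `<=` @bounded_op R H ->
  clspan S `<=` @bounded_op R H.
Proof. by move=> bS; case: (smallest_closed bS). Qed.

Section OneSubspace.
Variables (H : hilbertType R) (V : set (op H)) (cV : closed_subspace V).

Lemma closed_bounded T : V T -> bounded_op T.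
Proof. by case: cV => + _ _ _; exact. Qed.

Lemma closed_zero : V 0.
Proof. by case: cV. Qed.

Lemma closed_lin c S T : V S -> V T -> V (c *: S + T).
Proof. by case: cV => _ _ + _; exact. Qed.

Lemma closed_add S T : V S -> V T -> V (S + T).
Proof. by rewrite -{2}[S]scale1r; exact: closed_lin. Qed.

Lemma closed_scale c S : V S -> V (c *: S).
Proof.
by move=> VS; rewrite -[_ *: _]addr0; apply: closed_lin => //; exact: closed_zero.
Qed.

Lemma closed_sub S T : V S -> V T -> V (S - T).
Proof. by move=> VS VT; rewrite addrC -scaleN1r; exact: closed_lin. Qed.

Lemma closed_sum (I : Type) (r : seq I) (F : I -> op H) :
  (forall i, V (F i)) -> V (\sum_(i <- r) F i).
Proof.
move=> VF; elim: r => [|i r ih]; first by rewrite big_nil; exact: closed_zero.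
by rewrite big_cons; exact: closed_add.
Qed.

Lemma closed_lim T : bounded_op T ->
  (forall e : R, 0 < e -> exists2 S : op H, V S & opnorm (T - S) < e) -> V T.
Proof. by case: cV => _ _ _; exact. Qed.

End OneSubspace.

(* Vector-valued maps cover both functionals and, pointwise, maps into
   operators. *)
Definition blf H E (D : set (op H)) (f : op H -> E) : Prop :=
  (forall (c : R[i]) (S T : op H), D S -> D T ->
    f (c *: S + T) = c *: f S + f T) /\
  exists M : R, forall T : op H, D T -> hnorm (f T) <= M * opnorm T.

(** Applied to a difference, this shows that bounded linear maps which agree on generators agree on
    their closed span. *)
Lemma blf_ker_closed H E (D : set (op H)) (f : op H -> E) :
  closed_subspace D -> blf D f -> closed_subspace [set T | D T /\ f T = 0].
Proof.
move=> cD [lf [M hM]].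
have f0 : f 0 = 0.
  have := lf (-1) 0 0 (closed_zero cD) (closed_zero cD).
  by rewrite !scaleN1r !addNr.
split.
- by move=> T [/(closed_bounded cD)].
- by split => //; exact: closed_zero.
- move=> c S T [DS fS] [DT fT]; split; first exact: closed_lin.
  by rewrite lf// fS fT scaler0 addr0.
- move=> T bT h.
  have DT : D T.
    by apply: (closed_lim cD) => // e e0; have [S [? _] ?] := h e e0; exists S.
  split=> //; apply: hnorm_small => e e0.
  (* The constant [M] may be zero or negative, so a positive one replaces it before dividing. *)
  have M10 : 0 < `|M| + 1 by rewrite ltr_wpDl.
  have [S [DS fS] le] := h _ (divr_gt0 e0 M10).
  have -> : f T = f (T - S).
    by rewrite addrC -scaleN1r lf// fS scaler0 add0r.
  have DTS : D (T - S) by exact: closed_sub.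
  apply: (le_trans (hM _ DTS)).
  apply: (@le_trans _ _ ((`|M| + 1) * opnorm (T - S))).
    apply: ler_wpM2r; first exact/opnorm_ge0/(closed_bounded cD).
    by rewrite (le_trans (ler_norm M))// lerDl.
  by rewrite mulrC -ler_pdivlMr// ltW.
Qed.

Lemma blf_sub H E (D : set (op H)) (f g : op H -> E) :
  D `<=` @bounded_op R H ->
  blf D f -> blf D g -> blf D (fun T => f T - g T).
Proof.
move=> bD [lf [M hM]] [lg [N hN]]; split.
  move=> c S T DS DT; rewrite lf// lg// opprD scalerBr.
  by rewrite !addrA; congr (_ + _); rewrite -!addrA; congr (_ + _); rewrite addrC.
exists (M + N) => T DT; apply: le_trans (hnorm_sub _ _) _.
by rewrite mulrDl lerD ?hM ?hN.
Qed.

Lemma blf_eq H E (S : set (op H)) (f g : op H -> E) :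
  S `<=` @bounded_op R H -> blf (clspan S) f -> blf (clspan S) g ->
  (forall T, S T -> f T = g T) -> forall T, clspan S T -> f T = g T.
Proof.
move=> bS bf bg fg T ST.
have cS := smallest_closed bS.
have := blf_ker_closed cS (blf_sub (clspan_bounded bS) bf bg).
move=> h; have [] := @clspan_sub _ S _ h _ T ST.
  move=> X SX; split; first exact: sub_clspan.
  by rewrite fg// subrr.
by move=> _ /eqP; rewrite subr_eq0 => /eqP.
Qed.

Lemma bl_at H K (D : set (op H)) (phi : op H -> op K) :
  bounded_linear_on D phi -> forall x, blf D (fun T => phi T x).
Proof.
move=> [lf [M hM]] x; split; first by move=> c S T DS DT; rewrite lf.
exists (M * hnorm x) => T DT; have [b le] := hM T DT.
by apply: (le_trans (le_opnorm _ b)); rewrite mulrAC ler_wpM2r ?hnorm_ge0.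
Qed.

Lemma bl_eq H K (S : set (op H)) (f g : op H -> op K) :
  S `<=` @bounded_op R H ->
  bounded_linear_on (clspan S) f -> bounded_linear_on (clspan S) g ->
  (forall T, S T -> f T = g T) -> forall T, clspan S T -> f T = g T.
Proof.
move=> bS bf bg fg T ST; apply/funext => x.
by apply: (blf_eq bS (bl_at bf x) (bl_at bg x)) => // X SX; rewrite fg.
Qed.

(** The condition [D T] belongs to the set because nothing is known about [phi] outside [D];
    closedness of [D] lets the bound apply at the limit too. *)
Lemma bl_preimage_closed H K (D : set (op H)) (V : set (op K))
    (phi : op H -> op K) :
  closed_subspace D -> closed_subspace V -> bounded_linear_on D phi ->
  closed_subspace [set T | D T /\ V (phi T)].
Proof.
move=> cD cV [lf [M hM]].
have f0 : phi 0 = 0.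
  have := lf (-1) 0 0 (closed_zero cD) (closed_zero cD).
  by rewrite !scaleN1r !addNr.
split.
- by move=> T [/(closed_bounded cD)].
- by split; [|rewrite f0]; exact: closed_zero.
- move=> c S T [DS fS] [DT fT]; split; first exact: closed_lin.
  by rewrite lf//; exact: closed_lin.
- move=> T bT h.
  have DT : D T.
    by apply: (closed_lim cD) => // e e0; have [S [? _] ?] := h e e0; exists S.
  split=> //; apply: (closed_lim cV); first exact: (hM _ DT).1.
  move=> e e0.
  have M10 : 0 < `|M| + 1 by rewrite ltr_wpDl.
  have [S [DS VS] le] := h _ (divr_gt0 e0 M10).
  exists (phi S) => //.
  have -> : phi T - phi S = phi (T - S).
    have <- : (-1 : R[i]) *: S + T = T - S by rewrite scaleN1r addrC.
    by rewrite lf// scaleN1r addrC.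
  have DTS : D (T - S) by exact: closed_sub.
  apply: (le_lt_trans (hM _ DTS).2).
  apply: (@le_lt_trans _ _ ((`|M| + 1) * opnorm (T - S))).
    apply: ler_wpM2r; first exact/opnorm_ge0/(closed_bounded cD).
    by rewrite (le_trans (ler_norm M))// lerDl.
  by rewrite mulrC -ltr_pdivlMr.
Qed.

Lemma bl_clspan_sub H K (S : set (op H)) (V : set (op K))
    (phi : op H -> op K) :
  S `<=` @bounded_op R H -> closed_subspace V ->
  bounded_linear_on (clspan S) phi ->
  (forall T, S T -> V (phi T)) -> forall T, clspan S T -> V (phi T).
Proof.
move=> bS cV bphi h T ST.
have := bl_preimage_closed (smallest_closed bS) cV bphi.
move=> c; have [] := @clspan_sub _ S _ c _ T ST => //.
by move=> X SX; split; [exact: sub_clspan|exact: h].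
Qed.

Lemma bl_comp H K E (D : set (op H)) (D' : set (op K))
    (phi : op H -> op K) (psi : op K -> op E) :
  bounded_linear_on D phi -> (forall T, D T -> D' (phi T)) ->
  bounded_linear_on D' psi -> bounded_linear_on D (psi \o phi).
Proof.
move=> [lf [M hM]] DD' [lg [N hN]]; split.
  by move=> c S T DS DT /=; rewrite lf// lg//; exact: DD'.
exists (`|N| * M) => T DT /=; have [b1 l1] := hM _ DT.
have [b2 l2] := hN _ (DD' _ DT); split=> //; apply: (le_trans l2).
apply: (@le_trans _ _ (`|N| * opnorm (phi T))).
  by rewrite ler_wpM2r ?ler_norm// opnorm_ge0.
by rewrite -mulrA ler_wpM2l.
Qed.

Lemma bl_sub H K (D D' : set (op H)) (phi : op H -> op K) :
  D `<=` D' -> bounded_linear_on D' phi -> bounded_linear_on D phi.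
Proof.
move=> DD' [lf [M hM]]; split.
  by move=> c S T /DD' DS /DD' DT; exact: lf.
by exists M => T /DD'; exact: hM.
Qed.

Lemma bl_eqfun H K (D : set (op H)) (phi psi : op H -> op K) :
  closed_subspace D ->
  (forall T, D T -> phi T = psi T) ->
  bounded_linear_on D psi -> bounded_linear_on D phi.
Proof.
move=> cD e [lf [M hM]]; split.
  by move=> c S T DS DT; rewrite !e//; [exact: lf|exact: closed_lin].
by exists M => T DT; rewrite e//; exact: hM.
Qed.

Lemma bl_mull H (S : op H) : bounded_op S ->
  bounded_linear_on (@bounded_op R H) (fun T => S \o T).
Proof.
move=> bS; split.
  by move=> c T T' _ _; apply/funext => x /=; rewrite bS.1.
exists (opnorm S) => T bT; split; first exact: bounded_comp.
exact: opnorm_comp.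
Qed.

Lemma bl_mulr H (S : op H) : bounded_op S ->
  bounded_linear_on (@bounded_op R H) (fun T => T \o S).
Proof.
move=> bS; split; first by move=> c T T' _ _; apply/funext.
exists (opnorm S) => T bT; split; first exact: bounded_comp.
by rewrite mulrC; exact: opnorm_comp.
Qed.

(** Exhibiting any bounded extension makes the choice in [lin_ext] succeed; by [bl_eq] the chosen
    map then coincides with the exhibited one on the closed span. *)
Lemma lin_ext_spec H K (P : set (op H * op K)) (phi : op H -> op K) :
  bounded_linear_on (clspan [set p.1 | p in P]) phi ->
  (forall p, P p -> phi p.1 = p.2) ->
  bounded_linear_on (clspan [set p.1 | p in P]) (lin_ext P) /\
  forall p, P p -> lin_ext P p.1 = p.2.
Proof.
move=> b e; rewrite /lin_ext; set Q := [set _ | _].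
by have := @xgetPex _ (0 : op H -> op K) Q; apply; exists phi.
Qed.

(** For the maps attached to [u], where no extension is exhibited, the argument continues from this
    alternative. *)
Lemma lin_ext_dflt H K (P : set (op H * op K)) :
  (bounded_linear_on (clspan [set p.1 | p in P]) (lin_ext P) /\
   forall p, P p -> lin_ext P p.1 = p.2) \/ lin_ext P = 0.
Proof.
rewrite /lin_ext; set Q := [set _ | _].
by case: xgetP => [phi -> h|h]; [left|right].
Qed.

Lemma clalg_algebra H (S : set (op H)) : S `<=` @bounded_op R H ->
  operator_algebra (clalg S).
Proof.
move=> bS; split; last first.
  move=> T T' h h' V [oV SV]; apply: oV.2; [exact: h|exact: h'].
split.
- apply: smallest_sub => //; split; first exact: closed_subspace_bounded.
  by move=> T T'; exact: bounded_comp.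
- by move=> V [[[_ V0 _ _] _] _].
- move=> c T1 T2 h1 h2 V [oV SV].
  by case: (oV.1) => _ _ + _; apply; [exact: h1|exact: h2].
- move=> T bT h V [oV SV]; case: (oV.1) => _ _ _; apply => // e e0.
  by have [T' h' le] := h e e0; exists T' => //; exact: h'.
Qed.

Lemma clspan_algebra H (S : set (op H)) : S `<=` @bounded_op R H ->
  (forall T T', S T -> S T' -> clspan S (T \o T')) ->
  operator_algebra (clspan S).
Proof.
move=> bS mS; have cS := smallest_closed bS; split=> //.
move=> T T' hT; move: T'.
have step X : clspan S X -> (forall T', S T' -> clspan S (X \o T')) ->
    forall T', clspan S T' -> clspan S (X \o T').
  move=> SX h; apply: (@bl_clspan_sub H H S (clspan S)) => //.
  apply: bl_sub (bl_mull (clspan_bounded bS SX)).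
  exact: clspan_bounded.
apply: (step T hT) => T' ST'; move: T hT.
apply: (@bl_clspan_sub H H S (clspan S)) => //.
  apply: bl_sub (bl_mulr (bS _ ST')).
  exact: clspan_bounded.
by move=> T ST; exact: mS.
Qed.

End ClosedSpans.

(** * Square-summable families *)

Section SquareSummable.
Variables (R : realType) (I : choiceType).

Lemma sum_le_subset (F F' : seq I) (p : I -> R) : uniq F -> uniq F' ->
  {subset F <= F'} -> (forall i, 0 <= p i) ->
  \sum_(i <- F) p i <= \sum_(i <- F') p i.
Proof.
move=> uF uF' FF' p0.
have -> : \sum_(i <- F) p i = \sum_(i <- F' | i \in F) p i.
  rewrite -[RHS]big_filter; apply: perm_big; apply: uniq_perm => //.
    exact: filter_uniq.
  by move=> i; rewrite mem_filter; case: (boolP (i \in F)) => //= /FF' ->.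
by rewrite big_mkcond; apply: ler_sum => i _; case: ifP.
Qed.

Section L2Basics.
Variable H : hilbertType R.
Implicit Types (x y : L2 I H) (f : I -> H) (F : seq I).

Lemma L2_ext x y : (forall i, x i = y i) -> x = y.
Proof. by move=> h; apply/val_inj/funext => i; exact: h. Qed.

Lemma L2_addE x y i : (x + y) i = x i + y i. Proof. by []. Qed.
Lemma L2_scaleE (a : R[i]) x i : (a *: x) i = a *: x i. Proof. by []. Qed.
Lemma L2_zeroE i : (0 : L2 I H) i = 0. Proof. by []. Qed.
Lemma L2_subE x y i : (x - y) i = x i - y i. Proof. by []. Qed.

Lemma L2_sumE (J : Type) (r : seq J) (X : J -> L2 I H) i :
  (\sum_(j <- r) X j) i = \sum_(j <- r) X j i.
Proof.
by elim: r => [|j r ih]; rewrite ?big_nil ?big_cons// L2_addE ih.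
Qed.

Lemma mkl2E f i : f \in l2pred (H := H) -> mkl2 f i = f i.
Proof. by move=> lf; rewrite /mkl2 -[LHS]/(val (insubd 0 f) i) val_insubd lf. Qed.

(** This and the next three lemmas trade the extended real sum that defines the norm for sums over
    duplicate-free lists, the form in which all estimates are made. *)
Lemma bessel x F : uniq F -> \sum_(i <- F) hsq (x i) <= hsq x.
Proof.
move=> uF; rewrite -lee_fin -l2_esumE -sumEFin fsbig_seq//.
by apply: ereal_sup_ubound; exists [set` F] => //; split.
Qed.

Lemma l2_hsq_le x (M : R) :
  (forall F, uniq F -> \sum_(i <- F) hsq (x i) <= M) -> hsq x <= M.
Proof.
move=> h; rewrite -lee_fin -l2_esumE; apply: ge_ereal_sup => _ [X [finX _] <-].
by rewrite fsbig_finite//= sumEFin lee_fin; apply: h.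
Qed.

Lemma l2_intro f (M : R) :
  (forall F, uniq F -> \sum_(i <- F) hsq (f i) <= M) -> f \in l2pred (H := H).
Proof.
move=> h; rewrite inE; apply: le_lt_trans (ltry M).
apply: ge_ereal_sup => _ [X [finX _] <-].
rewrite fsbig_finite//= sumEFin lee_fin.
by under eq_bigr do rewrite hnorm_sq; apply: h.
Qed.

Lemma l2_near x (e : R) : 0 < e ->
  exists2 F, uniq F & hsq x - e < \sum_(i <- F) hsq (x i).
Proof.
move=> e0; apply: contrapT => /forall2NP h.
suff : hsq x <= hsq x - e by lra.
apply: l2_hsq_le => F uF; have [//|/negP] := h F.
by rewrite -leNgt.
Qed.

Lemma hnorm_coord x i : hnorm (x i) <= hnorm x.
Proof.
rewrite hnorm_le ?hnorm_ge0// hnorm_sq.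
by have := @bessel x [:: i] isT; rewrite big_seq1.
Qed.

Lemma ev_l2 i (v : H) : (fun j : I => if j == i then v else 0) \in l2pred (H := H).
Proof.
apply: (@l2_intro _ (hsq v)) => F uF.
have [iF|iF] := boolP (i \in F).
  rewrite (bigD1_seq i)//= eqxx big1 ?addr0//.
  by move=> j /negPf ->; exact: hsq0.
rewrite big_seq big1 ?hsq_ge0// => j jF.
by case: eqP => [ji|_]; [rewrite ji (negPf iF) in jF|exact: hsq0].
Qed.

(* [ev] and the operators below are obtained from opaque existence proofs:
   this keeps conversion from unfolding the Hilbert space structures. *)
Fact ev_exists : {e : I -> H -> L2 I H |
  forall i v j, e i v j = if j == i then v else 0}.
Proof.
exists (fun i v => mkl2 (fun j => if j == i then v else 0)) => i v j.
by rewrite mkl2E// ev_l2.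
Qed.

Definition ev := sval ev_exists.

Lemma evE i v j : ev i v j = if j == i then v else 0.
Proof. exact: (svalP ev_exists). Qed.

Lemma ev_add i v w : ev i (v + w) = ev i v + ev i w.
Proof.
by apply: L2_ext => j; rewrite L2_addE !evE; case: eqP; rewrite ?addr0.
Qed.

Lemma ev_scale i (a : R[i]) v : ev i (a *: v) = a *: ev i v.
Proof.
by apply: L2_ext => j; rewrite L2_scaleE !evE; case: eqP; rewrite ?scaler0.
Qed.

Lemma sum_evE F (f : I -> H) j : uniq F ->
  (\sum_(i <- F) ev i (f i)) j = if j \in F then f j else 0.
Proof.
move=> uF; rewrite L2_sumE; under eq_bigr do rewrite evE.
have [jF|jF] := boolP (j \in F).
  rewrite (bigD1_seq j)//= eqxx big1 ?addr0// => i.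
  by rewrite eq_sym => /negPf ->.
rewrite big_seq big1// => i iF; case: eqP => // ji.
by rewrite ji iF in jF.
Qed.

Lemma rsum_single (p : I -> R) i : (forall j, j != i -> p j = 0) ->
  rsum p = p i.
Proof.
move=> h.
have E (q : I -> \bar R) : (forall j, 0 <= q j)%E ->
    (forall j, j != i -> q j = 0)%E ->
    (\esum_(j in [set: I]) q j = q i)%E.
  move=> q0 qi; rewrite -(@esum_set1 _ _ i q)//.
  rewrite [RHS]esum_mkcond; apply: eq_esum => j _.
  case: ifPn => //; rewrite notin_setE => /eqP; exact: qi.
rewrite /rsum !E//.
- by rewrite funeposE funenegE /= -!EFin_max/= [RHS](rposneg p).
- by move=> j ji; rewrite funenegE /= h// oppr0 maxxx.
- by move=> j ji; rewrite funeposE /= h// maxxx.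
Qed.

Lemma hdot_ev x i v : hdot x (ev i v) = hdot (x i) v.
Proof.
rewrite -[LHS]/(l2dot x (ev i v)) /l2dot !(@rsum_single _ i).
- by rewrite evE eqxx; case: (hdot _ _).
- by move=> j /negPf ji; rewrite evE ji hdot0r.
- by move=> j /negPf ji; rewrite evE ji hdot0r.
Qed.

Lemma hsq_sum_ev F (f : I -> H) : uniq F ->
  hsq (\sum_(i <- F) ev i (f i)) = \sum_(i <- F) hsq (f i).
Proof.
move=> uF; rewrite {1}/hsq hdot_sumr.
have -> : \sum_(i <- F) hdot (\sum_(j <- F) ev j (f j)) (ev i (f i)) =
    \sum_(i <- F) ((hsq (f i))%:C%C : R[i]).
  rewrite big_seq [RHS]big_seq; apply: eq_bigr => i iF.
  by rewrite hdot_ev sum_evE// iF hdot_hsq.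
by rewrite -rmorph_sum.
Qed.

Lemma hsq_ev i v : hsq (ev i v) = hsq v.
Proof. by have := @hsq_sum_ev [:: i] (fun=> v) isT; rewrite !big_seq1. Qed.

Lemma hnorm_ev i v : hnorm (ev i v) = hnorm v.
Proof. by rewrite !hnormE hsq_ev. Qed.

Definition trunc F x := \sum_(i <- F) ev i (x i).

Lemma hsq_trunc F x : uniq F -> hsq (x - trunc F x) =
  hsq x - \sum_(i <- F) hsq (x i).
Proof.
move=> uF; rewrite hsqDN hsq_sum_ev//.
have -> : complex.Re (hdot x (trunc F x)) = \sum_(i <- F) hsq (x i).
  rewrite hdot_sumr; under eq_bigr do rewrite hdot_ev hdot_hsq.
  by rewrite -rmorph_sum.
by rewrite mulr2n; ring.
Qed.

Lemma trunc_near x (e : R) : 0 < e ->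
  exists2 F, uniq F & hnorm (x - trunc F x) < e.
Proof.
move=> e0; have [F uF hF] := l2_near x (exprn_gt0 2 e0).
by exists F => //; rewrite hnorm_lt// hsq_trunc//; lra.
Qed.

End L2Basics.

Lemma blin_ev (H : hilbertType R) i : blin (@ev H i).
Proof.
split; first by move=> a v w; rewrite ev_add ev_scale.
by exists 1 => v; rewrite hnorm_ev mul1r.
Qed.

Lemma blin_coord (H : hilbertType R) i : blin (fun x : L2 I H => x i).
Proof. by split=> //; exists 1 => x; rewrite mul1r; exact: hnorm_coord. Qed.

(** The difference of the two maps vanishes on every [trunc F x], and these approximate [x]. *)
Lemma blin_ext (H K : hilbertType R) (S T : L2 I H -> K) : blin S -> blin T ->
  (forall i v, S (ev i v) = T (ev i v)) -> forall x, S x = T x.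
Proof.
move=> bS bT h x.
have := blin_lin (-1) bT bS; set D := (fun y => _) => bD.
have D0 F : D (trunc F x) = 0.
  rewrite /trunc (linear_bigsum bD.1) big1// => i _.
  by rewrite /D h scaleN1r addNr.
suff : D x = 0 by rewrite /D scaleN1r addrC => /eqP; rewrite subr_eq0 => /eqP.
have [M M0 hM] := blin_pos bD; apply: hnorm_small => e e0.
have M10 : 0 < M + 1 by rewrite ltr_wpDl.
have [F uF hF] := trunc_near x (divr_gt0 e0 M10).
rewrite -(subr0 (D x)) -(D0 F) -(linear_sub bD.1).
apply: (le_trans (hM _)); apply: (@le_trans _ _ ((M + 1) * hnorm (x - trunc F x))).
  by rewrite ler_wpM2r ?hnorm_ge0// lerDl.
by rewrite mulrC -ler_pdivlMr// ltW.
Qed.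

End SquareSummable.

Section Extension.
Variable R : realType.
Implicit Types H K E : hilbertType R.

Lemma dense_extension H K (D : set H) (f : H -> K) (M : R) : 0 <= M ->
  (forall c x y, D x -> D y -> D (c *: x + y)) ->
  (forall x e, 0 < e -> exists2 d, D d & hnorm (x - d) < e) ->
  (forall c x y, D x -> D y -> f (c *: x + y) = c *: f x + f y) ->
  (forall x, D x -> hnorm (f x) <= M * hnorm x) ->
  exists T : H -> K, [/\ linear T, forall x, hnorm (T x) <= M * hnorm x
    & forall x, D x -> T x = f x].
Proof.
move=> M0 Dlin Dden flin fM.
have Dsub x y : D x -> D y -> D (x - y).
  by move=> Dx Dy; rewrite addrC -scaleN1r; exact: Dlin.
have fsub x y : D x -> D y -> f (x - y) = f x - f y.
  by move=> Dx Dy; rewrite addrC -scaleN1r flin// scaleN1r addrC.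
(* [Q x y] says that [(x, y)] is in the closure of the graph of [f] on [D]. The bound on [f] makes
   this closure a graph, and completeness of [K] makes it total. *)
pose Q x y := forall e : R, 0 < e ->
  exists d, [/\ D d, hnorm (x - d) < e & hnorm (y - f d) < e].
have Quniq x y y' : Q x y -> Q x y' -> y = y'.
  move=> q q'; apply/eqP; rewrite -subr_eq0; apply/eqP/hnorm_small => e e0.
  (* With all four errors below [t], the path [y], [f d], [f d'], [y'] has length at most
     [t + M (2 t) + t]. *)
  have k0 : 0 < 2 + 2 * M by rewrite ltr_pwDl// mulr_ge0.
  have [d [Dd d1 d2]] := q _ (divr_gt0 e0 k0).
  have [d' [Dd' d1' d2']] := q' _ (divr_gt0 e0 k0).
  set t := e / _ in d1 d2 d1' d2'.
  have te : t * (2 + 2 * M) = e by rewrite /t divfK// gt_eqF.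
  have h1 := hnorm_split y (f d) y'; have h2 := hnorm_split (f d) (f d') y'.
  have h3 := fM _ (Dsub _ _ Dd Dd'); rewrite fsub// in h3.
  have h4 := hnorm_split d x d'; rewrite (hnorm_distC d x) in h4.
  rewrite (hnorm_distC (f d') y') in h2.
  have h5 : M * hnorm (d - d') <= M * (t + t) by apply: ler_wpM2l => //; lra.
  lra.
have Qex x : exists y, Q x y.
  have n0 (n : nat) : 0 < (n.+1%:R)^-1 :> R by rewrite invr_gt0.
  have /choice[s hs] : forall n : nat, exists d, D d /\ hnorm (x - d) < (n.+1%:R)^-1.
    by move=> n; have [d Dd dn] := Dden x _ (n0 n); exists d.
  have small (e : R) : 0 < e -> exists N : nat, forall n, (N <= n)%N ->
      hnorm (x - s n) < e.
    move=> /invS_lt_near[N hN]; exists N => n /hN.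
    exact: lt_le_trans (hs n).2.
  have [|y hy] := @hcomplete _ _ (fun n => f (s n)).
    move=> e e0.
    (* Here the distance is at most [M (2 t)]; the extra 1 makes the inequality strict and the
       divisor positive when [M = 0]. *)
    have k0 : 0 < 1 + 2 * M by rewrite ltr_pwDl// mulr_ge0.
    have [N hN] := small _ (divr_gt0 e0 k0); exists N => m n /hN h1 /hN h2.
    set t := e / _ in h1 h2.
    have t0 : 0 < t by rewrite divr_gt0.
    have te : t * (1 + 2 * M) = e by rewrite /t divfK// gt_eqF.
    have [Dm _] := hs m; have [Dn _] := hs n.
    rewrite -fsub//; apply: (le_lt_trans (fM _ (Dsub _ _ Dm Dn))).
    have h4 := hnorm_split (s m) x (s n); rewrite (hnorm_distC (s m) x) in h4.
    have h5 : M * hnorm (s m - s n) <= M * (t + t) by apply: ler_wpM2l => //; lra.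
    lra.
  exists y => e e0; have [N hN] := small _ e0; have [N' hN'] := hy _ e0.
  exists (s (maxn N N')); split; first exact: (hs _).1.
    by apply: hN; exact: leq_maxl.
  by rewrite hnorm_distC; apply: hN'; exact: leq_maxr.
have /choice[T hT] := Qex.
exists T; split.
- move=> c x y; apply: (Quniq (c *: x + y)); first exact: hT.
  move=> e e0; set k := hnorm (c : R[i]^o) + 1.
  have k0 : 0 < k by rewrite ltr_wpDl// hnorm_ge0.
  have [d [Dd d1 d2]] := hT x _ (divr_gt0 e0 k0).
  have [d' [Dd' d1' d2']] := hT y _ (divr_gt0 e0 k0).
  set t := e / _ in d1 d2 d1' d2'.
  have te : t * k = e by rewrite /t divfK// gt_eqF.
  have b (V : hilbertType R) (p q p' q' : V) : hnorm (p - p') < t ->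
      hnorm (q - q') < t -> hnorm (c *: p + q - (c *: p' + q')) < e.
    move=> hp hq; rewrite opprD addrACA -scalerBr.
    apply: (le_lt_trans (hnorm_add _ _)); rewrite hnormZ -te /k mulrDr mulr1 [t * _]mulrC.
    by apply: ler_ltD => //; rewrite ler_wpM2l ?hnorm_ge0// ltW.
  exists (c *: d + d'); split; first exact: Dlin.
    exact: b.
  by rewrite flin//; exact: b.
- move=> x; apply/ler_addgt0Pr => e e0.
  have k0 : 0 < 1 + M by rewrite ltr_pwDl.
  have [d [Dd d1 d2]] := hT x _ (divr_gt0 e0 k0).
  set t := e / _ in d1 d2.
  have te : t * (1 + M) = e by rewrite /t divfK// gt_eqF.
  have h1 := hnorm_split (T x) (f d) 0; rewrite !subr0 in h1.
  have h2 := fM _ Dd.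
  have h3 := hnorm_split d x 0; rewrite !subr0 (hnorm_distC d x) in h3.
  have h5 : M * hnorm d <= M * (t + hnorm x) by apply: ler_wpM2l => //; lra.
  lra.
- move=> x Dx; apply: (Quniq x); first exact: hT.
  by move=> e e0; exists x; rewrite !subrr !hnorm0.
Qed.

(** * Operators given by their matrices *)

Section Matrix.
Variables (I : choiceType) (H K : hilbertType R) (m : I -> I -> H -> K) (M : R).
Hypothesis M0 : 0 <= M.
Hypothesis mlin : forall i j, linear (m i j).
(** Square sections suffice: the support of a vector and a finite set of rows are always enlarged to
    a common list. *)
Hypothesis mM : forall (F : seq I) (x : I -> H), uniq F ->
  \sum_(i <- F) hsq (\sum_(j <- F) m i j (x j)) <=
  M ^+ 2 * \sum_(j <- F) hsq (x j).

Let fin_supp : set (L2 I H) :=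
  [set x | exists2 F : seq I, uniq F & forall i, i \notin F -> x i = 0].

(** For a finitely supported [x] this is a sum over any list that carries the support, so two
    vectors can be compared over one list. *)
Let row (x : L2 I H) (i : I) : K := \sum_(j \in [set: I]) m i j (x j).

Let rowE (x : L2 I H) (F : seq I) i : uniq F -> (forall j, j \notin F -> x j = 0) ->
  row x i = \sum_(j <- F) m i j (x j).
Proof.
move=> uF xF; rewrite /row (fsbigE F)//.
  by under eq_bigl do rewrite in_setT.
by move=> j _ /xF ->; rewrite (linear_zero (mlin i j)).
Qed.

Let row_bound (x : L2 I H) (F' : seq I) : fin_supp x -> uniq F' ->
  \sum_(i <- F') hsq (row x i) <= M ^+ 2 * hsq x.
Proof.
move=> [F uF xF] uF'; set F2 := undup (F ++ F').
have u2 : uniq F2 by exact: undup_uniq.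
have x2 j : j \notin F2 -> x j = 0.
  by rewrite mem_undup mem_cat negb_or => /andP[/xF].
apply: (@le_trans _ _ (\sum_(i <- F2) hsq (row x i))).
  apply: sum_le_subset => //; last by move=> i; exact: hsq_ge0.
  by move=> i iF; rewrite mem_undup mem_cat iF orbT.
under eq_bigr do rewrite (rowE _ u2 x2).
apply: (le_trans (mM _ u2)).
by rewrite ler_wpM2l ?sqr_ge0//; exact: bessel.
Qed.

Let row_l2 (x : L2 I H) : fin_supp x -> row x \in l2pred (H := K).
Proof.
by move=> sx; apply: (@l2_intro _ _ _ _ (M ^+ 2 * hsq x)) => F; exact: row_bound.
Qed.

Let fin_lin c (x y : L2 I H) : fin_supp x -> fin_supp y -> fin_supp (c *: x + y).
Proof.
move=> [F uF xF] [F' uF' yF']; exists (undup (F ++ F')); first exact: undup_uniq.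
move=> i; rewrite mem_undup mem_cat negb_or => /andP[/xF h /yF' h'].
by rewrite L2_addE L2_scaleE h h' scaler0 addr0.
Qed.

Lemma matrix_operator : exists X : L2 I H -> L2 I K,
  [/\ linear X, forall x, hnorm (X x) <= M * hnorm x
    & forall i j v, X (ev j v) i = m i j v].
Proof.
have fev j v : fin_supp (ev j v).
  exists [:: j] => // i; rewrite inE evE => /negPf ->//.
have [] := @dense_extension (L2 I H) (L2 I K) fin_supp (fun x => mkl2 (row x)) M M0.
- exact: fin_lin.
- move=> x e e0; have [F uF hF] := trunc_near x e0; exists (trunc F x) => //.
  by exists F => // i /negPf iF; rewrite /trunc sum_evE// iF.
- move=> c x y sx sy; apply: L2_ext => i.
  rewrite L2_addE L2_scaleE !mkl2E; try exact: row_l2; last exact/row_l2/fin_lin.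
  have [F uF xF] := sx; have [F' uF' yF'] := sy.
  set F2 := undup (F ++ F').
  have u2 : uniq F2 by exact: undup_uniq.
  have x2 j : j \notin F2 -> x j = 0.
    by rewrite mem_undup mem_cat negb_or => /andP[/xF].
  have y2 j : j \notin F2 -> y j = 0.
    by rewrite mem_undup mem_cat negb_or => /andP[_ /yF'].
  rewrite !(rowE _ u2)//; last first.
    by move=> j jF; rewrite L2_addE L2_scaleE x2// y2// scaler0 addr0.
  rewrite scaler_sumr -big_split/=; apply: eq_bigr => j _.
  exact: mlin.
- move=> x sx; rewrite hnorm_le ?mulr_ge0 ?hnorm_ge0// exprMn hnorm_sq.
  apply: l2_hsq_le => F uF; under eq_bigr do rewrite mkl2E ?row_l2//.
  exact: row_bound.
- move=> X [lX XM Xf]; exists X; split => // i j v.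
  rewrite Xf// mkl2E ?row_l2// (@rowE _ [:: j])//.
    by rewrite big_seq1 evE eqxx.
  by move=> k; rewrite inE evE => /negPf ->.
Qed.

End Matrix.
End Extension.

(** * Tensor products of operators *)

Section Amplification.
Variables (R : realType) (I : choiceType).
Implicit Types H K : hilbertType R.

Lemma amp_l2 H K (T : H -> K) (x : L2 I H) : blin T ->
  (fun i => T (x i)) \in l2pred (H := K).
Proof.
move=> /blin_pos[M M0 hM]; apply: (@l2_intro _ _ _ _ (M ^+ 2 * hsq x)) => F uF.
apply: (@le_trans _ _ (\sum_(i <- F) M ^+ 2 * hsq (x i))).
  apply: ler_sum => i _; rewrite -!hnorm_sq -exprMn ler_pXn2r ?nnegrE ?hnorm_ge0//.
  by rewrite mulr_ge0 ?hnorm_ge0.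
by rewrite -mulr_sumr ler_wpM2l ?sqr_ge0 ?bessel.
Qed.

Fact amp_exists H K : {a : (H -> K) -> L2 I H -> L2 I K |
  forall T x i, blin T -> a T x i = T (x i)}.
Proof.
exists (fun T x => mkl2 (fun i => T (x i))) => T x i bT.
by rewrite mkl2E//; exact: amp_l2.
Qed.

(** The amplification [T \otimes 1], also for [T] between different spaces; for bounded operators it
    is [tens T id], see [tens_id]. *)
Definition amp H K := sval (amp_exists H K).

Lemma ampE H K (T : H -> K) x i : blin T -> amp T x i = T (x i).
Proof. exact: (svalP (amp_exists H K)). Qed.

Lemma amp_linear H K (T : H -> K) : blin T -> linear (amp T).
Proof.
by move=> bT a x y; apply: L2_ext => i; rewrite L2_addE L2_scaleE !ampE// bT.1.
Qed.

Lemma amp_bound H K (T : H -> K) (M : R) : blin T -> 0 <= M ->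
  (forall x, hnorm (T x) <= M * hnorm x) ->
  forall x, hnorm (amp T x) <= M * hnorm x.
Proof.
move=> bT M0 hM x; rewrite hnorm_le ?mulr_ge0 ?hnorm_ge0// exprMn hnorm_sq.
apply: l2_hsq_le => F uF; under eq_bigr do rewrite ampE//.
apply: (@le_trans _ _ (\sum_(i <- F) M ^+ 2 * hsq (x i))).
  apply: ler_sum => i _; rewrite -!hnorm_sq -exprMn ler_pXn2r ?nnegrE ?hnorm_ge0//.
  by rewrite mulr_ge0 ?hnorm_ge0.
by rewrite -mulr_sumr ler_wpM2l ?sqr_ge0 ?bessel.
Qed.

Lemma blin_amp H K (T : H -> K) : blin T -> blin (amp T).
Proof.
move=> bT; split; first exact: amp_linear.
by have [M M0 hM] := blin_pos bT; exists M; exact: amp_bound.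
Qed.

Lemma amp_ev H K (T : H -> K) j v : blin T -> amp T (ev j v) = ev j (T v).
Proof.
move=> bT; apply: L2_ext => i; rewrite ampE// !evE.
by case: eqP => //; rewrite (linear_zero bT.1).
Qed.

Lemma opnorm_amp H (T : op H) : bounded_op T -> opnorm (amp T) <= opnorm T.
Proof.
move=> bT; apply: opnorm_le; first exact: opnorm_ge0.
apply: amp_bound => //; first exact: opnorm_ge0.
by move=> x; exact: le_opnorm.
Qed.

Lemma opnorm_ampE H (T : op H) : bounded_op T -> (exists i : I, True) ->
  opnorm (amp T) = opnorm T.
Proof.
move=> bT [i _]; apply/eqP; rewrite eq_le opnorm_amp//=.
have bA : bounded_op (amp T) by exact: blin_amp.
apply: opnorm_le; first exact: opnorm_ge0.
move=> x; rewrite -(hnorm_ev i x) -(hnorm_ev i (T x)) -amp_ev//.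
exact: le_opnorm.
Qed.

End Amplification.

Section Tensor.
Variables (R : realType) (I : choiceType).
Implicit Types H K : hilbertType R.

(* The [f k] may vanish; the coefficient on such an [f k] is then [_ / 0 = 0]. *)
Lemma orthogonalization H (J : eqType) (F : seq J) (x : J -> H) :
  exists n (f : nat -> H) (c : J -> nat -> R[i]),
    (forall k l, (k < n)%N -> (l < n)%N -> k != l -> hdot (f k) (f l) = 0) /\
    forall j, j \in F -> x j = \sum_(k < n) c j k *: f k.
Proof.
elim: F => [|j F [n [f [c [fo xE]]]]].
  by exists 0%N, (fun=> 0), (fun _ _ => 0).
pose a k : R[i] := hdot (x j) (f k) / hdot (f k) (f k).
pose r := x j - \sum_(k < n) a k *: f k.
have ro k : (k < n)%N -> hdot r (f k) = 0.
  move=> kn; rewrite /r hdotBl hdot_suml (bigD1 (Ordinal kn))//= big1 ?addr0.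
    have [->|f0] := eqVneq (f k) 0; first by rewrite !hdot0r subrr.
    rewrite hdotZl /a divfK ?subrr//.
    by rewrite gt_eqF// hdot_gt0.
  by move=> l lk; rewrite hdotZl fo ?mulr0.
exists n.+1, (fun k => if k == n then r else f k),
  (fun i k => if i == j then (if k == n then 1 else a k)
              else if k == n then 0 else c i k); split.
  have lt k : (k < n.+1)%N -> k != n -> (k < n)%N.
    by move=> k1 kn; rewrite ltn_neqAle kn -ltnS.
  move=> k l /lt hk /lt hl.
  have [kn|kn] /= := eqVneq k n; have [ln|ln] //= := eqVneq l n.
  - by rewrite kn ln eqxx.
  - by move=> _; exact/ro/hl.
  - by move=> _; rewrite hdotC ro ?conjc0//; exact: hk.
  - by apply: fo; [exact: hk|exact: hl].
move=> i; rewrite inE big_ord_recr/= !eqxx.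
have [->|ij] /= := eqVneq i j.
  move=> _; rewrite scale1r; under eq_bigr => k _ do rewrite ltn_eqF//.
  by rewrite /r addrC subrK.
move=> iF; rewrite scale0r addr0; under eq_bigr => k _ do rewrite ltn_eqF//.
exact: xE.
Qed.

Lemma hsq_orthogonal_sum H n (f : nat -> H) (a : nat -> R[i]) :
  (forall k l, (k < n)%N -> (l < n)%N -> k != l -> hdot (f k) (f l) = 0) ->
  hsq (\sum_(k < n) a k *: f k) = \sum_(k < n) hsq (a k : R[i]^o) * hsq (f k).
Proof.
elim: n => [|n ih] fo; first by rewrite !big_ord0 hsq0.
rewrite !big_ord_recr/= hsqD ih; last first.
  by move=> k l kn ln; apply: fo; exact: ltnW.
have -> : hdot (\sum_(k < n) a k *: f k) (a n *: f n) = 0.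
  rewrite hdot_suml big1// => k _.
  by rewrite hdotZl hdotZr fo ?mulr0// ?ltn_eqF// ltnS ltnW.
by rewrite mul0rn addr0 hsqZE.
Qed.

Lemma ev_ell2 j (z : R[i]^o) : ev j z = (z : R[i]) *: ev (I := I) j (1 : R[i]^o).
Proof. by rewrite -ev_scale; congr ev; rewrite -[RHS]/(z * 1) mulr1. Qed.

(* Writing the vectors of a finite section in an orthogonal family [f] bounds the
   section by applying [T] to the coefficient vectors on each [f k]. *)
Lemma id_tens_exists H (T : op (ell2 R I)) : bounded_op T ->
  exists X : op (L2 I H), [/\ linear X,
    forall x, hnorm (X x) <= opnorm T * hnorm x
    & forall i j v, X (ev j v) i = (T (ev j (1 : R[i]^o)) i : R[i]) *: v].
Proof.
move=> bT.
apply: (@matrix_operator _ I H H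
  (fun i j v => (T (ev j (1 : R[i]^o)) i : R[i]) *: v) (opnorm T)).
- exact: opnorm_ge0.
- move=> i j a v w /=. by rewrite scalerDr !scalerA [in LHS]mulrC.
move=> F x uF; have [n [f [c [fo xE]]]] := orthogonalization F x.
pose C k : ell2 R I := \sum_(j <- F) ev j (c j k : R[i]^o).
have rowE i : \sum_(j <- F) (T (ev j (1 : R[i]^o)) i : R[i]) *: x j =
    \sum_(k < n) (T (C k) i : R[i]) *: f k.
  rewrite big_seq; under eq_bigr => j jF do rewrite xE// scaler_sumr.
  rewrite -big_seq exchange_big/=; apply: eq_bigr => k _.
  rewrite /C (linear_bigsum bT.1) L2_sumE scaler_suml; apply: eq_bigr => j _.
  rewrite (ev_ell2 _ (c j k)) (linear_scale bT.1) L2_scaleE scalerA.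
  by congr (_ *: _); exact: mulrC.
under eq_bigr => i _ do
  rewrite rowE (@hsq_orthogonal_sum _ _ f (fun k => T (C k) i : R[i]) fo).
rewrite exchange_big/=.
have -> : \sum_(j <- F) hsq (x j) = \sum_(k < n) hsq (C k) * hsq (f k).
  under [RHS]eq_bigr do rewrite hsq_sum_ev// mulr_suml.
  rewrite exchange_big/= big_seq [RHS]big_seq; apply: eq_bigr => j jF.
  by rewrite xE// (@hsq_orthogonal_sum _ _ f (c j) fo).
rewrite mulr_sumr; apply: ler_sum => k _.
rewrite -mulr_suml mulrA ler_wpM2r ?hsq_ge0//.
apply: (le_trans (bessel _ uF)).
rewrite -!hnorm_sq -exprMn ler_pXn2r ?nnegrE ?hnorm_ge0 ?le_opnorm//.
by rewrite mulr_ge0 ?hnorm_ge0 ?opnorm_ge0.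
Qed.

Lemma tensv_l2 H (v : H) (w : ell2 R I) :
  (fun i => (w i : R[i]) *: v) \in l2pred (H := H).
Proof.
apply: (@l2_intro _ _ _ _ (hsq w * hsq v)) => F uF.
under eq_bigr do rewrite hsqZE.
by rewrite -mulr_suml ler_wpM2r ?hsq_ge0//; exact: bessel.
Qed.

Lemma tensvE H (v : H) (w : ell2 R I) i : tensv v w i = (w i : R[i]) *: v.
Proof. by rewrite /tensv mkl2E// tensv_l2. Qed.

Lemma tensv_ev H (v : H) (j : I) (z : R[i]^o) :
  tensv v (ev j z) = ev j ((z : R[i]) *: v).
Proof.
by apply: L2_ext => i; rewrite tensvE !evE; case: eqP => //; rewrite scale0r.
Qed.

Lemma hnorm_tensv H (v : H) (w : ell2 R I) : hnorm (tensv v w) <= hnorm v * hnorm w.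
Proof.
rewrite hnorm_le ?mulr_ge0 ?hnorm_ge0// exprMn !hnorm_sq.
apply: l2_hsq_le => F uF; under eq_bigr do rewrite tensvE hsqZE.
by rewrite -mulr_suml mulrC ler_wpM2l ?hsq_ge0//; exact: bessel.
Qed.

Lemma blin_tensvr H (v : H) : blin (fun w : ell2 R I => tensv v w).
Proof.
split; last by exists (hnorm v) => w; exact: hnorm_tensv.
move=> a w w'; apply: L2_ext => i.
by rewrite L2_addE L2_scaleE !tensvE scalerA -scalerDl.
Qed.

Lemma blin_tensvl H (w : ell2 R I) : blin (fun v : H => tensv v w).
Proof.
split; last by exists (hnorm w) => v; rewrite mulrC; exact: hnorm_tensv.
move=> a v v'; apply: L2_ext => i.
by rewrite L2_addE L2_scaleE !tensvE scalerDr !scalerA mulrC.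
Qed.

Section Spec.
Variables (H : hilbertType R) (S : op H) (T : op (ell2 R I)).
Hypotheses (bS : bounded_op S) (bT : bounded_op T).

(** The product [(S \otimes 1) (1 \otimes T)]: the first factor is an amplification, the second
    comes from [id_tens_exists], and both norm bounds multiply. *)
Let tens_spec : exists X : op (L2 I H), [/\ bounded_op X,
  opnorm X <= opnorm S * opnorm T
  & forall v w, X (tensv v w) = tensv (S v) (T w)].
Proof.
have [X [lX nX XE]] := id_tens_exists H bT.
have bX : bounded_op X by split=> //; exists (opnorm T).
have bA : bounded_op (amp (I := I) S) by exact: blin_amp.
exists (amp S \o X); split.
- exact: bounded_comp.
- apply: (le_trans (opnorm_comp bA bX)); apply: ler_pM.
  + exact: opnorm_ge0.
  + exact: opnorm_ge0.
  + exact: opnorm_amp.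
  + by apply: opnorm_le => //; exact: opnorm_ge0.
- move=> v; apply: blin_ext.
  + apply: blin_comp; last exact: blin_tensvr.
    exact: bounded_comp.
  + exact: (blin_comp (blin_tensvr _)).
  + move=> j z /=; apply: L2_ext => i; rewrite tensv_ev ampE// tensvE XE.
    rewrite (ev_ell2 _ z) (linear_scale bT.1) L2_scaleE.
    rewrite !(linear_scale bS.1) scalerA.
    by congr (_ *: _); exact: mulrC.
Qed.

Lemma tens_uniq (X X' : op (L2 I H)) : bounded_op X -> bounded_op X' ->
  (forall v w, X (tensv v w) = X' (tensv v w)) -> X = X'.
Proof.
move=> bX bX' h; apply/funext; apply: blin_ext => // j v.
by rewrite -[v]scale1r -tensv_ev h.
Qed.

Lemma tensP : bounded_op (tens S T) /\
  forall v w, tens S T (tensv v w) = tensv (S v) (T w).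
Proof.
rewrite /tens; case: xgetP => [X -> //|h].
by have [X [b _ e]] := tens_spec; case: (h X).
Qed.

Lemma bounded_tens : bounded_op (tens S T).
Proof. by case: tensP. Qed.

Lemma tens_tensv v w : tens S T (tensv v w) = tensv (S v) (T w).
Proof. by case: tensP. Qed.

Lemma tens_ev v (j : I) : tens S T (ev j v) = tensv (S v) (T (ev j (1 : R[i]^o))).
Proof. by rewrite -tens_tensv tensv_ev scale1r. Qed.

Lemma tens_def (X : op (L2 I H)) : bounded_op X ->
  (forall v j, X (ev j v) = tensv (S v) (T (ev j (1 : R[i]^o)))) -> tens S T = X.
Proof.
move=> bX h; apply/funext; apply: blin_ext => //; first exact: bounded_tens.
by move=> j v; rewrite tens_ev h.
Qed.

Lemma opnorm_tens : opnorm (tens S T) <= opnorm S * opnorm T.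
Proof.
have [X [bX nX XE]] := tens_spec.
rewrite (_ : tens S T = X)//; apply: tens_uniq => //; first exact: bounded_tens.
by move=> v w; rewrite tens_tensv XE.
Qed.

End Spec.

Section Algebra.
Variable H : hilbertType R.
Implicit Types (S : op H) (T : op (ell2 R I)).

Lemma tens_comp S S' T T' : bounded_op S -> bounded_op S' ->
  bounded_op T -> bounded_op T' ->
  tens S T \o tens S' T' = tens (S \o S') (T \o T').
Proof.
move=> bS bS' bT bT'; apply: tens_uniq.
- by apply: bounded_comp; exact: bounded_tens.
- by apply: bounded_tens; exact: bounded_comp.
- by move=> v w /=; rewrite !tens_tensv//; exact: bounded_comp.
Qed.

Lemma bl_tensl T : bounded_op T ->
  bounded_linear_on (@bounded_op R H) (fun S => tens S T).
Proof.
move=> bT; split.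
  move=> c S S' bS bS'; have b : bounded_op (c *: S + S') by exact: bounded_lin.
  apply: tens_uniq; first exact: bounded_tens.
    by apply: bounded_lin; exact: bounded_tens.
  move=> v w; rewrite -[RHS]/(c *: tens S T (tensv v w) + tens S' T (tensv v w)).
  rewrite !tens_tensv//; exact: (blin_tensvl H (T w)).1.
exists (opnorm T) => S bS; split; first exact: bounded_tens.
by rewrite mulrC; exact: opnorm_tens.
Qed.

Lemma bl_tensr S : bounded_op S ->
  bounded_linear_on (@bounded_op R (ell2 R I)) (fun T => tens S T).
Proof.
move=> bS; split.
  move=> c T T' bT bT'; have b : bounded_op (c *: T + T') by exact: bounded_lin.
  apply: tens_uniq; first exact: bounded_tens.
    by apply: bounded_lin; exact: bounded_tens.
  move=> v w; rewrite -[RHS]/(c *: tens S T (tensv v w) + tens S T' (tensv v w)).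
  rewrite !tens_tensv//; exact: (blin_tensvr (S v)).1.
exists (opnorm S) => T bT; split; first exact: bounded_tens.
exact: opnorm_tens.
Qed.

Lemma tens_id S : bounded_op S -> tens S (id : op (ell2 R I)) = amp S.
Proof.
move=> bS; apply: tens_def => //; first exact: bounded_id.
  exact: blin_amp.
by move=> v j; rewrite amp_ev// tensv_ev scale1r.
Qed.

End Algebra.
End Tensor.

(** * Complete contractions act entrywise *)

Section FiniteSums.
Variables (R : realType) (H : hilbertType R).

Lemma hsq_sum_ev_inj (I : choiceType) n (t : 'I_n -> I) (z : 'I_n -> H) :
  injective t -> hsq (\sum_(l < n) ev (t l) (z l)) = \sum_(l < n) hsq (z l).
Proof.
move=> inj_t; rewrite {1}/hsq hdot_sumr.
rewrite (eq_bigr (fun l => (hsq (z l))%:C%C : R[i])); last first.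
  move=> l _; rewrite hdot_ev L2_sumE (bigD1 l)//= evE eqxx big1 ?addr0 ?hdot_hsq//.
  by move=> k kl; rewrite evE (inj_eq inj_t) eq_sym (negPf kl).
by rewrite -rmorph_sum.
Qed.

Lemma fin_l2 n (f : 'I_n -> H) : f \in l2pred (H := H).
Proof.
have -> : f = l2fun (\sum_(i <- enum 'I_n) ev i (f i)).
  by apply/funext => i; rewrite sum_evE ?enum_uniq// mem_enum.
exact: l2funP.
Qed.

Lemma fin_sum_ev n (x : L2 'I_n H) : x = \sum_(l < n) ev l (x l).
Proof.
apply: L2_ext => i; rewrite L2_sumE (bigD1 i)//= evE eqxx big1 ?addr0//.
by move=> k ki; rewrite evE eq_sym (negPf ki).
Qed.

Lemma hsq_fin n (x : L2 'I_n H) : hsq x = \sum_(i < n) hsq (x i).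
Proof. by rewrite {1}[x]fin_sum_ev hsq_sum_ev_inj. Qed.

End FiniteSums.

Section Matrices.
Variable R : realType.
Implicit Types H K L : hilbertType R.

Lemma mxopE H n (a : 'M[op H]_n) (x : L2 'I_n H) i :
  mxop a x i = \sum_(j < n) a i j (x j).
Proof. by rewrite /mxop mkl2E// fin_l2. Qed.

Lemma bounded_mxop H n (a : 'M[op H]_n) :
  (forall i j, bounded_op (a i j)) -> bounded_op (mxop a).
Proof.
move=> ba.
have -> : mxop a = fun x => \sum_(i < n) \sum_(j < n) ev i (a i j (x j)).
  apply/funext => x; rewrite [LHS]fin_sum_ev; apply: eq_bigr => i _.
  by rewrite mxopE (linear_bigsum (blin_ev _ _).1).
apply: blin_sum => i; apply: blin_sum => j.
apply: (blin_comp (blin_ev _ _)).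
exact: (blin_comp (ba i j) (blin_coord _ _)).
Qed.

Lemma opnorm_mxop1 H (T : op H) : bounded_op T ->
  opnorm (mxop (const_mx T : 'M_1)) = opnorm T.
Proof.
move=> bT.
have bm : bounded_op (mxop (const_mx T : 'M_1)).
  by apply: bounded_mxop => i j; rewrite mxE.
have mE x : mxop (const_mx T : 'M_1) x = ev ord0 (T (x ord0)).
  apply: L2_ext => i; rewrite mxopE big_ord1 mxE evE.
  by rewrite (ord1 i) eqxx.
apply/eqP; rewrite eq_le; apply/andP; split; apply: opnorm_le;
  try exact: opnorm_ge0.
  move=> x; rewrite mE hnorm_ev; apply: (le_trans (le_opnorm _ bT)).
  by rewrite ler_wpM2l ?opnorm_ge0//; exact: hnorm_coord.
move=> x; have := le_opnorm (ev ord0 x) bm.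
by rewrite mE !hnorm_ev evE eqxx.
Qed.

Lemma cc_opnorm H K (A : set (op H)) (phi : op H -> op K) (a : op H) :
  completely_contractive A phi -> A a -> bounded_op a -> bounded_op (phi a) ->
  opnorm (phi a) <= opnorm a.
Proof.
move=> cc Aa ba bp; have := cc 1%N (const_mx a).
rewrite map_const_mx !opnorm_mxop1//; apply=> i j; by rewrite mxE.
Qed.

Lemma ci_opnorm H K (A : set (op H)) (phi : op H -> op K) (a : op H) :
  completely_isometric A phi -> A a -> bounded_op a -> bounded_op (phi a) ->
  opnorm (phi a) = opnorm a.
Proof.
move=> cc Aa ba bp; have := cc 1%N (const_mx a).
rewrite map_const_mx !opnorm_mxop1//; apply=> i j; by rewrite mxE.
Qed.

Lemma ci_cc H K (A : set (op H)) (phi : op H -> op K) :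
  completely_isometric A phi -> completely_contractive A phi.
Proof. by move=> ci n a aA; rewrite ci. Qed.

Definition entry (I : choiceType) H (X : op (L2 I H)) (i j : I) : op H :=
  fun v => X (ev j v) i.

Section Entries.
Variables (I : choiceType) (H : hilbertType R).

Lemma bounded_entry (X : op (L2 I H)) i j : bounded_op X -> bounded_op (entry X i j).
Proof.
move=> bX; apply: (blin_comp (blin_coord H i)).
exact: (blin_comp bX (blin_ev _ _)).
Qed.

Lemma opnorm_entry (X : op (L2 I H)) i j : bounded_op X ->
  opnorm (entry X i j) <= opnorm X.
Proof.
move=> bX; apply: opnorm_le; first exact: opnorm_ge0.
move=> v; apply: (le_trans (hnorm_coord _ _)).
by rewrite -(hnorm_ev j v); exact: le_opnorm.
Qed.

Lemma bl_entry i j :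
  bounded_linear_on (@bounded_op R (L2 I H)) (fun X => entry X i j).
Proof.
split; first by [].
exists 1 => X bX; rewrite mul1r; split; first exact: bounded_entry.
exact: opnorm_entry.
Qed.

Lemma entry_ext (X Y : op (L2 I H)) : bounded_op X -> bounded_op Y ->
  (forall i j, entry X i j = entry Y i j) -> X = Y.
Proof.
move=> bX bY h; apply/funext; apply: blin_ext => // j v.
by apply: L2_ext => i; have := h i j => /(congr1 (fun f => f v)).
Qed.

Lemma entry_tens (S : op H) (T : op (ell2 R I)) i j :
  bounded_op S -> bounded_op T ->
  entry (tens S T) i j = (T (ev j (1 : R[i]^o)) i : R[i]) *: S.
Proof.
by move=> bS bT; apply/funext => v; rewrite /entry tens_ev// tensvE.
Qed.

End Entries.

(** A finite section of the matrix [phi (X_ij)] is the image under [phi] of a finite section of [X],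
    which is a compression of [X]. Complete contractivity at size [n = size F] bounds it by the norm
    of [X], uniformly in [F], as [matrix_operator] requires. *)
Lemma cc_entries (I : choiceType) H K (A : set (op H)) (phi : op H -> op K)
    (X : op (L2 I H)) :
  closed_subspace A -> (forall a, A a -> bounded_op (phi a)) ->
  completely_contractive A phi -> bounded_op X ->
  (forall i j, A (entry X i j)) ->
  exists X' : op (L2 I K), [/\ bounded_op X', opnorm X' <= opnorm X
    & forall i j, entry X' i j = phi (entry X i j)].
Proof.
move=> cA bphi cc bX AX.
have [|X' [lX' nX' eX']] := @matrix_operator _ I K K (fun i j => phi (entry X i j))
  (opnorm X) (opnorm_ge0 bX) (fun i j => (bphi _ (AX i j)).1); last first.
  exists X'; split; first by split=> //; exists (opnorm X).
    by apply: opnorm_le => //; exact: opnorm_ge0.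
  by move=> i j; apply/funext => v; exact: eX'.
(* [t] numbers the elements of [F], turning a section indexed by [F] into a matrix indexed by
   ['I_(size F)]. *)
move=> F x uF; pose t := tnth (in_tuple F).
have inj_t : injective t.
  exact/(@tuple_uniqP _ _ (in_tuple F)).
pose a : 'M[op H]_(size F) := \matrix_(k, l) entry X (t k) (t l).
have Aa k l : A (a k l) by rewrite mxE.
pose z : L2 'I_(size F) K := mkl2 (fun k => x (t k)).
have zE k : z k = x (t k) by rewrite /z mkl2E// fin_l2.
have ba : bounded_op (mxop a) by apply: bounded_mxop => k l; exact: (closed_bounded cA).
have bpa : bounded_op (mxop (map_mx phi a)).
  by apply: bounded_mxop => k l; rewrite mxE; exact: bphi.
have -> : \sum_(j <- F) hsq (x j) = hsq z.
  by rewrite hsq_fin big_tnth; apply: eq_bigr => k _; rewrite zE.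
have -> : \sum_(i <- F) hsq (\sum_(j <- F) phi (entry X i j) (x j)) =
    hsq (mxop (map_mx phi a) z).
  rewrite hsq_fin big_tnth; apply: eq_bigr => k _; congr hsq.
  rewrite mxopE big_tnth; apply: eq_bigr => l _.
  by rewrite !mxE zE.
rewrite -!hnorm_sq -exprMn ler_pXn2r ?nnegrE ?mulr_ge0 ?hnorm_ge0 ?opnorm_ge0//.
apply: (le_trans (le_opnorm _ bpa)); rewrite ler_wpM2r ?hnorm_ge0//.
apply: (le_trans (cc _ _ Aa)); apply: opnorm_le; first exact: opnorm_ge0.
(* [w] is [y] placed at the positions of [F]: an isometric embedding, so [mxop a y] consists of the
   [F] coordinates of [X w]. *)
move=> y; pose w := \sum_(l < size F) ev (t l) (y l).
have -> : hnorm y = hnorm w by rewrite !hnormE hsq_sum_ev_inj// hsq_fin.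
apply: le_trans (le_opnorm _ bX).
rewrite hnorm_le ?hnorm_ge0// hnorm_sq hsq_fin.
apply: le_trans (bessel _ uF); rewrite [leRHS]big_tnth.
apply: ler_sum => k _; rewrite mxopE /w (linear_bigsum bX.1) L2_sumE.
by under eq_bigr do rewrite mxE.
Qed.

Lemma tensmap_spec H K L H' K' L' (t : op H -> op K -> op L)
    (t' : op H' -> op K' -> op L') (A : set (op H)) (B : set (op K))
    (phi : op H -> op H') (psi : op K -> op K') (Phi : op L -> op L') :
  bounded_linear_on (mintens t A B) Phi ->
  (forall a b, A a -> B b -> Phi (t a b) = t' (phi a) (psi b)) ->
  bounded_linear_on (mintens t A B) (tensmap t t' A B phi psi) /\
  forall a b, A a -> B b -> tensmap t t' A B phi psi (t a b) = t' (phi a) (psi b).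
Proof.
rewrite /tensmap /mintens; set P := (X in lin_ext X); set S := (X in clspan X).
have <- : [set p.1 | p in P] = S.
  apply/seteqP; split=> [_ [p [a [b [Aa Bb ->]]] <-]|_ [a [b [Aa Bb ->]]]].
    by exists a, b.
  by exists (t a b, t' (phi a) (psi b)) => //; exists a, b.
move=> bPhi e; have [|b e'] := @lin_ext_spec _ _ _ P _ bPhi.
  by move=> _ [a [b [Aa Bb ->]]]; exact: e.
split=> // a b' Aa Bb.
by apply: (e' (t a b', t' (phi a) (psi b'))); exists a, b'.
Qed.

Lemma tensmap_dflt H K L H' K' L' (t : op H -> op K -> op L)
    (t' : op H' -> op K' -> op L') (A : set (op H)) (B : set (op K))
    (phi : op H -> op H') (psi : op K -> op K') :
  (bounded_linear_on (mintens t A B) (tensmap t t' A B phi psi) /\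
   forall a b, A a -> B b ->
     tensmap t t' A B phi psi (t a b) = t' (phi a) (psi b)) \/
  tensmap t t' A B phi psi = 0.
Proof.
rewrite /tensmap /mintens; set P := (X in lin_ext X); set S := (X in clspan X).
have <- : [set p.1 | p in P] = S.
  apply/seteqP; split=> [_ [p [a [b [Aa Bb ->]]] <-]|_ [a [b [Aa Bb ->]]]].
    by exists a, b.
  by exists (t a b, t' (phi a) (psi b)) => //; exists a, b.
have [[b e]|] := lin_ext_dflt P; [left|by right].
split=> // a b' Aa Bb.
by apply: (e (t a b', t' (phi a) (psi b'))); exists a, b'.
Qed.

Lemma mintens_bounded (I : choiceType) H (A : set (op H)) (B : set (op (ell2 R I))) :
  A `<=` @bounded_op R H -> B `<=` @bounded_op R (ell2 R I) ->
  [set T | exists a b, [/\ A a, B b & T = @tens R I H a b]] `<=` @bounded_op R _.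
Proof. by move=> bA bB _ [a [b [/bA Aa /bB Bb ->]]]; exact: bounded_tens. Qed.

(** The entries of [a \otimes b] are multiples of [a], so all entries of the tensor product lie in
    [A] and [cc_entries] applies. Linearity follows because an operator is determined by its
    entries. *)
Lemma tensmap_cc (I : choiceType) H K (A : set (op H)) (B : set (op (ell2 R I)))
    (phi : op H -> op K) :
  closed_subspace A -> linear_on A phi -> (forall a, A a -> bounded_op (phi a)) ->
  completely_contractive A phi -> B `<=` @bounded_op R (ell2 R I) ->
  bounded_linear_on (mintens (@tens R I H) A B)
    (tensmap (@tens R I H) (@tens R I K) A B phi id) /\
  forall a b, A a -> B b ->
    tensmap (@tens R I H) (@tens R I K) A B phi id (tens a b) = tens (phi a) b.
Proof.
move=> cA lphi bphi cc bB.
set D := mintens _ _ _.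
have bD0 := @mintens_bounded I H A B (closed_bounded cA) bB.
have bD : D `<=` @bounded_op R _ by exact: clspan_bounded.
have cD : closed_subspace D by exact: smallest_closed.
have entD X i j : D X -> A (entry X i j).
  have be : bounded_linear_on D (fun Y => entry Y i j).
    by apply: bl_sub bD (bl_entry _ _ _).
  apply: (bl_clspan_sub bD0 cA be) => _ [a [b [Aa Bb ->]]].
  rewrite entry_tens; last exact: bB.
    exact: closed_scale.
  exact: closed_bounded Aa.
pose Phi (X : op (L2 I H)) : op (L2 I K) :=
  xget 0 [set X' | bounded_op X' /\ opnorm X' <= opnorm X /\
    forall i j, entry X' i j = phi (entry X i j)].
have PhiP X : D X -> [/\ bounded_op (Phi X), opnorm (Phi X) <= opnorm X
    & forall i j, entry (Phi X) i j = phi (entry X i j)].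
  move=> DX; rewrite /Phi; case: xgetP => [X' _ [? [? ?]] //|no].
  have [X' [b n e]] := cc_entries cA bphi cc (bD _ DX) (fun i j => entD _ i j DX).
  by case: (no X').
apply: (@tensmap_spec _ _ _ _ _ _ _ _ _ _ _ _ Phi); first split.
- move=> c S T DS DT; have DST : D (c *: S + T) by exact: (closed_lin cD).
  have [bS _ eS] := PhiP _ DS; have [bT _ eT] := PhiP _ DT.
  have [bST _ eST] := PhiP _ DST.
  apply: entry_ext => //; first exact: bounded_lin.
  move=> i j; rewrite eST -[RHS]/(c *: entry (Phi S) i j + entry (Phi T) i j).
  by rewrite eS eT -lphi//; exact: entD.
- by exists 1 => X DX; rewrite mul1r; have [] := PhiP _ DX.
- move=> a b Aa Bb; have DX : D (tens a b).
    by apply: (sub_clspan (S := [set T | _])); exists a, b.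
  have ba := closed_bounded cA Aa; have bb := bB _ Bb.
  have [b1 _ e] := PhiP _ DX.
  apply: entry_ext => //; first by apply: bounded_tens => //; exact: bphi.
  move=> i j; rewrite e !entry_tens//; last exact: bphi.
  have p0 : phi 0 = 0.
    have := lphi (-1) 0 0 (closed_zero cA) (closed_zero cA).
    by rewrite !scaleN1r !addNr.
  rewrite -[_ *: a]addr0 lphi//; last exact: closed_zero.
  by rewrite p0 addr0.
Qed.

End Matrices.

(** * Reindexing unitaries and triple tensor products *)

Section Reindexing.
Variable R : realType.
Implicit Types (I J K : choiceType) (H E : hilbertType R).

Lemma reidx_l2 I J H (s : J -> I) (x : L2 I H) : injective s ->
  (fun j => x (s j)) \in l2pred (H := H).
Proof.
move=> inj_s; apply: (@l2_intro _ _ _ _ (hsq x)) => F uF.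
by rewrite -(big_map s xpredT (fun i => hsq (x i))) bessel ?map_inj_uniq.
Qed.

Fact reidx_exists I J H : {r : (J -> I) -> L2 I H -> L2 J H |
  forall s x j, injective s -> r s x j = x (s j)}.
Proof.
exists (fun s x => mkl2 (fun j => x (s j))) => s x j inj_s.
by rewrite mkl2E// reidx_l2.
Qed.

Definition reidx I J H := sval (reidx_exists I J H).

Lemma reidxE I J H (s : J -> I) (x : L2 I H) j : injective s ->
  reidx s x j = x (s j).
Proof. exact: (svalP (reidx_exists I J H)). Qed.

Lemma hsq_reidx I J H (s : J -> I) (x : L2 I H) : injective s ->
  hsq (reidx s x) <= hsq x.
Proof.
move=> inj_s; apply: l2_hsq_le => F uF; under eq_bigr do rewrite reidxE//.
by rewrite -(big_map s xpredT (fun i => hsq (x i))) bessel ?map_inj_uniq.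
Qed.

Lemma flat_bound I J H (x : L2 J (L2 I H)) (F : seq (J * I)) : uniq F ->
  \sum_(p <- F) hsq (x p.1 p.2) <= hsq x.
Proof.
move=> uF; set F1 := undup (map fst F); set F2 := undup (map snd F).
apply: (@le_trans _ _ (\sum_(p <- [seq (j, i) | j <- F1, i <- F2]) hsq (x p.1 p.2))).
  apply: sum_le_subset => //; last by move=> p; exact: hsq_ge0.
    by apply: allpairs_uniq; rewrite ?undup_uniq// => -[? ?] [? ?].
  move=> [j i] h; apply/allpairsP; exists (j, i); split => //=; rewrite mem_undup.
    by apply/mapP; exists (j, i).
  by apply/mapP; exists (j, i).
rewrite big_allpairs; apply: le_trans (bessel x (undup_uniq (map fst F))).
by apply: ler_sum => j _; exact: (bessel (x j) (undup_uniq (map snd F))).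
Qed.

Fact flat_exists I J H : {f : L2 J (L2 I H) -> L2 (J * I)%type H |
  forall x p, f x p = x p.1 p.2}.
Proof.
exists (fun x : L2 J (L2 I H) => mkl2 (fun p => x p.1 p.2)) => x p.
by rewrite mkl2E//; exact: l2_intro (flat_bound x).
Qed.

(** Merging two indices into one reduces statements on [tens2] to statements on [tens]. *)
Definition flat I J H := sval (flat_exists I J H).

Lemma flatE I J H (x : L2 J (L2 I H)) p : flat x p = x p.1 p.2.
Proof. exact: (svalP (flat_exists I J H)). Qed.

Lemma hsq_flat I J H (x : L2 J (L2 I H)) : hsq (flat x) <= hsq x.
Proof.
apply: l2_hsq_le => F uF; under eq_bigr do rewrite flatE.
exact: flat_bound.
Qed.

Definition row I J H (y : L2 (J * I)%type H) (j : J) : L2 I H :=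
  reidx (fun i => (j, i)) y.

Lemma rowE I J H (y : L2 (J * I)%type H) j i : row y j i = y (j, i).
Proof. by rewrite /row reidxE// => ? ? []. Qed.

(** Each row norm is itself an infinite sum. It is replaced by a finite one up to a small error, and
    the finite pieces together form one duplicate-free list of pairs. *)
Lemma row_bound I J H (y : L2 (J * I)%type H) (F : seq J) : uniq F ->
  \sum_(j <- F) hsq (row y j) <= hsq y.
Proof.
move=> uF; apply/ler_addgt0Pr => e e0.
(* There are [size F] errors of size [e / k]; the successor keeps the divisor nonzero for an empty
   [F]. *)
set k : R := (size F).+1%:R; have k0 : 0 < k by rewrite ltr0n.
have /choice[f hf] : forall j, exists Fj, uniq Fj /\
    hsq (row y j) - e / k < \sum_(i <- Fj) hsq (row y j i).
  by move=> j; have [Fj u n] := l2_near (row y j) (divr_gt0 e0 k0); exists Fj.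
apply: (@le_trans _ _ (\sum_(j <- F) (\sum_(i <- f j) hsq (y (j, i)) + e / k))).
  apply: ler_sum => j _; have [_ h] := hf j.
  rewrite -lerBlDr; apply: le_trans (ltW h) _.
  by apply: ler_sum => i _; rewrite rowE.
rewrite big_split/= lerD//.
  have <- : \sum_(p <- [seq (j, i) | j <- F, i <- f j]) hsq (y p) =
      \sum_(j <- F) \sum_(i <- f j) hsq (y (j, i)) by rewrite big_allpairs_dep.
  apply: bessel; apply: allpairs_uniq_dep => //; first by move=> j _; exact: (hf j).1.
  by move=> [? ?] [? ?] _ _ /= [-> ->].
rewrite big_const_seq count_predT iter_addr addr0 -mulr_natr -mulrA ler_piMr ?(ltW e0)//.
by rewrite mulrC ler_pdivrMr// mul1r ler_nat.
Qed.

Fact unflat_exists I J H : {f : L2 (J * I)%type H -> L2 J (L2 I H) |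
  forall y j i, f y j i = y (j, i)}.
Proof.
exists (fun y => mkl2 (row y)) => y j i.
by rewrite mkl2E ?rowE//; apply: l2_intro (row_bound y).
Qed.

Definition unflat I J H := sval (unflat_exists I J H).

Lemma unflatE I J H (y : L2 (J * I)%type H) j i : unflat y j i = y (j, i).
Proof. exact: (svalP (unflat_exists I J H)). Qed.

Lemma hsq_unflat I J H (y : L2 (J * I)%type H) : hsq (unflat y) <= hsq y.
Proof.
apply: l2_hsq_le => F uF.
rewrite (eq_bigr (fun j => hsq (row y j))); first exact: row_bound.
by move=> j _; congr hsq; apply: L2_ext => i; rewrite unflatE rowE.
Qed.

Lemma flatK I J H : cancel (@flat I J H) (@unflat I J H).
Proof.
by move=> x; apply: L2_ext => j; apply: L2_ext => i; rewrite unflatE flatE.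
Qed.

Lemma unflatK I J H : cancel (@unflat I J H) (@flat I J H).
Proof. by move=> y; apply: L2_ext => -[j i]; rewrite flatE unflatE. Qed.

Lemma coord_linear I H E (T : E -> L2 I H) (f : I -> E -> H) :
  (forall x i, T x i = f i x) -> (forall i, linear (f i)) -> linear T.
Proof.
move=> h lf a x y; apply: L2_ext => i.
by rewrite L2_addE L2_scaleE !h lf.
Qed.

Lemma contraction_blin H E (T : H -> E) : linear T ->
  (forall x, hsq (T x) <= hsq x) -> blin T.
Proof.
by move=> lT h; split=> //; exists 1 => x; rewrite mul1r hnorm_le ?hnorm_ge0// hnorm_sq.
Qed.

Lemma blin_flat I J H : blin (@flat I J H).
Proof.
apply: contraction_blin; last exact: hsq_flat.
apply: (@coord_linear (J * I)%type H _ (@flat I J H)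
  (fun p (x : L2 J (L2 I H)) => x p.1 p.2)); first exact: flatE.
by move=> p; exact: (blin_comp (blin_coord _ p.2) (blin_coord _ p.1)).1.
Qed.

Lemma blin_unflat I J H : blin (@unflat I J H).
Proof.
apply: contraction_blin; last exact: hsq_unflat.
apply: (@coord_linear J (L2 I H) _ (@unflat I J H) (fun j y => row y j)).
  by move=> y j; apply: L2_ext => i; rewrite unflatE rowE.
move=> j; apply: (@coord_linear I H _ (fun y => row y j)
  (fun i (y : L2 (J * I)%type H) => y (j, i))).
  by move=> y i; exact: rowE.
by move=> i; exact: (blin_coord _ (j, i)).1.
Qed.

Lemma blin_reidx I J H (s : J -> I) : injective s -> blin (@reidx I J H s).
Proof.
move=> inj_s; apply: contraction_blin; last by move=> x; exact: hsq_reidx.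
apply: (@coord_linear J H _ (@reidx I J H s) (fun j (x : L2 I H) => x (s j))).
  by move=> x j; exact: reidxE.
by move=> j; exact: (blin_coord _ (s j)).1.
Qed.

Lemma hnorm_flat I J H (x : L2 J (L2 I H)) : hnorm (flat x) = hnorm x.
Proof.
rewrite !hnormE; congr Num.sqrt; apply/eqP; rewrite eq_le hsq_flat/=.
by rewrite -{1}(flatK x) hsq_unflat.
Qed.

Lemma hnorm_unflat I J H (y : L2 (J * I)%type H) : hnorm (unflat y) = hnorm y.
Proof. by rewrite -hnorm_flat unflatK. Qed.

Section Perm2.
Variables I J I' J' : choiceType.

(** Pullback along [s], with the outer index first: [e_g \otimes e_h] sits at the pair [(h, g)]. The
    unitary [U], the flip and the conjugating unitary of the duality are all of this form. *)
Definition perm2 H (s : J' * I' -> J * I) (x : L2 J (L2 I H)) : L2 J' (L2 I' H) :=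
  unflat (reidx s (flat x)).

Lemma perm2E H (s : J' * I' -> J * I) (x : L2 J (L2 I H)) j i : injective s ->
  perm2 s x j i = x (s (j, i)).1 (s (j, i)).2.
Proof. by move=> inj_s; rewrite /perm2 unflatE reidxE// flatE. Qed.

Lemma blin_perm2 H (s : J' * I' -> J * I) : injective s -> blin (@perm2 H s).
Proof.
move=> inj_s; apply: (blin_comp (blin_unflat _ _ _)).
exact: (blin_comp (blin_reidx _ inj_s) (blin_flat _ _ _)).
Qed.

Lemma hsq_perm2 H (s : J' * I' -> J * I) (x : L2 J (L2 I H)) : injective s ->
  hsq (perm2 s x) <= hsq x.
Proof.
move=> inj_s; apply: le_trans (hsq_unflat _) _.
exact: le_trans (hsq_reidx _ inj_s) (hsq_flat _).
Qed.

End Perm2.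

Lemma perm2K I J I' J' H (s : J' * I' -> J * I) (t : J * I -> J' * I') :
  cancel s t -> cancel t s -> cancel (@perm2 _ _ _ _ H s) (perm2 t).
Proof.
move=> st ts x; apply: L2_ext => j; apply: L2_ext => i.
rewrite (perm2E _ _ _ (can_inj ts)) (perm2E _ _ _ (can_inj st)).
by rewrite -surjective_pairing ts.
Qed.

Lemma hnorm_perm2 I J I' J' H (s : J' * I' -> J * I) (t : J * I -> J' * I')
    (x : L2 J (L2 I H)) :
  cancel s t -> cancel t s -> hnorm (perm2 s x) = hnorm x.
Proof.
move=> st ts; rewrite !hnormE; congr Num.sqrt; apply/eqP; rewrite eq_le.
rewrite hsq_perm2/=; last exact: can_inj st.
rewrite -{1}(perm2K st ts x); apply: hsq_perm2; exact: can_inj ts.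
Qed.

Lemma ev2E I J H (j j' : J) (i i' : I) (v : H) :
  ev j (ev i v) j' i' = if (j', i') == (j, i) then v else 0.
Proof.
by rewrite evE xpair_eqE; case: eqP => _ /=; rewrite ?evE// L2_zeroE.
Qed.

Lemma blin_ext2 I J H E (X Y : L2 J (L2 I H) -> E) : blin X -> blin Y ->
  (forall j i v, X (ev j (ev i v)) = Y (ev j (ev i v))) -> forall x, X x = Y x.
Proof.
move=> bX bY h; apply: blin_ext => // j; apply: blin_ext => [||i v].
- exact: (blin_comp bX (blin_ev _ _)).
- exact: (blin_comp bY (blin_ev _ _)).
- exact: h.
Qed.

(** Polarization: norms of sums give the real part, and replacing [y] by [i y] gives the imaginary
    part. *)
Lemma isometry_hdot H E (T : H -> E) : linear T ->
  (forall x, hnorm (T x) = hnorm x) -> forall x y, hdot (T x) (T y) = hdot x y.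
Proof.
move=> lT iT.
have hT x : hsq (T x) = hsq x by rewrite -!hnorm_sq iT.
have ReT x y : complex.Re (hdot (T x) (T y)) = complex.Re (hdot x y).
  have := hT (x + y); rewrite (linear_add lT) !hsqD !hT => /addrI.
  by rewrite !mulr2n; lra.
move=> x y; have := ReT x ('i%C *: y); rewrite (linear_scale lT) !hdotZr.
have := ReT x y; case: (hdot (T x) _) => a b; case: (hdot x y) => c d /= ->.
by rewrite !mul0r !sub0r !mulN1r !opprK => ->.
Qed.

Lemma adjE H (T S : op H) : bounded_op T -> bounded_op S ->
  (forall x y, hdot (T x) y = hdot x (S y)) -> adj T = S.
Proof.
move=> bT bS h; rewrite /adj; case: xgetP => [S' _ h'|no]; last by case: (no S).
apply/funext => y; apply: hdot_ext => z; rewrite hdotC [RHS]hdotC.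
by rewrite -h -(h' z y).
Qed.

Lemma adj_perm2 I J H (s t : J * I -> J * I) : cancel s t -> cancel t s ->
  adj (@perm2 I J I J H s) = perm2 t.
Proof.
move=> st ts; apply: adjE.
- exact: blin_perm2 (can_inj st).
- exact: blin_perm2 (can_inj ts).
move=> x y; rewrite -{1}(perm2K ts st y) (isometry_hdot (blin_perm2 H (can_inj st)).1)//.
by move=> z; exact: hnorm_perm2 st ts.
Qed.

End Reindexing.

(** * Tensor products with two square-summable factors *)

Section Tensor2.
Variables (R : realType) (I J : choiceType).
Implicit Types H K : hilbertType R.

Lemma tensv2_amp H (v : H) (w : L2 J (ell2 R I)) :
  tensv2 v w = amp (fun x : ell2 R I => tensv v x) w.
Proof.
apply: L2_ext => j; rewrite ampE; last exact: blin_tensvr.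
rewrite /tensv2 mkl2E//; exact: amp_l2 (blin_tensvr I v).
Qed.

Lemma tensv2E H (v : H) (w : L2 J (ell2 R I)) j i :
  tensv2 v w j i = (w j i : R[i]) *: v.
Proof. by rewrite tensv2_amp ampE ?tensvE//; exact: blin_tensvr. Qed.

Lemma tensv2_ev H (v : H) (j : J) (i : I) (z : R[i]^o) :
  tensv2 v (ev j (ev i z)) = ev j (ev i ((z : R[i]) *: v)).
Proof.
apply: L2_ext => j'; apply: L2_ext => i'; rewrite tensv2E !ev2E.
by case: eqP => //; rewrite scale0r.
Qed.

Lemma flat_tensv2 H (v : H) (w : L2 J (ell2 R I)) :
  flat (tensv2 v w) = tensv v (flat w).
Proof. by apply: L2_ext => p; rewrite flatE tensv2E tensvE flatE. Qed.

Definition conjflat H (X : op (L2 J (L2 I H))) : op (L2 (J * I)%type H) :=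
  @flat R I J H \o X \o @unflat R I J H.

Definition conjunflat H (X : op (L2 (J * I)%type H)) : op (L2 J (L2 I H)) :=
  @unflat R I J H \o X \o @flat R I J H.

Lemma conjflatE H (X : op (L2 J (L2 I H))) y :
  conjflat X y = flat (X (unflat y)).
Proof. by []. Qed.

Lemma conjunflatE H (X : op (L2 (J * I)%type H)) x :
  conjunflat X x = unflat (X (flat x)).
Proof. by []. Qed.

Lemma conjunflatK H (X : op (L2 (J * I)%type H)) : conjflat (conjunflat X) = X.
Proof.
apply/funext => y; rewrite conjflatE conjunflatE.
rewrite (unflatK y).
by rewrite unflatK.
Qed.

Lemma bounded_conjflat H (X : op (L2 J (L2 I H))) : bounded_op X ->
  bounded_op (conjflat X).
Proof.
move=> bX; apply: (blin_comp (blin_comp (blin_flat _ _ _) bX)).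
exact: blin_unflat.
Qed.

Lemma bounded_conjunflat H (X : op (L2 (J * I)%type H)) : bounded_op X ->
  bounded_op (conjunflat X).
Proof.
move=> bX; apply: (blin_comp (blin_comp (blin_unflat _ _ _) bX)).
exact: blin_flat.
Qed.

Lemma opnorm_conjflat H (X : op (L2 J (L2 I H))) : bounded_op X ->
  opnorm (conjflat X) <= opnorm X.
Proof.
move=> bX; apply: opnorm_le => [|x]; first exact: opnorm_ge0.
rewrite conjflatE hnorm_flat -(hnorm_unflat x); exact: le_opnorm.
Qed.

Lemma opnorm_conjunflat H (X : op (L2 (J * I)%type H)) : bounded_op X ->
  opnorm (conjunflat X) <= opnorm X.
Proof.
move=> bX; apply: opnorm_le => [|x]; first exact: opnorm_ge0.
rewrite conjunflatE hnorm_unflat -(hnorm_flat x); exact: le_opnorm.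
Qed.

Lemma bl_conjflat H :
  bounded_linear_on (@bounded_op R (L2 J (L2 I H))) (@conjflat H).
Proof.
split.
  by move=> c S T _ _; apply/funext => x; rewrite /conjflat/= (blin_flat _ _ _).1.
exists 1 => T bT; rewrite mul1r; split; first exact: bounded_conjflat.
exact: opnorm_conjflat.
Qed.

Lemma bl_conjunflat H :
  bounded_linear_on (@bounded_op R (L2 (J * I)%type H)) (@conjunflat H).
Proof.
split.
  by move=> c S T _ _; apply/funext => x; rewrite /conjunflat/= (blin_unflat _ _ _).1.
exists 1 => T bT; rewrite mul1r; split; first exact: bounded_conjunflat.
exact: opnorm_conjunflat.
Qed.

Lemma tens2_uniq H (X X' : op (L2 J (L2 I H))) : bounded_op X -> bounded_op X' ->
  (forall v w, X (tensv2 v w) = X' (tensv2 v w)) -> X = X'.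
Proof.
move=> bX bX' h; apply/funext; apply: blin_ext2 => // j i v.
by have := h v (ev j (ev i (1 : R[i]^o))); rewrite tensv2_ev scale1r.
Qed.

Lemma tens2_unique H (S : op H) (T : op (L2 J (ell2 R I))) (X : op (L2 J (L2 I H))) :
  bounded_op X -> (forall v w, X (tensv2 v w) = tensv2 (S v) (T w)) ->
  tens2 S T = X.
Proof.
move=> bX hX; rewrite /tens2; case: xgetP => [X' _ [bX' hX']|no].
  by apply: tens2_uniq => // v w; rewrite hX hX'.
by case: (no X).
Qed.

Section Spec.
Variables (H : hilbertType R) (S : op H) (T : op (L2 J (ell2 R I))).
Hypotheses (bS : bounded_op S) (bT : bounded_op T).

(** Boundedness, norm estimates and linearity of [tens2] are obtained from those of [tens] through
    this identity. *)
Lemma tens2_flat : tens2 S T = conjunflat (tens S (conjflat T)).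
Proof.
have bcT : bounded_op (conjflat T) by exact: bounded_conjflat.
apply: tens2_unique; first by apply: bounded_conjunflat; exact: bounded_tens.
move=> v w; rewrite conjunflatE flat_tensv2 (tens_tensv bS bcT).
by rewrite conjflatE (flatK w) -flat_tensv2 (flatK (tensv2 _ _)).
Qed.

Lemma bounded_tens2 : bounded_op (tens2 S T).
Proof.
by rewrite tens2_flat; apply: bounded_conjunflat; apply: bounded_tens => //;
  exact: bounded_conjflat.
Qed.

Lemma tens2_tensv2 v w : tens2 S T (tensv2 v w) = tensv2 (S v) (T w).
Proof.
rewrite tens2_flat conjunflatE flat_tensv2 (tens_tensv bS (bounded_conjflat bT)).
by rewrite conjflatE (flatK w) -flat_tensv2 (flatK (tensv2 _ _)).
Qed.

Lemma tens2_ev v j i :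
  tens2 S T (ev j (ev i v)) = tensv2 (S v) (T (ev j (ev i (1 : R[i]^o)))).
Proof. by rewrite -tens2_tensv2 tensv2_ev scale1r. Qed.

Lemma tens2_def (X : op (L2 J (L2 I H))) : bounded_op X ->
  (forall v j i, X (ev j (ev i v)) =
    tensv2 (S v) (T (ev j (ev i (1 : R[i]^o))))) -> tens2 S T = X.
Proof.
move=> bX h; apply/funext; apply: blin_ext2 => //; first exact: bounded_tens2.
by move=> j i v; rewrite tens2_ev h.
Qed.

Lemma conjflat_tens2 : conjflat (tens2 S T) = tens S (conjflat T).
Proof.
by rewrite tens2_flat conjunflatK.
Qed.

End Spec.

Lemma tens2_comp H (S S' : op H) (T T' : op (L2 J (ell2 R I))) :
  bounded_op S -> bounded_op S' -> bounded_op T -> bounded_op T' ->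
  tens2 S T \o tens2 S' T' = tens2 (S \o S') (T \o T').
Proof.
move=> bS bS' bT bT'.
have bSS := bounded_comp bS bS'; have bTT := bounded_comp bT bT'.
apply: tens2_uniq (bounded_tens2 bSS bTT) _.
  exact: bounded_comp (bounded_tens2 bS bT) (bounded_tens2 bS' bT').
move=> v w; rewrite (tens2_tensv2 bSS bTT).
transitivity (tens2 S T (tens2 S' T' (tensv2 v w))); first by [].
by rewrite (tens2_tensv2 bS' bT') (tens2_tensv2 bS bT).
Qed.

Lemma bl_tens2r H (S : op H) : bounded_op S ->
  bounded_linear_on (@bounded_op R (L2 J (ell2 R I))) (fun T => tens2 S T).
Proof.
move=> bS.
apply: (@bl_eqfun _ _ _ _ _ (@conjunflat H \o ((fun T => tens S T) \o @conjflat R[i]^o))).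
- exact: closed_subspace_bounded.
- by move=> T bT; exact: tens2_flat.
- have b1 : bounded_linear_on (@bounded_op R (L2 J (ell2 R I)))
      ((fun T => tens S T) \o @conjflat R[i]^o).
    apply: bl_comp (bl_conjflat _) _ (bl_tensr (J * I)%type bS).
    by move=> T; exact: bounded_conjflat.
  apply: bl_comp b1 _ (bl_conjunflat H).
  by move=> T bT; apply: (bounded_tens bS); exact: bounded_conjflat.
Qed.

(** Associativity of the tensor product. It allows the two sides of the coaction identity, one built
    with [tens] and one with [tens2], to be compared. *)
Lemma tens2_tens H (S : op H) (T1 : op (ell2 R I)) (T2 : op (ell2 R J)) :
  bounded_op S -> bounded_op T1 -> bounded_op T2 ->
  tens2 S (tens T1 T2) = tens (tens S T1) T2.
Proof.
move=> bS b1 b2; have bt := bounded_tens b1 b2; have bt' := bounded_tens bS b1.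
apply: tens2_def => //; first exact: bounded_tens.
move=> v j i; rewrite !tens_ev//; apply: L2_ext => j'; apply: L2_ext => i'.
rewrite tensvE L2_scaleE tensvE tensv2E tensvE L2_scaleE scalerA.
by [].
Qed.

Lemma mintens2_bounded H (A : set (op H)) (B : set (op (L2 J (ell2 R I)))) :
  A `<=` @bounded_op R H -> B `<=` @bounded_op R _ ->
  [set T | exists a b, [/\ A a, B b & T = @tens2 R I J H a b]] `<=` @bounded_op R _.
Proof. by move=> bA bB _ [a [b [/bA Aa /bB Bb ->]]]; exact: bounded_tens2. Qed.

(** After flattening, [B] becomes a space of operators over the single index set [J * I], where
    [tensmap_cc] applies. *)
Lemma tens2_cc H K (A : set (op H)) (B : set (op (L2 J (ell2 R I))))
    (phi : op H -> op K) :
  closed_subspace A -> linear_on A phi -> (forall a, A a -> bounded_op (phi a)) ->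
  completely_contractive A phi -> B `<=` @bounded_op R _ ->
  exists Phi, bounded_linear_on (mintens (@tens2 R I J H) A B) Phi /\
    forall a b, A a -> B b -> Phi (tens2 a b) = tens2 (phi a) b.
Proof.
move=> cA lphi bphi cc bB.
pose B' : set (op (ell2 R (J * I)%type)) := [set @conjflat R[i]^o b | b in B].
have bB' : B' `<=` @bounded_op R _ by move=> _ [b /bB bb <-]; exact: bounded_conjflat.
have bA : A `<=` @bounded_op R H by move=> a /(closed_bounded cA).
have [bl e] := tensmap_cc cA lphi bphi cc bB'.
set Phi := tensmap _ _ _ _ _ _ in bl e.
have bS2 := mintens2_bounded bA bB.
exists (fun X => conjunflat (Phi (conjflat X))); split; last first.
  move=> a b Aa Bb; rewrite conjflat_tens2; [|exact: bA|exact: bB].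
  rewrite e//; last by exists b.
  by rewrite -tens2_flat//; [exact: bphi|exact: bB].
have bl0 : bounded_linear_on (mintens (@tens2 R I J H) A B) (@conjflat H).
  by apply: bl_sub (bl_conjflat H); exact: clspan_bounded.
have bl1 : bounded_linear_on (mintens (@tens2 R I J H) A B) (Phi \o @conjflat H).
  apply: (bl_comp bl0 _ bl); apply: (bl_clspan_sub bS2 _ bl0).
    exact/smallest_closed/mintens_bounded.
  move=> _ [a [b [Aa Bb ->]]]; rewrite conjflat_tens2; [|exact: bA|exact: bB].
  by apply: (sub_clspan (S := [set T | _])); exists a, (conjflat b); split => //; exists b.
apply: (bl_comp (D' := @bounded_op R _) bl1 _ (bl_conjunflat _)).
by move=> X DX; case: bl1 => _ [M /(_ _ DX)[]].
Qed.

End Tensor2.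

(** * Conjugations and complete isometries *)

Section Isometries.
Variable R : realType.
Implicit Types (I : choiceType) (H K L : hilbertType R).

(** A unitary between two possibly different spaces, carried together with its inverse so that no
    adjoint has to be computed. *)
Definition isometric_inverses H K (U : H -> K) (V : K -> H) : Prop :=
  [/\ linear U, linear V, forall x, hnorm (U x) = hnorm x & cancel U V] /\
  cancel V U.

Section Conjugation.
Variables (H K : hilbertType R) (U : H -> K) (V : K -> H).
Hypothesis UV : isometric_inverses U V.

Lemma isometric_inverses_sym : isometric_inverses V U.
Proof.
case: UV => -[lU lV iU VU] UVc; split=> //; split=> // y.
by rewrite -iU UVc.
Qed.

Lemma blin_isometry : blin U.
Proof. by case: UV => -[lU _ iU _] _; split=> //; exists 1 => x; rewrite mul1r iU. Qed.

Definition conj_by (T : op H) : op K := U \o T \o V.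

Lemma bounded_conj (T : op H) : blin V -> bounded_op T -> bounded_op (conj_by T).
Proof. by move=> bV bT; exact: (blin_comp (blin_comp blin_isometry bT) bV). Qed.

Lemma opnorm_conj_le (T : op H) : bounded_op T ->
  (forall y, hnorm (V y) = hnorm y) -> opnorm (conj_by T) <= opnorm T.
Proof.
move=> bT iV; apply: opnorm_le; first exact: opnorm_ge0.
move=> y; case: UV => -[_ _ iU _] _.
rewrite -[conj_by T y]/(U (T (V y))) iU -(iV y); exact: le_opnorm.
Qed.

End Conjugation.

Section ConjugationInv.
Variables (H K : hilbertType R) (U : H -> K) (V : K -> H).
Hypothesis UV : isometric_inverses U V.

Let VU := isometric_inverses_sym UV.
Let bU := blin_isometry UV.
Let bV := blin_isometry VU.
Let iU : forall x, hnorm (U x) = hnorm x. Proof. by case: UV => -[]. Qed.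
Let iV : forall x, hnorm (V x) = hnorm x. Proof. by case: VU => -[]. Qed.

Lemma conj_byK : cancel (conj_by U V) (conj_by V U).
Proof.
move=> T; apply/funext => x; case: UV => -[_ _ _ UVc] _.
by rewrite -[LHS]/(V (U (T (V (U x))))) !UVc.
Qed.

Lemma opnorm_conj (T : op H) : bounded_op T -> opnorm (conj_by U V T) = opnorm T.
Proof.
move=> bT; apply/eqP; rewrite eq_le opnorm_conj_le//=.
by rewrite -{1}(conj_byK T) opnorm_conj_le//; exact: bounded_conj.
Qed.

Lemma bounded_conj_by (T : op H) : bounded_op T -> bounded_op (conj_by U V T).
Proof. by move=> bT; exact: bounded_conj. Qed.

Lemma conj_by_lin c (S T : op H) :
  conj_by U V (c *: S + T) = c *: conj_by U V S + conj_by U V T.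
Proof. by apply/funext => y; exact: bU.1. Qed.

Lemma conj_by_comp (S T : op H) :
  conj_by U V (S \o T) = conj_by U V S \o conj_by U V T.
Proof.
apply/funext => y; case: UV => -[_ _ _ UVc] _.
by rewrite -[RHS]/(U (S (V (U (T (V y)))))) UVc.
Qed.

Lemma bl_conj : bounded_linear_on (@bounded_op R H) (conj_by U V).
Proof.
split; first by move=> c S T _ _; exact: conj_by_lin.
exists 1 => T bT; rewrite mul1r opnorm_conj//; split=> //.
exact: bounded_conj_by.
Qed.

End ConjugationInv.

Lemma isometric_inverses_amp I H K (U : H -> K) (V : K -> H) :
  isometric_inverses U V -> isometric_inverses (@amp R I H K U) (amp V).
Proof.
move=> UV; have VU := isometric_inverses_sym UV.
have bU := blin_isometry UV; have bV := blin_isometry VU.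
have c1 : cancel (@amp R I H K U) (amp V).
  move=> x; apply: L2_ext => i; rewrite !ampE//.
  by case: UV => -[_ _ _ ->].
have c2 : cancel (@amp R I K H V) (amp U).
  move=> x; apply: L2_ext => i; rewrite !ampE//.
  by case: UV => -[_ _ _ _] ->.
have le1 (x : L2 I H) : hnorm (amp U x) <= hnorm x.
  rewrite -[leRHS]mul1r; apply: amp_bound => // y.
  by rewrite mul1r; case: UV => -[_ _ -> _] _.
have le2 (x : L2 I K) : hnorm (amp V x) <= hnorm x.
  rewrite -[leRHS]mul1r; apply: amp_bound => // y.
  by rewrite mul1r; case: VU => -[_ _ -> _] _.
split=> //; split=> //; [exact: amp_linear|exact: amp_linear|].
by move=> x; apply/eqP; rewrite eq_le le1/= -{1}(c1 x) le2.
Qed.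

Lemma isometric_inverses_perm2 (I J I' J' : choiceType) H
    (s : J' * I' -> J * I) (t : J * I -> J' * I') : cancel s t -> cancel t s ->
  isometric_inverses (@perm2 R I J I' J' H s) (perm2 t).
Proof.
move=> st ts; split; last exact: perm2K.
split; last exact: perm2K.
- exact: (blin_perm2 H (can_inj st)).1.
- exact: (blin_perm2 H (can_inj ts)).1.
- by move=> x; exact: hnorm_perm2 st ts.
Qed.

(** On matrices, conjugation by [U] is conjugation by the amplified unitary, which preserves the
    norm. *)
Lemma ci_conj H K (U : H -> K) (V : K -> H) : isometric_inverses U V ->
  completely_isometric (@bounded_op R H) (conj_by U V).
Proof.
move=> UV n a ba; have VU := isometric_inverses_sym UV.
have bU := blin_isometry UV; have bV := blin_isometry VU.
have -> : mxop (map_mx (conj_by U V) a) = conj_by (amp U) (amp V) (mxop a).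
  apply/funext => x; apply: L2_ext => i.
  rewrite -[RHS]/(amp U (mxop a (amp V x)) i) ampE// !mxopE.
  rewrite (linear_bigsum bU.1); apply: eq_bigr => j _.
  by rewrite mxE ampE.
apply: opnorm_conj; first exact: isometric_inverses_amp.
exact: bounded_mxop.
Qed.

(** Exchanging the indices ['I_n] and [I] turns the matrix of amplifications into the amplification
    of the matrix, whose norm is unchanged because [I] is nonempty. *)
Lemma ci_amp I H : (exists i : I, True) ->
  completely_isometric (@bounded_op R H) (@amp R I H H).
Proof.
move=> I0 n a ba; pose s (J J' : choiceType) (p : J * J') := (p.2, p.1).
have sK (J J' : choiceType) : cancel (@s J J') (@s J' J) by case.
have UV := isometric_inverses_perm2 H (@sK 'I_n I) (@sK I 'I_n).
rewrite -[RHS](opnorm_ampE (bounded_mxop ba) I0).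
rewrite -[RHS](opnorm_conj UV); last exact: blin_amp (bounded_mxop ba).
congr opnorm; apply/funext => x; apply: L2_ext => i; apply: L2_ext => g.
set S : op _ := perm2 _; set T : op _ := perm2 _.
rewrite -[RHS]/(perm2 (@s 'I_n I) (amp (mxop a) (perm2 (@s I 'I_n) x)) i g).
rewrite (perm2E _ _ _ (can_inj (@sK 'I_n I))) (ampE _ _ (bounded_mxop ba)).
rewrite !mxopE L2_sumE; apply: eq_bigr => j _.
rewrite mxE (ampE _ _ (ba i j)).
by rewrite (perm2E _ _ _ (can_inj (@sK I 'I_n))).
Qed.

Lemma ci_comp H K L (A : set (op H)) (B : set (op K)) (phi : op H -> op K)
    (psi : op K -> op L) :
  completely_isometric A phi -> (forall a, A a -> B (phi a)) ->
  completely_isometric B psi -> completely_isometric A (psi \o phi).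
Proof.
move=> c1 AB c2 n a Aa; rewrite map_mx_comp c2 ?c1//.
by move=> i j; rewrite mxE; exact: AB.
Qed.

Lemma ci_sub H K (A B : set (op H)) (phi : op H -> op K) : A `<=` B ->
  completely_isometric B phi -> completely_isometric A phi.
Proof. by move=> AB c n a Aa; apply: c => i j; exact: AB. Qed.

Lemma ci_eq H K (A : set (op H)) (phi psi : op H -> op K) :
  (forall a, A a -> phi a = psi a) ->
  completely_isometric A psi -> completely_isometric A phi.
Proof.
move=> e c n a Aa; rewrite -(c n a Aa).
suff -> : map_mx phi a = map_mx psi a by [].
by apply/matrixP => i j; rewrite !mxE e.
Qed.

Lemma ci_bl H K (A : set (op H)) (phi : op H -> op K) :
  A `<=` @bounded_op R H -> linear_on A phi ->
  (forall a, A a -> bounded_op (phi a)) -> completely_isometric A phi ->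
  bounded_linear_on A phi.
Proof.
move=> bA lphi bphi c; split=> //; exists 1 => T AT; split; first exact: bphi.
by rewrite mul1r (ci_opnorm c AT (bA _ AT) (bphi _ AT)).
Qed.

Lemma bl_amp I H : bounded_linear_on (@bounded_op R H) (@amp R I H H).
Proof.
split.
  move=> c S T bS bT; have bST : bounded_op (c *: S + T) by exact: bounded_lin.
  by apply/funext => x; apply: L2_ext => i; rewrite L2_addE L2_scaleE !ampE.
exists 1 => T bT; rewrite mul1r; split; first exact: blin_amp.
exact: opnorm_amp.
Qed.

Lemma amp_comp I H (S T : op H) : bounded_op S -> bounded_op T ->
  @amp R I H H (S \o T) = amp S \o amp T.
Proof.
move=> bS bT; have bST := bounded_comp bS bT.
apply/funext => x; apply: L2_ext => i; rewrite ampE//.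
by rewrite -[RHS]/(amp S (amp T x) i) !ampE.
Qed.

Lemma tens2_id_perm2 (I J : choiceType) H (s t : J * I -> J * I) :
  cancel s t -> cancel t s ->
  tens2 (id : op H) (@perm2 R I J I J R[i]^o s) = perm2 s.
Proof.
move=> st ts; have inj_s := can_inj st.
apply: tens2_def.
- exact: bounded_id.
- exact: blin_perm2.
- exact: blin_perm2.
move=> v j i; apply: L2_ext => j'; apply: L2_ext => i'.
rewrite tensv2E !(perm2E _ _ _ inj_s) !ev2E.
by case: ifP; rewrite ?scale1r ?scale0r.
Qed.

End Isometries.

(** * Group operators and reduced coactions *)

Section GroupOperators.
Variables (R : realType) (G : groupType).
Implicit Types (H K : hilbertType R) (I : choiceType).

Lemma mulg_inv_inj (g : G) : injective (fun h => (g^-1 * h)%g).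
Proof. exact: mulgI. Qed.

Lemma lreg_reidx (g : G) : lreg g = @reidx R G G R[i]^o (fun h => (g^-1 * h)%g).
Proof.
apply/funext => x; apply: L2_ext => h; rewrite reidxE; last exact: mulg_inv_inj.
rewrite /lreg mkl2E//; exact: reidx_l2 (@mulg_inv_inj g).
Qed.

Lemma lregE (g : G) (x : ell2 R G) h : lreg g x h = x (g^-1 * h)%g.
Proof. by rewrite lreg_reidx reidxE//; exact: mulg_inv_inj. Qed.

Lemma bounded_lreg (g : G) : bounded_op (@lreg R G g).
Proof. by rewrite lreg_reidx; apply: blin_reidx; exact: mulg_inv_inj. Qed.

Lemma lreg_one : @lreg R G 1%g = id.
Proof. by apply/funext => x; apply: L2_ext => h; rewrite lregE invg1 mul1g. Qed.

Lemma lreg_mulg (g h : G) : @lreg R G (g * h)%g = lreg g \o lreg h.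
Proof.
apply/funext => x; apply: L2_ext => k.
by rewrite -[RHS]/(lreg g (lreg h x) k) !lregE invgM mulgA.
Qed.

Lemma lreg_mulV (g : G) : @lreg R G g \o lreg g^-1%g = id.
Proof. by rewrite -lreg_mulg mulgV lreg_one. Qed.

Lemma lreg_ev (g h : G) (z : R[i]^o) : lreg g (ev h z) = ev (g * h)%g z.
Proof.
apply: L2_ext => k; rewrite lregE !evE.
by rewrite -(inj_eq (@mulgI _ g)) mulVKg.
Qed.

Lemma tens_lreg H (S : op H) (g : G) : bounded_op S ->
  tens S (lreg g) = amp S \o reidx (fun h => (g^-1 * h)%g).
Proof.
move=> bS; have inj := @mulg_inv_inj g.
apply: tens_def => //; first exact: bounded_lreg.
  exact: (blin_comp (blin_amp _ bS) (blin_reidx _ inj)).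
move=> v j; apply: L2_ext => i; rewrite lreg_ev tensv_ev scale1r.
rewrite -[LHS]/(amp S (reidx _ (ev j v)) i) ampE// reidxE// !evE.
rewrite -(inj_eq (@mulgI _ g)) mulVKg.
by case: eqP => // _; exact: (linear_zero bS.1).
Qed.

Lemma tens_lregE H (S : op H) (g : G) (x : L2 G H) h : bounded_op S ->
  tens S (lreg g) x h = S (x (g^-1 * h)%g).
Proof.
move=> bS; rewrite tens_lreg//.
by rewrite -[LHS]/(amp S (reidx _ x) h) ampE// reidxE//; exact: mulg_inv_inj.
Qed.

Definition mat_unit I (p q : I) : op (ell2 R I) := fun x => ev p (x q).

Lemma bounded_mat_unit I (p q : I) : bounded_op (mat_unit p q).
Proof. exact: (blin_comp (blin_ev _ _) (blin_coord _ _)). Qed.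

Lemma tens_mat_unitE I H (S : op H) (p q : I) (x : L2 I H) i : bounded_op S ->
  tens S (mat_unit p q) x i = if i == p then S (x q) else 0.
Proof.
move=> bS; pose X : op (L2 I H) := fun x => ev p (S (x q)).
have bX : bounded_op X.
  exact: (blin_comp (blin_ev _ _) (blin_comp bS (blin_coord _ q))).
have -> : tens S (mat_unit p q) = X.
  apply: tens_def => //; first exact: bounded_mat_unit.
  move=> v j; rewrite /X /mat_unit tensv_ev !evE.
  by case: eqP => _; rewrite ?scale1r// (linear_zero bS.1) scale0r.
exact: evE.
Qed.

(** On pairs [(h, g)] this is the inverse of the index map of [U], because operators act by
    pullback: [(U x)(h, g) = x(g^-1 h, g)]. *)
Definition shearU (p : G * G) : G * G := (p.2^-1 * p.1, p.2)%g.
Definition shearUV (p : G * G) : G * G := (p.2 * p.1, p.2)%g.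

Lemma shearUK : cancel shearU shearUV.
Proof. by case=> h g; rewrite /shearU /shearUV/= mulVKg. Qed.

Lemma shearUVK : cancel shearUV shearU.
Proof. by case=> h g; rewrite /shearU /shearUV/= mulKg. Qed.

Lemma opU_perm2 : @opU R G = perm2 shearU.
Proof.
have inj := can_inj shearUK.
apply/funext => x.
have row_eq h : l2fun (perm2 shearU x h) = fun g => x (g^-1 * h)%g g.
  by apply/funext => g; exact: (perm2E _ _ _ inj).
have inner h : mkl2 (fun g => x (g^-1 * h)%g g) = perm2 shearU x h.
  apply: L2_ext => g; rewrite mkl2E; last by rewrite -(row_eq h); exact: l2funP.
  exact: (esym (perm2E _ _ _ inj)).
rewrite /opU; under eq_fun do rewrite inner.
by apply: L2_ext => h; rewrite mkl2E//; exact: (l2funP (perm2 shearU x)).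
Qed.

Lemma adj_opU : adj (@opU R G) = perm2 shearUV.
Proof. by rewrite opU_perm2; apply: adj_perm2; [exact: shearUK|exact: shearUVK]. Qed.

Lemma tens2_opU H : tens2 (id : op H) (@opU R G) = perm2 shearU.
Proof.
by rewrite opU_perm2; apply: tens2_id_perm2; [exact: shearUK|exact: shearUVK].
Qed.

Lemma tens2_adj_opU H : tens2 (id : op H) (adj (@opU R G)) = perm2 shearUV.
Proof.
by rewrite adj_opU; apply: tens2_id_perm2; [exact: shearUVK|exact: shearUK].
Qed.

Lemma shear_isometric H : isometric_inverses (@perm2 R G G G G H shearU) (perm2 shearUV).
Proof. by apply: isometric_inverses_perm2; [exact: shearUK|exact: shearUVK]. Qed.

(* [X |-> U (X \otimes 1) U^*]: on [L2 G (L2 G H)] it is the bidual coaction, on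
   [l^2(G)] it implements the comultiplication of the reduced group algebra. *)
Definition dual_coaction H (X : op (L2 G H)) : op (L2 G (L2 G H)) :=
  conj_by (perm2 shearU) (perm2 shearUV) (amp X).

Lemma bidual_coactionE H (X : op (L2 G (L2 G H))) : bounded_op X ->
  bidual_coaction X = dual_coaction X.
Proof.
by move=> bX; rewrite /bidual_coaction tens2_opU tens2_adj_opU tens_id.
Qed.

Lemma bounded_dual_coaction H (X : op (L2 G H)) : bounded_op X ->
  bounded_op (dual_coaction X).
Proof.
move=> bX; apply: (bounded_conj_by (shear_isometric _)).
exact: blin_amp.
Qed.

Lemma bl_dual_coaction H :
  bounded_linear_on (@bounded_op R (L2 G H)) (@dual_coaction H).
Proof.
apply: bl_comp (bl_amp G _) _ (bl_conj (shear_isometric _)).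
by move=> X bX; exact: blin_amp.
Qed.

Lemma ci_dual_coaction H :
  completely_isometric (@bounded_op R (L2 G H)) (@dual_coaction H).
Proof.
apply: ci_comp (@ci_amp _ G _ _) _ (ci_conj (shear_isometric _)).
  by exists 1%g.
by move=> X bX; exact: blin_amp.
Qed.

Lemma dual_coaction_comp H (X Y : op (L2 G H)) : bounded_op X -> bounded_op Y ->
  dual_coaction (X \o Y) = dual_coaction X \o dual_coaction Y.
Proof.
move=> bX bY; rewrite /dual_coaction amp_comp//.
exact: conj_by_comp (shear_isometric _) _ _.
Qed.

(** The hypothesis says that [X] shifts the index by [r]. In [U (X \otimes 1) U^*] the two shears
    then leave the outer index [(r^-1 h) h^-1 k = r^-1 k], a translation by [r] free of [h]. *)
Lemma dual_coaction_homogeneous H (X : op (L2 G H)) (B : G -> H -> H) (r : G) :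
  bounded_op X -> (forall x h, X x h = B h (x (r^-1 * h)%g)) ->
  dual_coaction X = tens X (lreg r).
Proof.
move=> bX XE; apply/funext => y; apply: L2_ext => k; apply: L2_ext => h.
rewrite (tens_lregE _ _ _ bX) XE.
rewrite -[LHS]/(perm2 shearU (amp X (perm2 shearUV y)) k h).
rewrite (perm2E _ _ _ (can_inj shearUK)) (ampE _ _ bX) XE.
rewrite (perm2E _ _ _ (can_inj shearUVK)) /shearU /shearUV/=.
by rewrite -mulgA mulVKg.
Qed.

Lemma dual_coaction_lreg (r : G) :
  dual_coaction (@lreg R G r) = tens (lreg r) (lreg r).
Proof.
apply: (@dual_coaction_homogeneous _ _ (fun=> id)); first exact: bounded_lreg.
by move=> x h; exact: lregE.
Qed.

(** [U] acts on the last two legs only, so [S] passes through the conjugation. *)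
Lemma dual_coaction_tens H (S : op H) (T : op (ell2 R G)) :
  bounded_op S -> bounded_op T ->
  dual_coaction (tens S T) = tens2 S (dual_coaction T).
Proof.
move=> bS bT; have bid := @bounded_id R H.
have bTi := bounded_tens bT (@bounded_id R (ell2 R G)).
have b1 := blin_perm2 (R[i]^o) (can_inj shearUK).
have b2 := blin_perm2 (R[i]^o) (can_inj shearUVK).
have e : dual_coaction T = perm2 shearU \o tens T id \o perm2 shearUV.
  by rewrite tens_id.
rewrite e -[S in RHS]/(id \o S \o id).
rewrite -(tens2_comp (bounded_comp bid bS) bid (bounded_comp b1 bTi) b2).
rewrite -(tens2_comp bid bS b1 bTi).
rewrite -opU_perm2 -adj_opU tens2_opU tens2_adj_opU.
rewrite (tens2_tens bS bT (@bounded_id R _)) tens_id//.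
exact: bounded_tens.
Qed.

End GroupOperators.

Section ReducedAlgebra.
Variables (R : realType) (G : groupType).
Implicit Types (H K : hilbertType R).

Let lambdas : set (op (ell2 R G)) := [set lreg g | g in [set: G]].

Let lambdas_bounded : lambdas `<=` @bounded_op R _.
Proof. by move=> _ [g _ <-]; exact: bounded_lreg. Qed.

Lemma reduced_alg_bounded : @reduced_alg R G `<=` @bounded_op R _.
Proof. exact: clspan_bounded. Qed.

Lemma reduced_alg_lreg g : reduced_alg (@lreg R G g).
Proof. by apply: sub_clspan; exists g. Qed.

Lemma reduced_alg_algebra : operator_algebra (@reduced_alg R G).
Proof.
apply: clspan_algebra => // _ _ [g _ <-] [h _ <-].
by rewrite -(lreg_mulg _ g h); exact: reduced_alg_lreg.
Qed.

(** The extension demanded by [lin_ext] exists because conjugation by [U] is bounded and has the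
    right values on the [lambda_g]. *)
Lemma comult_spec :
  bounded_linear_on (@reduced_alg R G) (comult (@lreg R G)) /\
  forall g, comult (@lreg R G) (lreg g) = tens (lreg g) (lreg g).
Proof.
rewrite /comult; set P := (X in lin_ext X).
have dom : [set p.1 | p in P] = lambdas.
  apply/seteqP; split=> [_ [_ [g ->] <-]|_ [g _ <-]]; first by exists g.
  by exists (lreg g, tens (lreg g) (lreg g)) => //; exists g.
have [|_ [g ->]|] := @lin_ext_spec _ _ _ P (@dual_coaction R G R[i]^o).
- by rewrite dom; exact (bl_sub reduced_alg_bounded (bl_dual_coaction G R[i]^o)).
- exact: dual_coaction_lreg.
- rewrite dom => bl e; split=> // g.
  by apply: (e (lreg g, tens (lreg g) (lreg g))); exists g.
Qed.

Lemma comultE c : reduced_alg c -> comult (@lreg R G) c = dual_coaction c.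
Proof.
have [bl e] := comult_spec.
apply: (bl_eq lambdas_bounded bl).
  exact (bl_sub reduced_alg_bounded (bl_dual_coaction G R[i]^o)).
by move=> _ [g _ <-]; rewrite e dual_coaction_lreg.
Qed.

End ReducedAlgebra.

(** * Reduced coactions from homogeneous generators *)

Section Homogeneous.
Variables (R : realType) (G : groupType) (W : hilbertType R).
Variables (S : set (op W)) (eps : op W -> op (L2 G W)).

Let B : set (op W) := clspan S.
Let C : set (op (ell2 R G)) := @reduced_alg R G.
Let BC := mintens (@tens R G W) B C.
Let gens : set (op (L2 G W)) :=
  [set T | exists a c, [/\ B a, C c & T = tens a c]].

Hypothesis bS : S `<=` @bounded_op R W.
Hypothesis algB : operator_algebra B.
Hypothesis homB : hom_on B eps.
Hypothesis ciB : completely_isometric B eps.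
Hypothesis bB : forall b, B b -> bounded_op (eps b).
Hypothesis epsS : forall b, S b -> exists r, eps b = tens b (lreg r).

Let B_bounded : B `<=` @bounded_op R W.
Proof. exact: clspan_bounded. Qed.

Let C_bounded : C `<=` @bounded_op R _ := @reduced_alg_bounded R G.

Let gens_bounded : gens `<=` @bounded_op R _.
Proof. exact: mintens_bounded B_bounded C_bounded. Qed.

Let BC_closed : closed_subspace BC.
Proof. exact: smallest_closed gens_bounded. Qed.

Let BC_bounded : BC `<=` @bounded_op R _.
Proof. exact: clspan_bounded gens_bounded. Qed.

Let BC_tens b c : B b -> C c -> BC (tens b c).
Proof. by move=> Bb Cc; apply: (@sub_clspan _ _ gens); exists b, c. Qed.

Let bl_eps : bounded_linear_on B eps.
Proof. by apply: ci_bl => //; case: homB. Qed.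

Let eps_BC b : B b -> BC (eps b).
Proof.
apply: (bl_clspan_sub bS BC_closed bl_eps) => a Sa.
have [r ->] := epsS Sa.
by apply: BC_tens; [exact: sub_clspan|exact: reduced_alg_lreg].
Qed.

(** On a generator [b] of degree [r] both sides are [b \otimes lambda_r \otimes lambda_r]. *)
Let coaction_identity b : B b ->
  tensmap (@tens R G W) (@tens R G (L2 G W)) B C eps id (eps b) =
  tensmap (@tens R G W) (@tens2 R G G W) B C id (comult (@lreg R G)) (eps b).
Proof.
have [bl1 e1] := tensmap_cc algB.1 homB.1 bB (ci_cc ciB) C_bounded.
have bl0 : bounded_linear_on BC (@dual_coaction R G W).
  exact (bl_sub BC_bounded (bl_dual_coaction G W)).
have [|bl2 e2] := @tensmap_spec _ _ _ _ _ _ _ (@tens R G W) (@tens2 R G G W)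
    B C id (comult (@lreg R G)) _ bl0.
  move=> a c Ba Cc; rewrite (comultE Cc); apply: dual_coaction_tens.
    exact: B_bounded.
  exact: C_bounded.
apply: (bl_eq bS (bl_comp bl_eps eps_BC bl1) (bl_comp bl_eps eps_BC bl2)) => a Sa.
have Ba : B a by exact: sub_clspan.
have ba := bS Sa; have [r er] := epsS Sa.
have Cr := @reduced_alg_lreg R G r.
transitivity (tensmap (@tens R G W) (@tens R G (L2 G W)) B C eps id (tens a (lreg r))).
  by rewrite -er.
rewrite (e1 a _ Ba Cr) er.
transitivity (tensmap (@tens R G W) (@tens2 R G G W) B C id (comult (@lreg R G))
    (tens a (lreg r))); last by rewrite -er.
rewrite (e2 a _ Ba Cr) (comult_spec R G).2.
by rewrite (tens2_tens ba (bounded_lreg R r) (bounded_lreg R r)).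
Qed.

Let Q : set (op (L2 G W)) :=
  [set T | exists a c, [/\ B a, C c & T = eps a \o tens (id : op W) c]].

Let mulr_BC X c : BC X -> C c -> BC (X \o tens (id : op W) c).
Proof.
move=> BX Cc; move: X BX; have bc := C_bounded Cc.
have bt := bounded_tens (@bounded_id R W) bc.
apply: (bl_clspan_sub gens_bounded BC_closed).
  exact (bl_sub BC_bounded (bl_mulr bt)).
move=> _ [a [c' [Ba Cc' ->]]].
rewrite (tens_comp (B_bounded Ba) (@bounded_id R W) (C_bounded Cc') bc).
apply: BC_tens => //; exact: (@reduced_alg_algebra R G).2.
Qed.

(** For [b] of degree [r], the tensor [b \otimes c] is the product of [eps b] and
    [1 \otimes (lambda_(r^-1) c)], hence already an element of [Q]. The converse inclusion holds
    because [BC] absorbs [1 \otimes c] on the right. *)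
Let nondegenerate : clspan Q = BC.
Proof.
have Qb : Q `<=` @bounded_op R _.
  move=> _ [a [c [Ba Cc ->]]]; apply: bounded_comp; first exact: bB.
  exact: bounded_tens (@bounded_id R W) (C_bounded Cc).
apply/seteqP; split.
  apply: clspan_sub => // _ [a [c [Ba Cc ->]]].
  by apply: mulr_BC => //; exact: eps_BC.
apply: clspan_sub; first exact: smallest_closed.
move=> _ [b [c [Bb Cc ->]]]; move: b Bb; have bc := C_bounded Cc.
apply: (@bl_clspan_sub _ _ _ S (clspan Q) (fun b => tens b c)) => //.
  exact: smallest_closed.
  exact (bl_sub B_bounded (bl_tensl W bc)).
move=> b Sb; apply: sub_clspan; have [r er] := epsS Sb.
exists b, (lreg r^-1%g \o c); split; first exact: sub_clspan.
  by apply: (@reduced_alg_algebra R G).2 => //; exact: reduced_alg_lreg.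
have br := @bounded_lreg R G r; have brV := @bounded_lreg R G r^-1%g.
rewrite er (tens_comp (bS Sb) (@bounded_id R W) br (bounded_comp brV bc)).
congr tens; apply/funext => x.
by rewrite -[RHS]/((lreg r \o lreg r^-1%g) (c x)) (lreg_mulV R r).
Qed.

Lemma homogeneous_reduced_coaction : reduced_coaction B eps.
Proof.
by split=> //; split.
Qed.

End Homogeneous.

(** * Compact operators on l^2 *)

Section BolzanoWeierstrass.
Variable R : realType.

(** The cluster point is the limit superior [sup E]: some number just below it is a lower bound for
    infinitely many terms, while a number above it is eventually an upper bound. *)
Lemma bounded_cluster (r : nat -> R) (b : R) : (forall n, `|r n| <= b) ->
  exists l, forall e (N : nat), 0 < e -> exists n, (N <= n)%N /\ `|r n - l| < e.
Proof.
move=> rb; pose E := [set x : R | forall N : nat, exists n, (N <= n)%N /\ x <= r n].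
have Eb : E (- b).
  by move=> N; exists N; split=> //; have := rb N; rewrite ler_norml => /andP[].
have Eub : ubound E b.
  move=> x /(_ 0%N)[n [_ xr]]; apply: (le_trans xr).
  by have := rb n; rewrite ler_norml => /andP[].
have hE : has_sup E by split; [exists (- b)|exists b].
exists (sup E) => e N e0.
have [x Ex xe] := sup_adherent e0 hE.
have nE : ~ E (sup E + e).
  by move=> h; have := sup_upper_bound hE h; lra.
have [M hM] : exists M, forall n, (M <= n)%N -> r n < sup E + e.
  apply: contrapT => h; apply: nE => M; apply: contrapT => h'; apply: h.
  exists M => n Mn; rewrite ltNge; apply/negP => le; apply: h'; by exists n.
have [n [Nn xn]] := Ex (maxn N M).
exists n; split; first exact: leq_trans (leq_maxl _ _) Nn.
rewrite ltr_norml; have := hM n (leq_trans (leq_maxr _ _) Nn).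
by move=> h; apply/andP; split; lra.
Qed.

Lemma bolzano_weierstrass (r : nat -> R) (b : R) : (forall n, `|r n| <= b) ->
  exists s : nat -> nat, (forall m n : nat, (m < n)%N -> (s m < s n)%N) /\
    exists l, forall e : R, 0 < e -> exists N : nat, forall n, (N <= n)%N ->
      `|r (s n) - l| < e.
Proof.
move=> /bounded_cluster[l hl].
have k0 (k : nat) : 0 < (k.+1%:R)^-1 :> R by rewrite invr_gt0.
have /choice[f hf] : forall p : nat * nat, exists n : nat,
    (p.2 <= n)%N /\ `|r n - l| < (p.1.+1%:R)^-1.
  by move=> p; exact: hl.
(* The second argument of [f] forces the next index past the previous one; the first sets the
   precision to [1 / (k + 1)]. *)
pose s := fix s k := if k is k'.+1 then f (k, (s k').+1) else f (0%N, 0%N).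
exists s; split.
  apply: (@homo_ltn nat s (fun a b => (a < b)%N)) => [? ? ?|i]; first exact: ltn_trans.
  exact: (hf (i.+1, (s i).+1)).1.
exists l => e /invS_lt_near[N hN]; exists N => n /hN; apply: lt_le_trans.
by case: n => [|n]; exact: (hf _).2.
Qed.

Lemma complex_bolzano_weierstrass (z : nat -> R[i]^o) (b : R) :
  (forall n, hnorm (z n) <= b) ->
  exists s : nat -> nat, (forall m n : nat, (m < n)%N -> (s m < s n)%N) /\
    exists l, hcvg (fun n => z (s n)) l.
Proof.
move=> zb.
have le_sq (x y : R) : x ^+ 2 <= y ^+ 2 -> 0 <= y -> `|x| <= y.
  move=> h y0; rewrite -(@ler_pXn2r _ 2%N) ?nnegrE//.
  by rewrite real_normK ?num_real.
have b0 : 0 <= b := le_trans (hnorm_ge0 _) (zb 0%N).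
have zb2 n : hsq (z n) <= b ^+ 2 by rewrite -hnorm_le.
have [|s [si [l1 h1]]] := @bolzano_weierstrass (fun n => complex.Re (z n)) b.
  move=> n; apply: le_sq => //; apply: le_trans (zb2 n).
  by rewrite hsq_cplx lerDl sqr_ge0.
have [|t [ti [l2 h2]]] := @bolzano_weierstrass (fun n => complex.Im (z (s n))) b.
  move=> n; apply: le_sq => //; apply: le_trans (zb2 (s n)).
  by rewrite hsq_cplx lerDr sqr_ge0.
have tn n : (n <= t n)%N.
  by elim: n => // n ih; exact: leq_ltn_trans ih (ti _ _ (ltnSn n)).
exists (s \o t); split; first by move=> m n mn /=; exact/si/ti.
exists (l1 +i* l2)%C => e e0.
have e20 : 0 < e / 2 by rewrite divr_gt0.
have [N1 hN1] := h1 _ e20; have [N2 hN2] := h2 _ e20.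
exists (maxn N1 N2) => n; rewrite geq_max => /andP[n1 /hN2 a2].
have {hN1} a1 := hN1 (t n) (leq_trans n1 (tn n)).
rewrite hnorm_lt// hsq_cplx /=.
have -> : complex.Re (z (s (t n)) - (l1 +i* l2)%C) = complex.Re (z (s (t n))) - l1.
  by case: (z _).
have -> : complex.Im (z (s (t n)) - (l1 +i* l2)%C) = complex.Im (z (s (t n))) - l2.
  by case: (z _).
set p := _ - l1 in a1 *; set q := _ - l2 in a2 *.
have sq (x : R) : `|x| < e / 2 -> x ^+ 2 < (e / 2) ^+ 2.
  move=> h; rewrite -[x ^+ 2]real_normK ?num_real//.
  by rewrite ltr_pXn2r// ?nnegrE// ltW.
apply: (lt_le_trans (ltrD (sq _ a1) (sq _ a2))).
by have := sqr_ge0 e; lra.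
Qed.

End BolzanoWeierstrass.

Section Compact.
Variables (R : realType) (I : choiceType).
Let X := ell2 R I.

(** The operator sees only the coordinate at [q], a bounded sequence of complex numbers. *)
Lemma compact_mat_unit (p q : I) : compact_op (@mat_unit R I p q).
Proof.
split; first exact: bounded_mat_unit.
move=> x x1; have [|s [si [l hl]]] := @complex_bolzano_weierstrass R (fun n => x n q) 1.
  by move=> n; apply: le_trans (hnorm_coord _ _) (x1 n).
exists s; split=> //; exists (ev p l) => e e0.
have [N hN] := hl e e0; exists N => n /hN.
by rewrite /mat_unit -(linear_sub (blin_ev _ p).1) hnorm_ev.
Qed.

Lemma hdot_evl (K : hilbertType R) (y : L2 I K) j v : hdot (ev j v) y = hdot v (y j).
Proof. by rewrite hdotC hdot_ev -hdotC. Qed.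

Lemma L2_riesz (phi : X -> R[i]^o) : blin phi -> exists y : X, forall x,
  phi x = hdot x y.
Proof.
move=> bphi; have [M M0 hM] := blin_pos bphi.
pose c (j : I) : R[i]^o := (phi (ev j (1 : R[i]^o)) : R[i])^*%C.
have phi_ev j z : phi (ev j z) = (z : R[i]) * (c j : R[i])^*%C.
  by rewrite ev_ell2 (linear_scale bphi.1) /c conjcK.
have cl2 : c \in l2pred (H := R[i]^o).
  apply: (@l2_intro _ _ _ _ (M ^+ 2)) => F uF.
  (* Testing [phi] on its own conjugated coefficients gives [phi x = S] with [|x|^2 = S], so the
     bound reads [S <= M sqrt S] and yields [S <= M^2]. *)
  set x := \sum_(j <- F) ev j (c j); set S := \sum_(j <- F) _.
  have hx : hsq x = S by exact: hsq_sum_ev.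
  have px : phi x = (S%:C)%C :> R[i].
    rewrite /x (linear_bigsum bphi.1) /S rmorph_sum/=; apply: eq_bigr => j _.
    by rewrite phi_ev hsq_cplx; case: (c j) => s t /=; congr Complex; ring.
  have S0 : 0 <= S by rewrite -hx hsq_ge0.
  have := hM x; rewrite px hnorm_real ger0_norm// hnormE hx.
  have [->|Sn] := eqVneq S 0; first by rewrite sqr_ge0.
  have Sp : 0 < Num.sqrt S by rewrite sqrtr_gt0 lt_def Sn.
  rewrite -[X in X <= _ -> _](sqr_sqrtr S0) expr2 ler_pM2r// => h.
  by rewrite -(sqr_sqrtr S0) ler_pXn2r ?nnegrE ?(ltW Sp).
exists (mkl2 c); apply: blin_ext => //.
  split; first by move=> a x y; rewrite hdotPl.
  by exists (hnorm (mkl2 c)) => x; rewrite mulrC; exact: hdot_CS.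
by move=> j z; rewrite hdot_evl mkl2E// phi_ev.
Qed.

Lemma hnorm_truncB (K : hilbertType R) (F : seq I) (x : L2 I K) : uniq F ->
  hnorm (x - trunc F x) <= hnorm x.
Proof.
move=> uF; rewrite hnorm_le ?hnorm_ge0// hnorm_sq hsq_trunc// gerBl.
by rewrite sumr_ge0// => i _; exact: hsq_ge0.
Qed.

Lemma hnorm_truncS (K : hilbertType R) (F F' : seq I) (x : L2 I K) : uniq F ->
  uniq F' -> {subset F <= F'} ->
  hnorm (x - trunc F' x) <= hnorm (x - trunc F x).
Proof.
move=> uF uF' FF'; rewrite hnorm_le ?hnorm_ge0// hnorm_sq !hsq_trunc// lerD2l.
by rewrite lerN2; apply: sum_le_subset => // i; exact: hsq_ge0.
Qed.

Lemma blin_trunc (K : hilbertType R) (F : seq I) : blin (@trunc R I K F).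
Proof. by apply: blin_sum => i; exact: (blin_comp (blin_ev _ _) (blin_coord _ _)). Qed.

(** The set [F] is one outside of which the vector representing [phi] has norm below [e]. *)
Lemma functional_tail (phi : X -> R[i]^o) (e : R) : blin phi -> 0 < e ->
  exists2 F : seq I, uniq F & forall x : X, (forall j, j \in F -> x j = 0) ->
    hnorm (phi x) <= e * hnorm x.
Proof.
move=> bphi e0; have [y hy] := L2_riesz bphi; have [F uF hF] := trunc_near y e0.
exists F => // x x0; rewrite hy.
have -> : hdot x y = hdot x (y - trunc F y).
  rewrite hdotDr hdotNr [X in - X](_ : _ = 0) ?subr0//.
  by rewrite hdot_sumr big_seq big1// => j jF; rewrite hdot_ev x0// hdot0l.
by apply: le_trans (hdot_CS _ _) _; rewrite mulrC ler_wpM2r ?hnorm_ge0// ltW.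
Qed.

(* Otherwise one finds unit vectors [x n] and finite sets [F n], increasing, such
   that [T (x n)] is far from its truncation to [F n] but close to its truncation
   to [F n.+1]; then no subsequence of [T (x n)] converges. *)
Lemma compact_tail (T : op X) (e : R) : compact_op T -> 0 < e ->
  exists2 F : seq I, uniq F & forall x : X, hnorm x <= 1 ->
    hnorm (T x - trunc F (T x)) <= e.
Proof.
have q1 : e / 4 = e / 8 + e / 8 by lra.
have q2 : e = e / 4 + (e / 4 + e / 2) by lra.
move=> [bT cT] e0; apply: contrapT => /forall2NP no.
have e40 : 0 < e / 4 by rewrite divr_gt0.
have e80 : 0 < e / 8 by rewrite divr_gt0.
have /choice[f hf] : forall F : seq I, exists xG : X * seq I, uniq F ->
    [/\ hnorm xG.1 <= 1, e < hnorm (T xG.1 - trunc F (T xG.1)), uniq xG.2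
      & hnorm (T xG.1 - trunc xG.2 (T xG.1)) < e / 4].
  move=> F; have [|uF] := pselect (uniq F); last by exists (0, [::]).
  move=> uF; have [//|/existsNP[x /not_implyP[x1 /negP]]] := no F.
  rewrite -ltNge => xe; have [F' uF' hF'] := trunc_near (T x) e40.
  by exists (x, F').
pose F := fix F n := if n is n'.+1 then undup (F n' ++ (f (F n')).2) else [::].
have uF n : uniq (F n) by case: n => //= n; exact: undup_uniq.
have FS n : {subset F n <= F n.+1}.
  by move=> i iF; rewrite /= mem_undup mem_cat iF.
have Fm m n : (m <= n)%N -> {subset F m <= F n}.
  elim: n => [|n ih]; first by rewrite leqn0 => /eqP ->.
  rewrite leq_eqVlt => /orP[/eqP -> //|]; rewrite ltnS => /ih h i /h; exact: FS.
pose x n := (f (F n)).1.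
have [|s [si [l hl]]] := cT x; first by move=> n; case: (hf _ (uF n)).
have [N hN] := hl _ e80.
set a := s N; set b := s N.+1.
have ab : (a < b)%N by exact: si.
have [_ _ uG hG] := hf _ (uF a); have [_ xe _ _] := hf _ (uF b).
rewrite -/(x a) in hG; rewrite -/(x b) in xe.
have h1 : hnorm (T (x a) - trunc (F b) (T (x a))) < e / 4.
  apply: le_lt_trans hG; apply: hnorm_truncS => // i iG.
  by apply: (Fm _ _ ab); rewrite /= mem_undup mem_cat iG orbT.
have h2 : hnorm (T (x b) - T (x a)) < e / 4.
  have l1 := hN N (leqnn N); have l2 := hN N.+1 (leqnSn N).
  have l3 := hnorm_split (T (x b)) l (T (x a)); rewrite (hnorm_distC l) in l3.
  apply: le_lt_trans l3 _; rewrite q1.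
  exact: ltrD l2 l1.
have h3 := hnorm_truncB (T (x b) - T (x a)) (uF b).
have h4 : T (x b) - trunc (F b) (T (x b)) = T (x a) - trunc (F b) (T (x a)) +
    (T (x b) - T (x a) - trunc (F b) (T (x b) - T (x a))).
  rewrite (linear_sub (blin_trunc _ _).1).
  set u := T (x a); set v := T (x b); set u' := trunc _ u; set v' := trunc _ v.
  have -> : v - u - (v' - u') = v - v' - (u - u').
    by rewrite !opprB [u' - v']addrC addrACA [- u + _]addrC.
  by rewrite [RHS]addrC subrK.
have h5 := hnorm_add (T (x a) - trunc (F b) (T (x a)))
  (T (x b) - T (x a) - trunc (F b) (T (x b) - T (x a))).
rewrite -h4 in h5; move: (lt_le_trans xe h5).
rewrite ltNge => /negP; apply; apply: ltW.
rewrite [ltRHS]q2.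
apply: ltrD h1 _; apply: le_lt_trans h3 _; apply: lt_trans h2 _.
by rewrite ltrDl divr_gt0.
Qed.

Let units : set (op X) := [set T | exists p q, T = @mat_unit R I p q].

Lemma mat_units_bounded : units `<=` @bounded_op R X.
Proof. by move=> _ [p [q ->]]; exact: bounded_mat_unit. Qed.

Lemma op_sumE (K : hilbertType R) (J : Type) (r : seq J) (T : J -> op K) x :
  (\sum_(j <- r) T j) x = \sum_(j <- r) T j x.
Proof. by elim: r => [|j r ih]; rewrite ?big_nil ?big_cons// -ih. Qed.

Lemma trunc_mat_units (T : op X) (F F' : seq I) : bounded_op T ->
  clspan units (@trunc R I _ F \o T \o @trunc R I _ F').
Proof.
move=> bT.
have -> : @trunc R I _ F \o T \o @trunc R I _ F' =
    \sum_(i <- F) \sum_(j <- F') (T (ev j (1 : R[i]^o)) i : R[i]) *: mat_unit i j.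
  apply/funext => x; rewrite op_sumE.
  rewrite -[LHS]/(\sum_(i <- F) ev i (T (trunc F' x) i)); apply: eq_bigr => i _.
  rewrite op_sumE /trunc (linear_bigsum bT.1) L2_sumE (linear_bigsum (blin_ev _ i).1).
  apply: eq_bigr => j _; rewrite (ev_ell2 j (x j)) (linear_scale bT.1) L2_scaleE.
  rewrite -[RHS]/((T (ev j (1 : R[i]^o)) i : R[i]) *: ev i (x j)) -ev_scale.
  by congr ev; exact: mulrC.
have cV := smallest_closed mat_units_bounded.
apply: (closed_sum cV) => i; apply: (closed_sum cV) => j; apply: (closed_scale cV).
by apply: sub_clspan; exists i, j.
Qed.

Lemma opnorm_le_unit (K : hilbertType R) (T : op K) (M : R) :
  (forall x, hnorm x <= 1 -> hnorm (T x) <= M) -> opnorm T <= M.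
Proof.
move=> h; apply: ge_sup; first by exists (hnorm (T 0)), 0 => //=; rewrite hnorm0.
by move=> _ [x /= x1 <-]; exact: h.
Qed.

Lemma hnorm_bigsum (K : hilbertType R) (J : eqType) (r : seq J) (f : J -> K) (c : R) :
  (forall j, j \in r -> hnorm (f j) <= c) ->
  hnorm (\sum_(j <- r) f j) <= (size r)%:R * c.
Proof.
elim: r => [|j r ih] h; first by rewrite big_nil hnorm0 mul0r.
rewrite big_cons -natr1 mulrDl mul1r addrC; apply: le_trans (hnorm_add _ _) _.
apply: lerD; first by apply: ih => k kr; apply: h; rewrite inE kr orbT.
by apply: h; rewrite inE eqxx.
Qed.

(** With [P] and [P'] the truncations to [F] and [F'], [T - P T P'] splits as
    [(T - P T) + P T (1 - P')]. Compactness controls the first term ([compact_tail]); in the second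
    only finitely many functionals occur, and each has a small tail. *)
Lemma compact_sub_mat_units : @compact_op R X `<=` clspan units.
Proof.
move=> T cT; have bT : bounded_op T := cT.1.
have cV := smallest_closed mat_units_bounded.
apply: (closed_lim cV) => // e e0.
have e40 : 0 < e / 4 by rewrite divr_gt0.
have [F uF hF] := compact_tail cT e40.
(* Each of the [size F] coordinates is allowed an error [e / 4 / k]; the successor avoids division
   by zero. *)
set k : R := (size F).+1%:R; have k0 : 0 < k by rewrite ltr0n.
have bphi i : blin (fun x : X => T x i) := blin_comp (blin_coord _ i) bT.
have /choice[G hG] : forall i, exists Fi : seq I, forall x : X,
    (forall j, j \in Fi -> x j = 0) -> hnorm (T x i) <= e / 4 / k * hnorm x.
  by move=> i; have [Fi _ h] := functional_tail (bphi i) (divr_gt0 e40 k0); exists Fi.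
pose F' := undup (flatten [seq G i | i <- F]).
have uF' : uniq F' by exact: undup_uniq.
exists (@trunc R I _ F \o T \o @trunc R I _ F'); first exact: trunc_mat_units.
have btF := blin_trunc R[i]^o F; have btF' := blin_trunc R[i]^o F'.
pose D1 : op X := T - (@trunc R I _ F \o T).
pose D2 : op X := @trunc R I _ F \o T \o (id - @trunc R I _ F').
have b1 : bounded_op D1 by apply: bounded_sub => //; exact: bounded_comp.
have b2 : bounded_op D2.
  by apply: bounded_comp; [exact: bounded_comp|apply: bounded_sub => //; exact: bounded_id].
have -> : T - (@trunc R I _ F \o T \o @trunc R I _ F') = D1 + D2.
  apply/funext => x.
  rewrite -[RHS]/(T x - trunc F (T x) + trunc F (T (x - trunc F' x))).
  by rewrite (linear_sub bT.1) (linear_sub btF.1) addrA subrK.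
apply: le_lt_trans (opnormD b1 b2) _.
have n1 : opnorm D1 <= e / 4 by apply: opnorm_le_unit => x; exact: hF.
have n2 : opnorm D2 <= e / 4.
  apply: opnorm_le_unit => x x1.
  set y := x - trunc F' x.
  have y1 : hnorm y <= 1 by apply: le_trans (hnorm_truncB _ uF') x1.
  have yF' j : j \in F' -> y j = 0.
    by move=> jF; rewrite /y L2_subE /trunc sum_evE// jF subrr.
  rewrite -[D2 x]/(\sum_(i <- F) ev i (T y i)).
  apply: (@le_trans _ _ ((size F)%:R * (e / 4 / k))).
    apply: hnorm_bigsum => i iF; rewrite hnorm_ev.
    apply: (@le_trans _ _ (e / 4 / k * hnorm y)).
      apply: hG => j jG; apply: yF'; rewrite mem_undup; apply/flattenP.
      by exists (G i) => //; apply/mapP; exists i.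
    by rewrite ler_piMr// ltW// divr_gt0.
  rewrite mulrCA ler_piMr ?(ltW e40)// ler_pdivrMr// mul1r.
  by rewrite ler_nat.
apply: le_lt_trans (lerD n1 n2) _.
by rewrite -mulrDl ltr_pdivrMr//; lra.
Qed.

End Compact.

(** * Spectral decomposition of a normal coaction *)

Section BoundedLinear.
Variable R : realType.
Implicit Types H K E : hilbertType R.

Lemma bl_zero H K (D : set (op H)) (phi : op H -> op K) :
  closed_subspace D -> bounded_linear_on D phi -> phi 0 = 0.
Proof.
move=> cD [lf _]; have := lf (-1) 0 0 (closed_zero cD) (closed_zero cD).
by rewrite !scaleN1r !addNr.
Qed.

Lemma bl0 H K (D : set (op H)) : bounded_linear_on D (0 : op H -> op K).
Proof.
split.
  move=> c S T _ _; rewrite -[LHS]/(0 : op K) -[RHS]/(c *: (0 : op K) + (0 : op K)).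
  by rewrite scaler0 addr0.
exists 0 => T _; rewrite mul0r -[X in bounded_op X]/(0 : op K).
rewrite -[X in opnorm X]/(0 : op K) opnorm0; split=> //; exact: bounded0.
Qed.

Lemma blf_post H K E (D : set (op H)) (f : op H -> K) (T : K -> E) :
  blf D f -> blin T -> blf D (fun X => T (f X)).
Proof.
move=> [lf [M hM]] bT; split; first by move=> c S X DS DX; rewrite lf// bT.1.
have [N N0 hN] := blin_pos bT.
exists (N * M) => X DX; apply: (le_trans (hN _)).
by rewrite -mulrA ler_wpM2l// hM.
Qed.

Lemma blin_hdot H (w : H) : blin (fun z : H => hdot z w : R[i]^o).
Proof.
split; first by move=> a x y; rewrite hdotPl.
by exists (hnorm w) => z; rewrite mulrC; exact: hdot_CS.
Qed.

Lemma cc_bl H K (A : set (op H)) (phi : op H -> op K) :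
  A `<=` @bounded_op R H -> linear_on A phi ->
  (forall a, A a -> bounded_op (phi a)) -> completely_contractive A phi ->
  bounded_linear_on A phi.
Proof.
move=> bA lphi bphi c; split=> //; exists 1 => T AT; split; first exact: bphi.
by rewrite mul1r (cc_opnorm c AT (bA _ AT) (bphi _ AT)).
Qed.

(* The slice map [omega_(v,w) \otimes id]. *)
Definition slice (Y : choiceType) H (v w : H) (Z : op (L2 Y H)) : op (ell2 R Y) :=
  fun x => amp (fun z : H => hdot z w : R[i]^o) (Z (tensv v x)).

Lemma bl_slice (Y : choiceType) H (v w : H) :
  bounded_linear_on (@bounded_op R (L2 Y H)) (slice v w).
Proof.
have bh := blin_hdot w; have bA := @blin_amp R Y _ _ _ bh.
have bv := @blin_tensvr R Y H v.
split; first by move=> c S T bS bT; apply/funext => x; exact: bA.1.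
exists (hnorm w * hnorm v) => Z bZ; split.
  exact: (blin_comp bA (blin_comp bZ bv)).
apply: opnorm_le; first by rewrite !mulr_ge0 ?hnorm_ge0 ?opnorm_ge0.
move=> x; apply: (@le_trans _ _ (hnorm w * hnorm (Z (tensv v x)))).
  apply: amp_bound => //; first exact: hnorm_ge0.
  by move=> z; rewrite mulrC; exact: hdot_CS.
rewrite -!mulrA ler_wpM2l ?hnorm_ge0//; apply: (le_trans (le_opnorm _ bZ)).
rewrite mulrCA ler_wpM2l ?opnorm_ge0//; exact: hnorm_tensv.
Qed.

Lemma slice_tens (Y : choiceType) H (v w : H) (S : op H) (T : op (ell2 R Y)) :
  bounded_op S -> bounded_op T -> slice v w (tens S T) = (hdot (S v) w : R[i]) *: T.
Proof.
move=> bS bT; apply/funext => x; apply: L2_ext => i.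
rewrite -[LHS]/(amp (fun z : H => hdot z w : R[i]^o) (tens S T (tensv v x)) i).
rewrite (ampE _ _ (blin_hdot w)) (tens_tensv bS bT) tensvE hdotZl.
exact: mulrC.
Qed.

End BoundedLinear.

Section SpectralSubspaces.
Variables (R : realType) (G : groupType) (Y : choiceType).
Variables (u : G -> op (ell2 R Y)) (H : hilbertType R) (A : set (op H)).
Variable delta : op H -> op (L2 Y H).
Hypothesis hu : unitary_rep u.
Hypothesis hA : operator_algebra A.
Hypothesis hdelta : coaction u A delta.
Hypothesis hnormal : normal_coaction u A delta.

Let C := group_alg u.
Let gens : set (op (L2 Y H)) := [set T | exists a c, [/\ A a, C c & T = tens a c]].
Let AC : set (op (L2 Y H)) := mintens (@tens R Y H) A C.
Let q := lquot u.
Let L := tensmap (@tens R Y H) (@tens R G H) A C id q.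
Let dl := delta_lambda u A delta.

Let cA : closed_subspace A := hA.1.

Let bA : A `<=` @bounded_op R H.
Proof. by move=> a /(closed_bounded cA). Qed.

Let bu g : bounded_op (u g).
Proof.
have [lu iu _] := hu.1 g; split=> //; exists 1 => x.
by rewrite mul1r !hnormE /hsq iu.
Qed.

Let us : set (op (ell2 R Y)) := [set u g | g in [set: G]].

Let bus : us `<=` @bounded_op R _.
Proof. by move=> _ [g _ <-]. Qed.

Let cC : closed_subspace C := smallest_closed bus.

Let bC : C `<=` @bounded_op R _ := clspan_bounded bus.

Let Cu g : C (u g).
Proof. by apply: sub_clspan; exists g. Qed.

Let bgens : gens `<=` @bounded_op R _ := mintens_bounded bA bC.

Let cAC : closed_subspace AC := smallest_closed bgens.

Let bAC : AC `<=` @bounded_op R _ := clspan_bounded bgens.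

Let AC_tens a c : A a -> C c -> AC (tens a c).
Proof. by move=> Aa Cc; apply: (@sub_clspan _ _ gens); exists a, c. Qed.

Let deltaAC a : A a -> AC (delta a).
Proof. by case: hdelta => _ [_ _ + _ _]; exact. Qed.

Let homdelta : hom_on A delta.
Proof. by case: hdelta => _ []. Qed.

Let bdelta a : A a -> bounded_op (delta a).
Proof. by move/deltaAC/bAC. Qed.

Let bl_delta : bounded_linear_on A delta.
Proof. by apply: cc_bl => //; [exact: homdelta.1|exact: hdelta.1]. Qed.

Let bl_L : bounded_linear_on AC L.
Proof.
have [[]//|e] := tensmap_dflt (@tens R Y H) (@tens R G H) A C id q.
by rewrite /L e; exact: bl0.
Qed.

Let spec_q : (bounded_linear_on C q /\ forall g, q (u g) = lreg g) \/ q = 0.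
Proof.
rewrite /q /lquot; set P := (X in lin_ext X).
have dom : [set p.1 | p in P] = us.
  apply/seteqP; split=> [_ [_ [g ->] <-]|_ [g _ <-]]; first by exists g.
  by exists (u g, lreg g) => //; exists g.
have [[bl e]|] := lin_ext_dflt P; [left|by right].
rewrite dom in bl; split=> // g.
by apply: (e (u g, lreg g)); exists g.
Qed.

(* [lin_ext], hence [L] or [q], is 0 when the extension does not exist; this would
   make [delta_lambda] vanish, and [A = 0] by normality. *)
Let L_spec : (forall X, AC X -> L X = 0) \/
  [/\ bounded_linear_on C q, forall g, q (u g) = lreg g
    & forall a c, A a -> C c -> L (tens a c) = tens a (q c)].
Proof.
have [[_ e]|e] := tensmap_dflt (@tens R Y H) (@tens R G H) A C id q; last first.
  by left=> X _; rewrite /L e.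
have [[bl qu]|q0] := spec_q; [by right|left].
apply: (bl_eq bgens bl_L (@bl0 _ _ _ _)) => _ [a [c [Aa Cc ->]]].
rewrite /L e// q0; exact: (bl_zero (closed_subspace_bounded _) (bl_tensr G (bA Aa))).
Qed.

Let bl_dl : bounded_linear_on A dl.
Proof. exact: (bl_comp bl_delta deltaAC bl_L). Qed.

Let bdl a : A a -> bounded_op (dl a).
Proof. by case: bl_dl => _ [M h] /h[]. Qed.

Let dl_inj0 a : A a -> dl a = 0 -> a = 0.
Proof.
move=> Aa da; apply: opnorm_eq0; first exact: bA.
by rewrite -(ci_opnorm hnormal Aa (bA Aa) (bdl Aa)) -/dl da opnorm0.
Qed.

Section Nontrivial.
Hypothesis blq : bounded_linear_on C q.
Hypothesis qu : forall g, q (u g) = lreg g.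
Hypothesis Ltens : forall a c, A a -> C c -> L (tens a c) = tens a (q c).

Let bq c : C c -> bounded_op (q c).
Proof. by case: blq => _ [M h] /h[]. Qed.

Let Su : set (op (L2 Y H)) := [set T | exists a g, A a /\ T = tens a (u g)].

Let bSu : Su `<=` @bounded_op R _.
Proof. by move=> _ [a [g [Aa ->]]]; exact: bounded_tens (bA Aa) (bu g). Qed.

(** On [a \otimes u_g] the values of [L] and [id \otimes Delta] are explicit, which is not so for a
    general [c] in place of [u_g]. *)
Let ACE : AC = clspan Su.
Proof.
have cSu := smallest_closed bSu.
apply/seteqP; split; apply: clspan_sub => //.
  move=> _ [a [c [Aa Cc ->]]]; move: c Cc.
  apply: (bl_clspan_sub bus cSu (bl_sub bC (bl_tensr Y (bA Aa)))).
  by move=> _ [g _ <-]; apply: sub_clspan; exists a, g.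
by move=> _ [a [g [Aa ->]]]; exact: AC_tens.
Qed.

(** The slice of [X] by the functional [c |-> <q(c) e_h, e_g>] in the last leg; [coef g h] is this
    functional on [C]. *)
Let ent g h (X : op (L2 Y H)) : op H := entry (L X) g h.

Let bl_ent g h : bounded_linear_on AC (ent g h).
Proof.
apply: bl_comp bl_L _ (bl_entry _ g h).
by move=> X ACX; case: bl_L => _ [M /(_ _ ACX)[]].
Qed.

Let ent_tens g h a c : A a -> C c ->
  ent g h (tens a c) = (q c (ev h (1 : R[i]^o)) g : R[i]) *: a.
Proof.
by move=> Aa Cc; rewrite /ent Ltens// (entry_tens _ _ (bA Aa) (bq Cc)).
Qed.

Let A_ent g h X : AC X -> A (ent g h X).
Proof.
apply: (bl_clspan_sub bgens cA (bl_ent g h)) => _ [a [c [Aa Cc ->]]].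
by rewrite ent_tens//; exact: (closed_scale cA).
Qed.

Let DI := tensmap (@tens R Y H) (@tens R Y (L2 Y H)) A C delta id.

Let DI_spec : bounded_linear_on AC DI /\
  forall a c, A a -> C c -> DI (tens a c) = tens (delta a) c.
Proof. by apply: tensmap_cc => //; [exact: homdelta.1|exact: hdelta.1]. Qed.

Let TH := tensmap (@tens R Y H) (@tens2 R Y Y H) A C id (comult u).

(** No bounded extension of [u_g |-> u_g \otimes u_g] is exhibited here, so the default 0 stays as
    an alternative; [delta_ent] disposes of it. *)
Let TH_spec : (forall X, AC X -> TH X = 0) \/
  bounded_linear_on AC TH /\
  forall a g, A a -> TH (tens a (u g)) = tens (tens a (u g)) (u g).
Proof.
have [[bl e]|e] := tensmap_dflt (@tens R Y H) (@tens2 R Y Y H) A C id (comult u); last first.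
  by left=> X _; rewrite /TH e.
have : (forall g, comult u (u g) = tens (u g) (u g)) \/ comult u = 0.
  rewrite /comult; set P := (X in lin_ext X).
  have [[_ e']|] := lin_ext_dflt P; [left|by right].
  by move=> g; apply: (e' (u g, tens (u g) (u g))); exists g.
move=> [cu|c0]; [right|left].
  split=> // a g Aa; rewrite /TH e// cu.
  exact: (tens2_tens (bA Aa) (bu g) (bu g)).
apply: (bl_eq bgens bl (@bl0 _ _ _ _)) => _ [a [c [Aa Cc ->]]].
rewrite e// c0.
exact: (bl_zero (closed_subspace_bounded _) (bl_tens2r Y Y (bA Aa))).
Qed.

Let coact a : A a -> DI (delta a) = TH (delta a).
Proof. by case: hdelta => _ [_ _ _ + _]; exact. Qed.

Let coef g h (c : op (ell2 R Y)) : R[i]^o := q c (ev h (1 : R[i]^o)) g.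

Let coef_blf g h (Phi : op (L2 Y H) -> op (ell2 R Y)) :
  bounded_linear_on AC Phi -> (forall X, AC X -> C (Phi X)) ->
  blf AC (fun X => coef g h (Phi X)).
Proof.
move=> bl CPhi; have bl' := bl_comp bl CPhi blq.
exact: (blf_post (bl_at bl' (ev h (1 : R[i]^o))) (blin_coord _ g)).
Qed.

Let coef_lin g h z c : C c -> coef g h ((z : R[i]) *: c) = z * coef g h c.
Proof.
move=> Cc; have := blq.1 z c 0 Cc (closed_zero cC).
by rewrite (bl_zero cC blq) !addr0 /coef => ->.
Qed.

Let slice_DI v w X : AC X -> C (slice v w (DI X)).
Proof.
have [bl e] := DI_spec.
have bl' : bounded_linear_on AC (slice v w \o DI).
  apply: (bl_comp bl _ (bl_slice Y v w)).
  by move=> Z ACZ; case: bl => _ [M /(_ _ ACZ)[]].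
apply: (bl_clspan_sub bgens cC bl') => _ [a [c [Aa Cc ->]]].
rewrite -[X in C X]/(slice v w (DI (tens a c))) e//.
rewrite (slice_tens _ _ (bdelta Aa) (bC Cc)); exact: (closed_scale cC).
Qed.

(** The functional acts on the last leg of [(delta \otimes id)(X)] and so commutes with [delta] on
    the first leg. Slicing the other legs by vectors leaves an operator on the last leg to evaluate
    it on, and the vectors separate operators at the end. *)
Let slice_coef g h v w X : AC X ->
  coef g h (slice v w (DI X)) = hdot (delta (ent g h X) v) w.
Proof.
have [bl e] := DI_spec.
have bl' : bounded_linear_on AC (slice v w \o DI).
  apply: (bl_comp bl _ (bl_slice Y v w)).
  by move=> Z ACZ; case: bl => _ [M /(_ _ ACZ)[]].
have bl2 := bl_comp (bl_ent g h) (A_ent g h) bl_delta.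
apply: (blf_eq bgens (coef_blf g h bl' (slice_DI v w))
  (blf_post (bl_at bl2 v) (blin_hdot w))) => _ [a [c [Aa Cc ->]]].
rewrite -[LHS]/(coef g h (slice v w (DI (tens a c)))) e//.
rewrite (slice_tens _ _ (bdelta Aa) (bC Cc)) coef_lin//.
rewrite -[RHS]/(hdot (delta (ent g h (tens a c)) v) w) ent_tens//.
rewrite -[_ *: a]addr0 (homdelta.1 _ _ _ Aa (closed_zero cA)).
rewrite (bl_zero cA bl_delta) addr0.
rewrite -[RHS]/(hdot ((q c (ev h (1 : R[i]^o)) g : R[i]) *: delta a v) w) hdotZl.
exact: mulrC.
Qed.

Let lreg_coef (g h k : G) : lreg k (ev h (1 : R[i]^o)) g =
  if g == (k * h)%g then 1 else 0 :> R[i]^o.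
Proof. by rewrite lreg_ev evE. Qed.

(** On [a \otimes u_k] both sides vanish unless [k = g h^-1], the only case where [lambda_k] has a
    nonzero coefficient at [(g, h)]; that is why [u_k] can be replaced by the fixed [u_(g h^-1)]. *)
Let slice_coef_TH g h v w X :
  bounded_linear_on AC TH ->
  (forall a g, A a -> TH (tens a (u g)) = tens (tens a (u g)) (u g)) -> AC X ->
  coef g h (slice v w (TH X)) = hdot (tens (ent g h X) (u (g * h^-1)%g) v) w.
Proof.
move=> bl e.
have bt a k : A a -> bounded_op (tens a (u k)).
  by move=> Aa; exact: bounded_tens (bA Aa) (bu k).
have bl' : bounded_linear_on AC (slice v w \o TH).
  apply: (bl_comp bl _ (bl_slice Y v w)).
  by move=> Z ACZ; case: bl => _ [M /(_ _ ACZ)[]].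
have sE a k : A a -> (slice v w \o TH) (tens a (u k)) =
    (hdot (tens a (u k) v) w : R[i]) *: u k.
  move=> Aa; rewrite -[LHS]/(slice v w (TH (tens a (u k)))) e//.
  exact: (slice_tens _ _ (bt _ _ Aa) (bu k)).
have slC Z : AC Z -> C ((slice v w \o TH) Z).
  move: Z; rewrite ACE; rewrite ACE in bl'.
  apply: (bl_clspan_sub bSu cC bl') => _ [a [k [Aa ->]]].
  by rewrite sE//; apply: (closed_scale cC).
have bl2 := bl_comp (bl_ent g h) (fun Z ACZ => bA (A_ent g h ACZ))
  (bl_tensl H (bu (g * h^-1)%g)).
have b1 := coef_blf g h bl' slC.
have b2 := blf_post (bl_at bl2 v) (blin_hdot w).
move: X; rewrite ACE; rewrite ACE in b1 b2.
apply: (blf_eq bSu b1 b2) => _ [a [k [Aa ->]]].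
rewrite sE// coef_lin// /coef qu lreg_coef.
rewrite -[RHS]/(hdot (tens (ent g h (tens a (u k))) (u (g * h^-1)%g) v) w).
rewrite ent_tens// qu lreg_coef.
have [->|ne] := eqVneq g (k * h)%g.
  by rewrite mulr1 scale1r mulgK.
rewrite scale0r (bl_zero (closed_subspace_bounded _) (bl_tensl H (bu _))).
by rewrite -[RHS]/(hdot (0 : L2 Y H) w) hdot0l mulr0.
Qed.

Let delta_ent g h a : A a ->
  delta (ent g h (delta a)) = tens (ent g h (delta a)) (u (g * h^-1)%g).
Proof.
move=> Aa; have ACa := deltaAC Aa; have Ae := A_ent g h ACa.
(* If [TH] is zero, the coaction identity makes [delta] vanish on the entry; normality then makes
   the entry itself zero, and the formula holds trivially. *)
have [TH0|[bl e]] := TH_spec.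
  have d0 : delta (ent g h (delta a)) = 0.
    apply/funext => v; apply: hdot_ext => w.
    rewrite -(slice_coef g h v w ACa) coact// TH0//.
    rewrite (bl_zero (closed_subspace_bounded _) (bl_slice Y v w)).
    by rewrite /coef (bl_zero cC blq) hdot0l.
  have e0 : ent g h (delta a) = 0.
    apply: dl_inj0 => //; rewrite -[LHS]/(L (delta (ent g h (delta a)))) d0.
    exact: bl_zero cAC bl_L.
  rewrite d0 e0; apply: esym.
  exact: (bl_zero (closed_subspace_bounded _) (bl_tensl H (bu _))).
apply/funext => v; apply: hdot_ext => w.
by rewrite -(slice_coef g h v w ACa) coact// slice_coef_TH.
Qed.

Let hom0 : set (op H) := [set a | A a /\ exists g, delta a = tens a (u g)].

Let bhom0 : hom0 `<=` @bounded_op R H.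
Proof. by move=> a [Aa _]; exact: bA. Qed.

Let chom0 : closed_subspace (clspan hom0) := smallest_closed bhom0.

(** [L] is so far only linear; compatibility with right multiplication by [1 \otimes u_k] is all the
    multiplicativity that [span_hom0] needs. *)
Let mulr_u X k : AC X -> AC (X \o tens (id : op H) (u k)) /\
  L (X \o tens (id : op H) (u k)) = L X \o tens (id : op H) (lreg k).
Proof.
have bt := bounded_tens (@bounded_id R H) (bu k).
have bt' := bounded_tens (@bounded_id R H) (@bounded_lreg R G k).
have tE a g : A a -> tens a (u g) \o tens (id : op H) (u k) = tens a (u (g * k)%g).
  move=> Aa; rewrite (tens_comp (bA Aa) (@bounded_id R H) (bu g) (bu k)).
  by rewrite hu.2.
have bm : bounded_linear_on AC (fun X => X \o tens (id : op H) (u k)).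
  exact: bl_sub bAC (bl_mulr bt).
have ACm Z : AC Z -> AC (Z \o tens (id : op H) (u k)).
  move=> ACZ; have bm' := bm; rewrite ACE in ACZ bm'; move: Z ACZ.
  apply: (bl_clspan_sub bSu cAC bm') => _ [a [g [Aa ->]]].
  by rewrite tE//; exact: AC_tens.
move=> ACX; split; first exact: ACm.
have b1 := bl_comp bm ACm bl_L.
have bLX Z : AC Z -> bounded_op (L Z) by move=> ACZ; case: bl_L => _ [M /(_ _ ACZ)[]].
have b2 := bl_comp bl_L bLX (bl_mulr bt').
move: X ACX; rewrite ACE; rewrite ACE in b1 b2.
apply: (bl_eq bSu b1 b2) => _ [a [g [Aa ->]]].
rewrite -[LHS]/(L (tens a (u g) \o tens (id : op H) (u k))) tE//.
rewrite -[RHS]/(L (tens a (u g)) \o tens (id : op H) (lreg k)).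
rewrite !Ltens// !qu.
rewrite (tens_comp (bA Aa) (@bounded_id R H) (@bounded_lreg R G g) (@bounded_lreg R G k)).
by rewrite lreg_mulg.
Qed.

Let ent_hom0 g h a : A a -> hom0 (ent g h (delta a)).
Proof.
move=> Aa; split; first exact: (A_ent g h (deltaAC Aa)).
by exists (g * h^-1)%g; exact: (delta_ent g h Aa).
Qed.

(** [a] is the [(1, 1)] entry of [a \otimes u_1]. By nondegeneracy this tensor lies in the closed
    span of the products [delta(a') (1 \otimes u_k)]; since [lambda_k] moves [e_1] to [e_k], the
    [(1, 1)] entry of such a product is the homogeneous [(1, k)] entry of [delta(a')]. *)
Let span_hom0 : A = clspan hom0.
Proof.
apply/seteqP; split; last by apply: clspan_sub => // a [].
have [_ _ _ _ nondeg] := hdelta.2; set Q := (X in clspan X) in nondeg.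
have bQ : Q `<=` @bounded_op R _.
  move=> _ [a [c [Aa Cc ->]]]; apply: bounded_comp; first exact: bdelta.
  exact: bounded_tens (@bounded_id R H) (bC Cc).
have QAC X : Q X -> AC X by move=> QX; rewrite /AC -nondeg; exact: sub_clspan.
have good X : AC X -> clspan hom0 (ent 1%g 1%g X).
  have bl := bl_ent 1%g 1%g; rewrite /AC -nondeg in bl *.
  move: X; apply: (bl_clspan_sub bQ chom0 bl) => _ [a [c [Aa Cc ->]]]; move: c Cc.
  have b1 : bounded_linear_on C (fun c => tens (id : op H) c).
    exact: bl_sub bC (bl_tensr Y (@bounded_id R H)).
  have b2 := bl_comp b1 (fun c Cc => bounded_tens (@bounded_id R H) (bC Cc))
    (bl_mull (bdelta Aa)).
  have b3 : bounded_linear_on C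
      (ent 1%g 1%g \o ((fun T => delta a \o T) \o (fun c => tens (id : op H) c))).
    apply: bl_comp b2 _ (bl_ent 1%g 1%g).
    by move=> c Cc; apply: QAC; exists a, c.
  apply: (bl_clspan_sub bus chom0 b3) => _ [k _ <-].
  rewrite -[X in clspan hom0 X]/(ent 1%g 1%g (delta a \o tens (id : op H) (u k))).
  rewrite /ent (mulr_u k (deltaAC Aa)).2.
  have -> : entry (L (delta a) \o tens (id : op H) (lreg k)) 1%g 1%g =
      ent 1%g k (delta a).
    apply/funext => v; rewrite /ent /entry.
    rewrite -[LHS]/(L (delta a) (tens (id : op H) (lreg k) (ev 1%g v)) 1%g).
    rewrite (tens_ev (@bounded_id R H) (@bounded_lreg R G k)) lreg_ev mulg1.
    by rewrite tensv_ev scale1r.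
  by apply: sub_clspan; exact: ent_hom0.
move=> a Aa; have := good _ (AC_tens Aa (Cu 1%g)).
by rewrite ent_tens// qu lreg_coef mulg1 eqxx scale1r.
Qed.

Let dl_hom0 a g : A a -> delta a = tens a (u g) -> dl a = tens a (lreg g).
Proof. by move=> Aa da; rewrite -[LHS]/(L (delta a)) da Ltens// qu. Qed.

(** For homogeneous factors the degrees multiply, because [delta] and [lambda] are multiplicative.
    The general case follows by extending one variable at a time over [span_hom0]. *)
Let dl_mul S T : A S -> A T -> dl (S \o T) = dl S \o dl T.
Proof.
have bl1 X : A X -> bounded_linear_on A (fun Z => dl (X \o Z)).
  move=> AX; apply: (bl_comp (phi := fun Z => X \o Z)) bl_dl.
    exact: bl_sub bA (bl_mull (bA AX)).
  by move=> Z; exact: hA.2.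
have bl2 X : A X -> bounded_linear_on A (fun Z => dl (Z \o X)).
  move=> AX; apply: (bl_comp (phi := fun Z => Z \o X)) bl_dl.
    exact: bl_sub bA (bl_mulr (bA AX)).
  by move=> Z AZ; exact: hA.2.
have bl3 X : A X -> bounded_linear_on A (fun Z => dl X \o dl Z).
  by move=> AX; exact: (bl_comp bl_dl bdl (bl_mull (bdl AX))).
have bl4 X : A X -> bounded_linear_on A (fun Z => dl Z \o dl X).
  by move=> AX; exact: (bl_comp bl_dl bdl (bl_mulr (bdl AX))).
move=> AS AT; move: S AS; have b2 := bl2 T AT; have b4 := bl4 T AT.
rewrite span_hom0; rewrite span_hom0 in b2 b4.
apply: (bl_eq bhom0 b2 b4) => S [AS [g dS]].
move: T AT {b2 b4}; have b1 := bl1 S AS; have b3 := bl3 S AS.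
rewrite span_hom0; rewrite span_hom0 in b1 b3.
apply: (bl_eq bhom0 b1 b3) => T [AT [h dT]].
rewrite (dl_hom0 AS dS) (dl_hom0 AT dT).
rewrite (tens_comp (bA AS) (bA AT) (@bounded_lreg R G g) (@bounded_lreg R G h)).
rewrite -lreg_mulg; apply: dl_hom0; first exact: hA.2.
rewrite homdelta.2// dS dT (tens_comp (bA AS) (bA AT) (bu g) (bu h)).
by rewrite hu.2.
Qed.

Lemma nontrivial_spectral : hom_on A dl /\
  A `<=` clspan [set a | A a /\ exists g, dl a = tens a (lreg g)].
Proof.
split; first by split; [exact: bl_dl.1|exact: dl_mul].
rewrite {1}span_hom0; apply: clspan_sub.
  by apply: smallest_closed => a [/bA].
move=> a [Aa [g da]]; apply: sub_clspan; split=> //.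
by exists g; exact: dl_hom0.
Qed.

End Nontrivial.

Lemma spectral_decomposition : [/\ hom_on A (delta_lambda u A delta),
  forall a, A a -> bounded_op (delta_lambda u A delta a)
  & A = clspan [set a | A a /\
      exists g, delta_lambda u A delta a = tens a (lreg g)]].
Proof.
suff [h1 h2] : hom_on A dl /\
    A `<=` clspan [set a | A a /\ exists g, dl a = tens a (lreg g)].
  by split=> //; apply/seteqP; split=> //; apply: clspan_sub => // a [].
have [L0|[blq qu Lt]] := L_spec; last exact: nontrivial_spectral.
have dl0 a : A a -> dl a = 0 by move=> Aa; exact: (L0 _ (deltaAC Aa)).
split; first split; first exact: bl_dl.1.
  by move=> S T AS AT; rewrite !dl0//; exact: hA.2.
move=> a Aa; rewrite (dl_inj0 Aa (dl0 _ Aa)).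
by apply: closed_zero; apply: smallest_closed => b [/bA].
Qed.

End SpectralSubspaces.

(** * Images of isometries, diagonal operators and the flip *)

Section IsometricImage.
Variable R : realType.
Implicit Types H K : hilbertType R.

Lemma bounded_op_complete H (A : set (op H)) (a : nat -> op H) :
  closed_subspace A -> (forall n, A (a n)) ->
  (forall e : R, 0 < e -> exists N : nat, forall m n : nat,
    (N <= m)%N -> (N <= n)%N -> opnorm (a m - a n) <= e) ->
  exists2 T, A T & forall e : R, 0 < e -> exists N : nat, forall n : nat,
    (N <= n)%N -> opnorm (T - a n) <= e.
Proof.
move=> cA Aa ca; have ba n : bounded_op (a n) := closed_bounded cA (Aa n).
have bsub m n : bounded_op (a m - a n) by apply: bounded_sub.
have cx x : hcauchy (fun n => a n x).
  move=> e e0; have n1 : 0 < hnorm x + 1 by rewrite ltr_wpDl ?hnorm_ge0.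
  have [N hN] := ca _ (divr_gt0 e0 n1); exists N => m n Nm Nn.
  have d0 : 0 < e / (hnorm x + 1) by rewrite divr_gt0.
  apply: (@le_lt_trans _ _ (e / (hnorm x + 1) * hnorm x)).
    apply: (le_trans (le_opnorm x (bsub m n))).
    by rewrite ler_wpM2r ?hnorm_ge0// hN.
  rewrite -[ltRHS](divfK (lt0r_neq0 n1)) ltr_pM2l//.
  by rewrite ltrDl.
have /choice[T hT] : forall x, exists y, hcvg (fun n => a n x) y.
  by move=> x; exact: hcomplete (cx x).
(* The Cauchy estimate between [a m] and [a n] passes to the limit in [m] at each fixed [x], with a
   constant independent of [x]: the pointwise limit is a norm limit. *)
have close e : 0 < e -> exists N : nat, forall n : nat, (N <= n)%N ->
    forall x, hnorm (T x - a n x) <= e * hnorm x.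
  move=> e0; have [N hN] := ca _ e0; exists N => n Nn x.
  apply/ler_addgt0Pr => d d0; have [M hM] := hT x d d0.
  have := hM (maxn N M) (leq_maxr _ _); set m := maxn N M.
  rewrite hnorm_distC => h1.
  have h2 : hnorm (a m x - a n x) <= e * hnorm x.
    apply: (le_trans (le_opnorm x (bsub m n))).
    by rewrite ler_wpM2r ?hnorm_ge0// hN// leq_maxl.
  apply: (le_trans (hnorm_split _ (a m x) _)); rewrite addrC.
  by apply: lerD => //; exact: ltW.
have lT : linear T.
  move=> c x y; apply: (@hcvg_unique _ _ (fun n => a n (c *: x + y))); first exact: hT.
  move=> e e0; set k := hnorm (c : R[i]^o) + 1.
  have k0 : 0 < k by rewrite ltr_wpDl// hnorm_ge0.
  have d0 := divr_gt0 e0 k0.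
  have [N hN] := hT x _ d0; have [M hM] := hT y _ d0.
  exists (maxn N M) => n; rewrite geq_max => /andP[/hN h1 /hM h2].
  rewrite (ba n).1 opprD addrACA -scalerBr.
  apply: (le_lt_trans (hnorm_add _ _)); rewrite hnormZ.
  have -> : e = hnorm (c : R[i]^o) * (e / k) + e / k.
    by rewrite -{2}[e / k]mul1r -mulrDl mulrC divfK// gt_eqF.
  by apply: ler_ltD => //; rewrite ler_wpM2l ?hnorm_ge0// ltW.
have bT : bounded_op T.
  split=> //; have [N hN] := close 1 ltr01; have [M M0 hM] := blin_pos (ba N).
  exists (1 + M) => x; rewrite mulrDl.
  rewrite -[T x](subrK (a N x)); apply: (le_trans (hnorm_add _ _)).
  by apply: lerD => //; exact: hN.
have cl e : 0 < e -> exists N : nat, forall n : nat,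
    (N <= n)%N -> opnorm (T - a n) <= e.
  move=> e0; have [N hN] := close e e0; exists N => n Nn.
  by apply: opnorm_le; [exact: ltW|exact: hN].
exists T => //; apply: (closed_lim cA bT) => e e0.
have e20 : 0 < e / 2 by rewrite divr_gt0.
have [N hN] := cl _ e20; exists (a N) => //.
by apply: (le_lt_trans (hN N (leqnn N))); rewrite ltr_pdivrMr// ltr_pMr// ltr1n.
Qed.

(** Preimages of a convergent sequence of images are Cauchy, and [A] is complete. This makes
    [delta_lambda(A)] a domain on which [tensmap_cc] applies to the inverse map. *)
Lemma isometric_image_closed H K (A : set (op H)) (phi : op H -> op K) :
  closed_subspace A -> bounded_linear_on A phi ->
  (forall a, A a -> opnorm (phi a) = opnorm a) -> closed_subspace (phi @` A).
Proof.
move=> cA bl iso.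
have bp a : A a -> bounded_op (phi a) by case: bl => _ [M h] /h[].
have psub a b : A a -> A b -> phi (a - b) = phi a - phi b.
  move=> Aa Ab; rewrite addrC -scaleN1r bl.1//.
  by rewrite scaleN1r addrC.
split.
- by move=> _ [a Aa <-]; exact: bp.
- by exists 0; [exact: closed_zero|exact: bl_zero cA bl].
- move=> c _ _ [a Aa <-] [b Ab <-]; exists (c *: a + b); first exact: closed_lin.
  by rewrite bl.1.
move=> T bT h.
have n0 (n : nat) : 0 < (n.+1%:R)^-1 :> R by rewrite invr_gt0.
have /choice[a ha] : forall n : nat, exists a, A a /\ opnorm (T - phi a) < (n.+1%:R)^-1.
  by move=> n; have [_ [a Aa <-] lt] := h _ (n0 n); exists a.
have small (e : R) : 0 < e -> exists N : nat, forall n, (N <= n)%N ->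
    opnorm (T - phi (a n)) < e.
  move=> /invS_lt_near[N hN]; exists N => n /hN.
  exact: lt_le_trans (ha n).2.
have bTa n : bounded_op (T - phi (a n)).
  by apply: bounded_sub => //; apply: bp; exact: (ha n).1.
have tri b n : A b -> opnorm (phi b - phi (a n)) <=
    opnorm (T - phi b) + opnorm (T - phi (a n)).
  move=> Ab; have bTb : bounded_op (T - phi b).
    by apply: bounded_sub => //; exact: bp.
  have -> : phi b - phi (a n) = - (T - phi b) + (T - phi (a n)).
    by rewrite opprB addrA subrK.
  rewrite -(opnormN (T - phi b)); apply: opnormD => //.
  by rewrite -scaleN1r; exact: bounded_scale.
have [|b Ab hb] := @bounded_op_complete H A a cA (fun n => (ha n).1).
  move=> e e0; have e20 : 0 < e / 2 by rewrite divr_gt0.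
  have [N hN] := small _ e20; exists N => m n Nm Nn.
  have [Am _] := ha m; have [An _] := ha n.
  rewrite -iso; last exact: closed_sub.
  rewrite psub//; apply: (le_trans (tri _ _ Am)).
  by rewrite [leRHS]splitr; apply: lerD; apply: ltW; exact: hN.
exists b => //; apply/eqP; rewrite -subr_eq0; apply/eqP.
have bbT : bounded_op (phi b - T) by apply: bounded_sub => //; exact: bp.
apply: opnorm_eq0 => //; apply/eqP; rewrite eq_le opnorm_ge0// andbT.
apply/ler_addgt0Pr => e e0; rewrite add0r.
have e20 : 0 < e / 2 by rewrite divr_gt0.
have [N hN] := small _ e20; have [M hM] := hb _ e20.
set n := maxn N M; have [An _] := ha n.
have -> : phi b - T = (phi b - phi (a n)) + - (T - phi (a n)).
  by rewrite opprB addrA subrK.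
have bN : bounded_op (- (T - phi (a n))) by rewrite -scaleN1r; exact: bounded_scale.
have bba : bounded_op (phi b - phi (a n)) by apply: bounded_sub; exact: bp.
apply: (le_trans (opnormD bba bN)); rewrite opnormN -psub// iso; last exact: closed_sub.
rewrite [leRHS]splitr; apply: lerD; first by apply: hM; exact: leq_maxr.
by apply: ltW; apply: hN; exact: leq_maxl.
Qed.

End IsometricImage.

Section Diagonal.
Variable R : realType.
Implicit Types (I J K : choiceType) (H : hilbertType R).

Definition bounded_family K (f : K -> R[i]) (M : R) : Prop :=
  forall k, hnorm (f k : R[i]^o) <= M.

Lemma diag_bound K H (f : K -> R[i]) (M : R) (x : L2 K H) (F : seq K) :
  bounded_family f M -> uniq F ->
  \sum_(k <- F) hsq (f k *: x k) <= M ^+ 2 * hsq x.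
Proof.
move=> fM uF; apply: (@le_trans _ _ (\sum_(k <- F) M ^+ 2 * hsq (x k))).
  apply: ler_sum => k _; rewrite hsqZE ler_wpM2r ?hsq_ge0// -hnorm_le//.
  exact: le_trans (hnorm_ge0 _) (fM k).
by rewrite -mulr_sumr ler_wpM2l ?sqr_ge0 ?bessel.
Qed.

Fact diag_exists K H : {d : (K -> R[i]) -> L2 K H -> L2 K H |
  forall f M x k, bounded_family f M -> d f x k = f k *: x k}.
Proof.
exists (fun f x => mkl2 (fun k => f k *: x k)) => f M x k fM.
by rewrite mkl2E//; apply: l2_intro (fun F => diag_bound x fM).
Qed.

Definition diag K H := sval (diag_exists K H).

Lemma diagE K H (f : K -> R[i]) (M : R) (x : L2 K H) k : bounded_family f M ->
  diag f x k = f k *: x k.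
Proof. exact: (svalP (diag_exists K H)). Qed.

Lemma diag_linear K H (f : K -> R[i]) (M : R) : bounded_family f M ->
  linear (@diag K H f).
Proof.
move=> fM; apply: (@coord_linear _ K H _ _ (fun k (x : L2 K H) => f k *: x k)).
  by move=> x k; exact: diagE fM.
by move=> k a x y; rewrite L2_addE L2_scaleE scalerDr !scalerA [f k * a]mulrC.
Qed.

Lemma hnorm_diag K H (f : K -> R[i]) (M : R) (x : L2 K H) : 0 <= M ->
  bounded_family f M -> hnorm (diag f x) <= M * hnorm x.
Proof.
move=> M0 fM; rewrite hnorm_le ?mulr_ge0 ?hnorm_ge0// exprMn hnorm_sq.
apply: l2_hsq_le => F uF; under eq_bigr do rewrite (diagE _ _ fM).
exact: diag_bound.
Qed.

Definition diag2 I J H (f : J * I -> R[i]) : op (L2 J (L2 I H)) :=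
  fun x => unflat (diag f (flat x)).

Section Diag2.
Variables (I J : choiceType) (f : J * I -> R[i]) (M : R).
Hypotheses (M0 : 0 <= M) (fM : bounded_family f M).

Lemma diag2E H (x : L2 J (L2 I H)) j i : diag2 f x j i = f (j, i) *: x j i.
Proof. by rewrite /diag2 unflatE (diagE _ _ fM) flatE. Qed.

Lemma bounded_diag2 H : bounded_op (@diag2 I J H f).
Proof.
have bd : blin (@diag _ H f).
  by split; [exact: diag_linear fM|exists M => x; exact: hnorm_diag].
exact: (blin_comp (blin_unflat _ _ _) (blin_comp bd (blin_flat _ _ _))).
Qed.

Lemma opnorm_diag2 H : opnorm (@diag2 I J H f) <= M.
Proof.
apply: opnorm_le => // x; rewrite /diag2 hnorm_unflat -(hnorm_flat x).
exact: hnorm_diag.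
Qed.

Lemma tens2_id_diag2 H : tens2 (id : op H) (@diag2 I J R[i]^o f) = diag2 f.
Proof.
apply: tens2_def; [exact: bounded_id|exact: bounded_diag2|exact: bounded_diag2|].
move=> v j i; apply: L2_ext => j'; apply: L2_ext => i'.
rewrite tensv2E !diag2E !ev2E.
case: ifP => _; last by rewrite !scaler0 scale0r.
by congr (_ *: _); rewrite -[RHS]/(f (j', i') * 1) mulr1.
Qed.

End Diag2.

End Diagonal.

Section FunctionMultiplication.
Variables (R : realType) (G : groupType) (H : hilbertType R).
Implicit Types f : G -> R[i].

(** Pairs carry the outer index first, so [p = (h, g)] receives [f(g h^-1)]. *)
Let nu f (p : G * G) : R[i] := f (p.2 * p.1^-1)%g.

Lemma mulop2_diag2 (F : G -> G -> R[i]) (M : R) :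
  bounded_family (fun p : G * G => F p.2 p.1) M ->
  mulop2 F = diag2 (fun p => F p.2 p.1).
Proof.
move=> FM; apply/funext => x; set D := diag2 _ x.
have row_eq h : l2fun (D h) = fun g => F g h * (x h g : R[i]).
  by apply/funext => g; exact: (diag2E FM).
have inner h : mkl2 (fun g => F g h * (x h g : R[i]) : R[i]^o) = D h.
  apply: L2_ext => g; rewrite mkl2E; last by rewrite -(row_eq h); exact: l2funP.
  by rewrite row_eq.
rewrite /mulop2; under eq_fun do rewrite inner.
by apply: L2_ext => h; rewrite mkl2E//; exact: (l2funP D).
Qed.

Lemma kc0_diag2 f (M : R) : bounded_family f M ->
  kc0 (H := H) f = diag2 (nu f).
Proof.
move=> fM; have nM : bounded_family (fun p : G * G => f (p.2 * p.1^-1)%g) M.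
  by move=> p; exact: fM.
by rewrite /kc0 (mulop2_diag2 nM) (tens2_id_diag2 (le_trans (hnorm_ge0 _) (fM 1%g)) nM).
Qed.

Lemma normc_hnorm (z : R[i]) : `|z| = ((hnorm (z : R[i]^o))%:C)%C.
Proof. by rewrite normc_def hnormE hsq_cplx. Qed.

Lemma c0_finite f (e : R) : c0 f -> 0 < e ->
  exists2 F : seq G, uniq F & forall g, g \notin F -> hnorm (f g : R[i]^o) <= e.
Proof.
move=> cf e0; have fin := cf e e0; exists (fset_set [set g | (e%:C%C <= `|f g|)]).
  exact: fset_uniq.
move=> g; rewrite in_fset_set// notin_setE /= normc_hnorm lecR => /negP.
by rewrite -ltNge => /ltW.
Qed.

Lemma c0_bounded f : c0 f -> exists2 M, 0 <= M & bounded_family f M.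
Proof.
move=> /c0_finite /(_ ltr01) [F uF hF].
(* Off [F] the values are at most 1; on [F] each value is one of the summands. *)
exists (1 + \sum_(g <- F) hnorm (f g : R[i]^o)).
  by rewrite addr_ge0// sumr_ge0// => g _; exact: hnorm_ge0.
move=> g; have [gF|gF] := boolP (g \in F); last first.
  by rewrite (le_trans (hF _ gF))// lerDl sumr_ge0// => h _; exact: hnorm_ge0.
rewrite (bigD1_seq g)//= addrA [1 + _]addrC -addrA lerDl addr_ge0// sumr_ge0//.
by move=> h _; exact: hnorm_ge0.
Qed.

Definition delta_fun (t : G) : G -> R[i] := fun g => if g == t then 1 else 0.

Lemma delta_bounded t : bounded_family (delta_fun t) 1.
Proof.
move=> g; rewrite /delta_fun; case: eqP => _; last by rewrite hnorm0 ler01.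
by rewrite -[X in hnorm X]/((1 : R)%:C%C : R[i]^o) hnorm_real normr1.
Qed.

Lemma c0_delta t : c0 (delta_fun t).
Proof.
move=> e e0; apply: sub_finite_set (finite_set1 t) => g /=.
rewrite /delta_fun; case: eqP => // _.
by rewrite normr0 lecR leNgt e0.
Qed.

Lemma kc0_deltaE t (x : L2 G (L2 G H)) h g :
  kc0 (delta_fun t) x h g = if (g * h^-1)%g == t then x h g else 0.
Proof.
have nM : bounded_family (nu (delta_fun t)) 1 by move=> p; exact: delta_bounded.
rewrite (kc0_diag2 (delta_bounded t)) (diag2E nM) /nu /delta_fun/=.
by case: ifP; rewrite ?scale1r ?scale0r.
Qed.

Let deltas : set (op (L2 G (L2 G H))) :=
  [set T | exists t, T = kc0 (H := H) (delta_fun t)].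

Lemma bounded_kc0 f : c0 f -> bounded_op (kc0 (H := H) f).
Proof.
move=> /c0_bounded[M M0 fM]; rewrite (kc0_diag2 fM).
by apply: (bounded_diag2 M0) => p; exact: fM.
Qed.

Lemma deltas_bounded : deltas `<=` @bounded_op R _.
Proof. by move=> _ [t ->]; apply: bounded_kc0; exact: c0_delta. Qed.

(** Subtracting the part of [f] on the finite set where it is large leaves the diagonal operator of
    a function bounded by [e / 2]. *)
Lemma kc0_span f : c0 f -> clspan deltas (kc0 (H := H) f).
Proof.
move=> cf; have cD := smallest_closed deltas_bounded.
apply: (closed_lim cD (bounded_kc0 cf)) => e e0.
have e20 : 0 < e / 2 by rewrite divr_gt0.
have [F uF hF] := c0_finite cf e20; have [M M0 fM] := c0_bounded cf.
exists (\sum_(t <- F) (f t : R[i]) *: kc0 (H := H) (delta_fun t)).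
  apply: (closed_sum cD) => t; apply: (closed_scale cD).
  by apply: sub_clspan; exists t.
pose f2 g := if g \in F then 0 else f g.
have f2M : bounded_family f2 (e / 2).
  move=> g; rewrite /f2; case: ifPn => gF; last exact: hF.
  by rewrite hnorm0 ltW.
have -> : kc0 (H := H) f - \sum_(t <- F) (f t : R[i]) *: kc0 (H := H) (delta_fun t) =
    diag2 (nu f2).
  have nf : bounded_family (nu f) M by move=> p; exact: fM.
  have nf2 : bounded_family (nu f2) (e / 2) by move=> p; exact: f2M.
  apply/funext => x; apply: L2_ext => h; apply: L2_ext => g.
  rewrite (diag2E nf2).
  rewrite -[LHS]/(kc0 f x h g -
    (\sum_(t <- F) (f t : R[i]) *: kc0 (H := H) (delta_fun t)) x h g).
  rewrite op_sumE !L2_sumE (kc0_diag2 fM) (diag2E nf) /nu/=.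
  rewrite (eq_bigr (fun t => f t *: (if (g * h^-1)%g == t then x h g else 0))).
    2: by move=> t _; rewrite -kc0_deltaE.
  rewrite /f2; case: ifPn => kF.
    rewrite (bigD1_seq (g * h^-1)%g)//= eqxx big1 ?addr0 ?subrr ?scale0r//.
    by move=> t; rewrite eq_sym => /negPf ->; rewrite scaler0.
  rewrite big_seq big1 ?subr0// => t tF; case: eqP => [kt|_]; last by rewrite scaler0.
  by rewrite kt tF in kF.
have nf2 : bounded_family (nu f2) (e / 2) by move=> p; exact: f2M.
apply: (le_lt_trans (opnorm_diag2 (ltW e20) nf2 H)).
by rewrite ltr_pdivrMr// ltr_pMr// ltr1n.
Qed.

End FunctionMultiplication.

Section Flip.
Variables (R : realType) (G : groupType).
Implicit Types H : hilbertType R.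

Definition flip_pair (p : G * G) : G * G := (p.2, p.1).

Lemma flip_pairK : cancel flip_pair flip_pair.
Proof. by case. Qed.

Lemma swap_isometric H :
  isometric_inverses (@perm2 R G G G G H flip_pair) (perm2 flip_pair).
Proof. exact: isometric_inverses_perm2 flip_pairK flip_pairK. Qed.

Lemma swap_tens (S T : op (ell2 R G)) : bounded_op S -> bounded_op T ->
  conj_by (perm2 flip_pair) (perm2 flip_pair) (tens S T) = tens T S.
Proof.
move=> bS bT; have inj := can_inj flip_pairK.
have bX := bounded_conj_by (swap_isometric R[i]^o) (bounded_tens bS bT).
apply/funext; apply: blin_ext2 => //; first exact: bounded_tens.
move=> j i z; apply: L2_ext => h; apply: L2_ext => g.
rewrite -[LHS]/(perm2 flip_pair (tens S T (perm2 flip_pair (ev j (ev i z)))) h g).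
rewrite (perm2E _ _ _ inj).
have -> : perm2 flip_pair (ev j (ev i z)) = ev i (ev j z) :> L2 G (ell2 R G).
  apply: L2_ext => a; apply: L2_ext => b; rewrite (perm2E _ _ _ inj) !ev2E.
  by rewrite /= !xpair_eqE andbC.
rewrite (tens_ev bS bT) (tens_ev bT bS) !tensvE !L2_scaleE /=.
rewrite (ev_ell2 j z) (ev_ell2 i z) (linear_scale bS.1) (linear_scale bT.1) !L2_scaleE.
set s : R[i]^o := S _ _; set t : R[i]^o := T _ _.
by rewrite -[LHS]/(t * (z * s)) -[RHS]/(s * (z * t)) mulrCA [RHS]mulrCA [s * t]mulrC.
Qed.

Let CK := mintens (@tens R G (ell2 R G)) (@reduced_alg R G) (@compacts R G).

Lemma compacts_bounded : @compacts R G `<=` @bounded_op R _.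
Proof. by move=> k []. Qed.

(** The flip is implemented by the unitary that swaps the two indices, so the extension exists and
    is a conjugation. *)
Lemma flipE b : CK b ->
  flip b = conj_by (perm2 flip_pair) (perm2 flip_pair) b.
Proof.
have bCK := mintens_bounded (@reduced_alg_bounded R G) compacts_bounded.
rewrite /flip; set P := (X in lin_ext X).
have dom : [set p.1 | p in P] =
    [set T | exists c k, [/\ reduced_alg c, compacts k & T = tens c k]].
  apply/seteqP; split=> [_ [_ [c [k [Cc Kk ->]]] <-]|_ [c [k [Cc Kk ->]]]].
    by exists c, k.
  by exists (tens c k, tens k c) => //; exists c, k.
have bl : bounded_linear_on (clspan [set p.1 | p in P])
    (conj_by (@perm2 R G G G G R[i]^o flip_pair) (perm2 flip_pair)).
  by rewrite dom; exact (bl_sub (clspan_bounded bCK) (bl_conj (swap_isometric _))).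
have [|bl' e] := lin_ext_spec bl.
  move=> _ [c [k [Cc Kk ->]]]; apply: swap_tens; first exact: reduced_alg_bounded.
  exact: compacts_bounded.
rewrite dom in bl bl'; apply: (bl_eq bCK bl' bl) => _ [c [k [Cc Kk ->]]].
rewrite (swap_tens (reduced_alg_bounded Cc) (compacts_bounded Kk)).
by apply: (e (tens c k, tens k c)); exists c, k.
Qed.

End Flip.

(** * Duality *)

Section Duality.
Variables (R : realType) (G : groupType) (H : hilbertType R).
Variables (A : set (op H)) (dl : op H -> op (L2 G H)).
Hypothesis hA : operator_algebra A.
Hypothesis homdl : hom_on A dl.
Hypothesis bdl : forall a, A a -> bounded_op (dl a).
Hypothesis cidl : completely_isometric A dl.
Hypothesis spanA : A = clspan [set a | A a /\ exists g, dl a = tens a (lreg g)].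

Local Notation W := (L2 G H).
Local Notation W2 := (L2 G (L2 G H)).
Local Notation W3 := (L2 G (L2 G (L2 G H))).
Local Notation K := (@compacts R G).
Local Notation C := (@reduced_alg R G).

Let homog : set (op H) := [set a | A a /\ exists g, dl a = tens a (lreg g)].
Let AGG : set (op W2) := double_crossed_product A dl.
Let AK : set (op W2) := stabilization A dl.

Let cA : closed_subspace A := hA.1.

Let bA : A `<=` @bounded_op R H.
Proof. by move=> a /(closed_bounded cA). Qed.

Let bhomog : homog `<=` @bounded_op R H.
Proof. by move=> a [/bA]. Qed.

Let bl_dl : bounded_linear_on A dl.
Proof. by apply: ci_bl => //; exact: homdl.1. Qed.

Let bK : K `<=` @bounded_op R _ := @compacts_bounded R G.
Let bC : C `<=` @bounded_op R _ := @reduced_alg_bounded R G.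
Let bl (g : G) : bounded_op (@lreg R G g) := @bounded_lreg R G g.
Let bE (p q : G) : bounded_op (@mat_unit R G p q) := @bounded_mat_unit R G p q.
Let bidW : bounded_op (id : op W) := @bounded_id R W.
Let bid : bounded_op (id : op (ell2 R G)) := @bounded_id R _.

Let KE p q : K (@mat_unit R G p q). Proof. exact: compact_mat_unit. Qed.

Let elem a (s p q : G) : op W2 := tens (tens a (lreg s)) (mat_unit p q).

Let SK : set (op W2) := [set T | exists a s p q,
  [/\ A a, dl a = tens a (lreg s) & T = elem a s p q]].

Let belem a s p q : A a -> bounded_op (elem a s p q).
Proof. by move=> Aa; exact: bounded_tens (bounded_tens (bA Aa) (bl s)) (bE p q). Qed.

Let bSK : SK `<=` @bounded_op R _.
Proof. by move=> _ [a [s [p [q [Aa _ ->]]]]]; exact: belem. Qed.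

Let cSK : closed_subspace (clspan SK) := smallest_closed bSK.

Let dlA_bounded : dl @` A `<=` @bounded_op R _.
Proof. by move=> _ [a Aa <-]; exact: bdl. Qed.

Let AKE : AK = clspan SK.
Proof.
set AK0 : set (op W2) := [set T | exists a b, [/\ (dl @` A) a, K b & T = tens a b]].
have bAK : AK0 `<=` @bounded_op R _ := mintens_bounded dlA_bounded bK.
have -> : AK = clspan AK0 by [].
apply/seteqP; split; last first.
  apply: clspan_sub; first exact: smallest_closed bAK.
  move=> _ [a [s [p [q [Aa da ->]]]]]; apply: sub_clspan.
  exists (dl a), (mat_unit p q); split; [by exists a|exact: KE|by rewrite da].
apply: clspan_sub => // _ [_ [k [[a Aa <-] Kk ->]]].
have bk := bK Kk.
have b1 : bounded_linear_on A ((fun T => tens T k) \o dl).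
  exact: (bl_comp bl_dl bdl (bl_tensl W bk)).
move: a Aa; rewrite spanA; rewrite spanA in b1.
apply: (bl_clspan_sub bhomog cSK b1) => a [Aa [s da]].
rewrite -[X in clspan SK X]/(tens (dl a) k).
have b2 := bl_sub (clspan_bounded (@mat_units_bounded R G)) (bl_tensr G (bdl Aa)).
move: k Kk bk {b1} => k /compact_sub_mat_units Kk _; move: k Kk.
apply: (bl_clspan_sub (@mat_units_bounded R G) cSK b2) => _ [p [q ->]].
by apply: sub_clspan; exists a, s, p, q; rewrite da.
Qed.

Definition shearV (p : G * G) : G * G := (p.1^-1 * p.2, p.2)%g.
Definition shearVV (p : G * G) : G * G := (p.2 * p.1^-1, p.2)%g.

Let shearVK : cancel shearV shearVV.
Proof. by case=> h g; rewrite /shearV /shearVV/= invgM invgK mulVKg. Qed.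

Let shearVVK : cancel shearVV shearV.
Proof. by case=> h g; rewrite /shearV /shearVV/= invgM invgK mulgVK. Qed.

(* [V (e_g \otimes e_h) = e_g \otimes e_(g h^-1)] *)
Let V : op W2 := perm2 shearV.
Let V' : op W2 := perm2 shearVV.

Let VV' : isometric_inverses V V'.
Proof. exact: isometric_inverses_perm2 shearVK shearVVK. Qed.

Let V'V := isometric_inverses_sym VV'.
Let bV : bounded_op V := blin_isometry VV'.
Let bV' : bounded_op V' := blin_isometry V'V.

Definition duality_map : op W2 -> op W2 :=
  conj_by (perm2 shearV) (perm2 shearVV).

(** Defined by pulling back [elem] along [V], so that the duality map sends [gen] to [elem] by
    construction; [crossed_gen] identifies these operators inside the double crossed product. *)
Let gen a (s p q : G) : op W2 := conj_by V' V (elem a s p q).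

Let bgen a s p q : A a -> bounded_op (gen a s p q).
Proof. by move=> Aa; exact (bounded_conj_by V'V (belem s p q Aa)). Qed.

Let genE a s p q (y : W2) h g : A a ->
  gen a s p q y h g = if (g * h^-1)%g == p
    then a (y (q^-1 * (s^-1 * g))%g (s^-1 * g)%g) else 0.
Proof.
move=> Aa; rewrite -[LHS]/(V' (elem a s p q (V y)) h g).
rewrite (perm2E _ _ _ (can_inj shearVVK)) /=.
rewrite (tens_mat_unitE _ _ _ _ (bounded_tens (bA Aa) (bl s))).
case: ifP => // _; rewrite (tens_lregE _ _ _ (bA Aa)).
by rewrite (perm2E _ _ _ (can_inj shearVK)).
Qed.

Let SB : set (op W2) := [set T | exists a s p q,
  [/\ A a, dl a = tens a (lreg s) & T = gen a s p q]].

Let bSB : SB `<=` @bounded_op R _.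
Proof. by move=> _ [a [s [p [q [Aa _ ->]]]]]; exact: bgen. Qed.

Let cSB : closed_subspace (clspan SB) := smallest_closed bSB.

Let elem_comp a b s t p q p' q' : A a -> A b ->
  elem a s p q \o elem b t p' q' =
  if q == p' then elem (a \o b) (s * t)%g p q' else 0.
Proof.
move=> Aa Ab; rewrite /elem.
rewrite (tens_comp (bounded_tens (bA Aa) (bl s)) (bounded_tens (bA Ab) (bl t))
  (bE p q) (bE p' q')).
rewrite (tens_comp (bA Aa) (bA Ab) (bl s) (bl t)) -lreg_mulg.
have -> : @mat_unit R G p q \o mat_unit p' q' =
    (if q == p' then mat_unit p q' else 0 : op (ell2 R G)).
  apply/funext => x; rewrite -[LHS]/(ev p (ev p' (x q') q)) evE.
  by case: eqP => // _; rewrite (linear_zero (blin_ev _ p).1).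
case: eqP => // _.
apply: (bl_zero (closed_subspace_bounded _) (bl_tensr G _)).
by apply: bounded_tens => //; exact: bA (hA.2 _ _ Aa Ab).
Qed.

Let dl_comp a b s t : A a -> A b -> dl a = tens a (lreg s) ->
  dl b = tens b (lreg t) -> dl (a \o b) = tens (a \o b) (lreg (s * t)%g).
Proof.
move=> Aa Ab da db; rewrite homdl.2// da db.
by rewrite (tens_comp (bA Aa) (bA Ab) (bl s) (bl t)) lreg_mulg.
Qed.

Let algSK : operator_algebra (clspan SK).
Proof.
apply: clspan_algebra => // _ _ [a [s [p [q [Aa da ->]]]]]
  [b [t [p' [q' [Ab db ->]]]]].
rewrite elem_comp//; case: eqP => _; last exact: closed_zero.
apply: sub_clspan; exists (a \o b), (s * t)%g, p, q'; split=> //.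
  exact: hA.2.
exact: dl_comp.
Qed.

Let PsiSK T : clspan SB T -> clspan SK (duality_map T).
Proof.
apply: (bl_clspan_sub bSB cSK (bl_sub (clspan_bounded bSB) (bl_conj VV'))).
move=> _ [a [s [p [q [Aa da ->]]]]].
rewrite (conj_byK V'V); apply: sub_clspan; by exists a, s, p, q.
Qed.

Let PsiVSB T : clspan SK T -> clspan SB (conj_by V' V T).
Proof.
apply: (bl_clspan_sub bSK cSB (bl_sub (clspan_bounded bSK) (bl_conj V'V))).
by move=> _ [a [s [p [q [Aa da ->]]]]]; apply: sub_clspan; exists a, s, p, q.
Qed.

(** Carried over from [algSK] by the multiplicative conjugation, which avoids multiplying the
    generators [gen] directly. *)
Let algSB : operator_algebra (clspan SB).
Proof.
split=> // S T BS BT; rewrite -(conj_byK VV' (S \o T)).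
apply: PsiVSB; rewrite (conj_by_comp VV').
by apply: algSK.2; exact: PsiSK.
Qed.

Let crossed_gens : set (op W2) := [set T | exists a f g,
  [/\ A a, c0 f & T = kA dl a \o kc0 (H := H) f \o kG (H := H) g]].

Let bkA a : A a -> bounded_op (kA dl a).
Proof. by move=> Aa; exact: bounded_tens (bdl Aa) bid. Qed.

Let bkG (g : G) : bounded_op (kG (R := R) (H := H) g).
Proof. exact: bounded_tens bidW (bl g). Qed.

Let bcrossed : crossed_gens `<=` @bounded_op R _.
Proof.
move=> _ [a [f [g [Aa cf ->]]]].
exact: bounded_comp (bounded_comp (bkA Aa) (bounded_kc0 H cf)) (bkG g).
Qed.

Let crossed_gen a s t r : A a -> dl a = tens a (lreg s) ->
  kA dl a \o kc0 (H := H) (delta_fun R t) \o kG (H := H) r =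
  gen a s (s * t)%g (t * r)%g.
Proof.
move=> Aa da; apply/funext => y; apply: L2_ext => h; apply: L2_ext => g.
rewrite genE//.
rewrite -[LHS]/(kA dl a (kc0 (delta_fun R t) (kG r y)) h g).
have -> : kA dl a = amp (tens a (lreg s)) by rewrite /kA tens_id ?da// -da; exact: bdl.
rewrite (ampE _ _ (bounded_tens (bA Aa) (bl s))) (tens_lregE _ _ _ (bA Aa)).
rewrite kc0_deltaE /kG (tens_lregE _ _ _ bidW).
have -> : (s^-1 * g * h^-1 == t)%g = (g * h^-1 == s * t)%g.
  by rewrite -(inj_eq (@mulgI _ s)) -mulgA mulVKg.
case: eqP => [e|_]; last exact: linear_zero (bA Aa).1.
(* With [q = t r], what remains is [h = t^-1 s^-1 g], that is, the support condition [e]. *)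
congr (a (y _ _)); rewrite invgM -!mulgA; congr (_ * _)%g.
apply: (@mulgI _ t); rewrite mulVKg; apply: (@mulgI _ s).
by rewrite mulVKg mulgA -e mulgVK.
Qed.

(** The closed span of the [gen] is already an algebra, so it absorbs the algebra generated.
    Generators of the crossed product are reduced first in [a] to homogeneous elements, then in [f]
    to point masses. *)
Let AGGE : AGG = clspan SB.
Proof.
apply/seteqP; split.
  apply: smallest_sub => // _ [a [f [r [Aa cf ->]]]].
  have bkf := bounded_kc0 H cf.
  have b1 : bounded_linear_on A ((fun T => T \o kG r) \o
      ((fun T => T \o kc0 (H := H) f) \o ((fun T => tens T (id : op (ell2 R G))) \o dl))).
    apply: bl_comp (bl_comp (bl_comp bl_dl bdl (bl_tensl W bid)) _ (bl_mulr bkf)) _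
      (bl_mulr (bkG r)); first by move=> b; exact: bkA.
    by move=> b Ab; exact: bounded_comp (bkA Ab) bkf.
  move: a Aa; rewrite spanA; rewrite spanA in b1.
  apply: (bl_clspan_sub bhomog cSB b1) => a [Aa [s da]].
  rewrite -[X in clspan SB X]/(kA dl a \o kc0 (H := H) f \o kG r).
  have b2 : bounded_linear_on (@bounded_op R W2)
      ((fun T => T \o kG r) \o (fun T => kA dl a \o T)).
    apply: bl_comp (bl_mull (bkA Aa)) _ (bl_mulr (bkG r)).
    by move=> T bT; exact: bounded_comp (bkA Aa) bT.
  have bD := @deltas_bounded R G H.
  have b3 := bl_sub (clspan_bounded bD) b2.
  move: (kc0_span (H := H) cf); move: (kc0 (H := H) f) => X.
  apply: (bl_clspan_sub bD cSB b3) => _ [t ->]; apply: sub_clspan.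
  exists a, s, (s * t)%g, (t * r)%g; split=> //.
  exact: crossed_gen.
have cAGG : closed_subspace AGG := (clalg_algebra bcrossed).1.
apply: clspan_sub => // _ [a [s [p [q [Aa da ->]]]]].
apply: (@sub_gen_smallest _ (@operator_algebra R W2)).
(* Solving [p = s t] and [q = t r] gives [t = s^-1 p] and [r = t^-1 q]. *)
exists a, (delta_fun R (s^-1 * p)%g), ((s^-1 * p)^-1 * q)%g; split=> //.
  exact: c0_delta.
by rewrite (crossed_gen _ _ Aa da) !mulVKg.
Qed.

Let dual_gen a s p q : A a ->
  dual_coaction (gen a s p q) = tens (gen a s p q) (lreg (p^-1 * (s * q))%g).
Proof.
move=> Aa.
(* The outer coordinate [h] of the image is supported at [g = p h], and its value is read from the
   outer coordinate [q^-1 s^-1 p h = r^-1 h] with [r = p^-1 s q]. *)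
apply: (@dual_coaction_homogeneous R G W (gen a s p q)
  (fun h (z : W) => ev (p * h)%g (a (z (s^-1 * (p * h))%g))) _ (bgen s p q Aa)).
move=> x h; apply: L2_ext => g; rewrite genE// evE.
have -> : (g * h^-1 == p)%g = (g == p * h)%g by rewrite divg_eq.
case: eqP => // ->; congr (a (x _ _)).
by rewrite !invgM invgK !mulgA.
Qed.

Let bAGG : AGG `<=` @bounded_op R _.
Proof. by rewrite AGGE; exact: clspan_bounded. Qed.

Let bAK : AK `<=` @bounded_op R _.
Proof. by rewrite AKE; exact: clspan_bounded. Qed.

Let hom_bidual : hom_on AGG (@bidual_coaction R G H).
Proof.
have cAGG : closed_subspace AGG by rewrite AGGE.
split=> [c S T BS BT|S T BS BT].
  have BST := closed_lin cAGG c BS BT.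
  rewrite !bidual_coactionE; [|exact: bAGG..].
  by apply: (bl_dual_coaction G W).1; exact: bAGG.
have BST : AGG (S \o T) by rewrite AGGE in BS BT *; exact: algSB.2.
rewrite !bidual_coactionE; [|exact: bAGG..].
by apply: dual_coaction_comp; exact: bAGG.
Qed.

Lemma bidual_reduced_coaction : reduced_coaction AGG (@bidual_coaction R G H).
Proof.
rewrite AGGE; apply: homogeneous_reduced_coaction => //.
- by rewrite -AGGE.
- apply: (@ci_eq _ _ _ _ _ (@dual_coaction R G W)).
    by rewrite -AGGE => T /bAGG; exact: bidual_coactionE.
  by apply: ci_sub (ci_dual_coaction (H := W)); rewrite -AGGE.
- rewrite -AGGE => T /bAGG bT; rewrite bidual_coactionE//.
  exact: bounded_dual_coaction.
- move=> _ [a [s [p [q [Aa da ->]]]]]; exists (p^-1 * (s * q))%g.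
  rewrite (bidual_coactionE (bgen s p q Aa)); exact: dual_gen.
Qed.

Lemma duality_map_iso : completely_isometric_iso AGG AK duality_map.
Proof.
split.
- split; first by move=> c S T _ _; exact: conj_by_lin VV' _ _ _.
  by move=> S T _ _; exact: conj_by_comp VV' _ _.
- by apply: ci_sub (ci_conj VV'); exact: bAGG.
- rewrite AGGE AKE; apply/seteqP; split; first by move=> _ [T /PsiSK + <-].
  move=> T KT; exists (conj_by V' V T); first exact: PsiVSB.
  exact: conj_byK V'V T.
Qed.

Let dlA := dl @` A.

Let dl_inj a b : A a -> A b -> dl a = dl b -> a = b.
Proof.
move=> Aa Ab dab; apply/eqP; rewrite -subr_eq0; apply/eqP.
have Aab := closed_sub cA Aa Ab; apply: opnorm_eq0; first exact: bA.
rewrite -(ci_opnorm cidl Aab (bA Aab) (bdl Aab)).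
have -> : dl (a - b) = 0; last exact: opnorm0.
rewrite addrC -scaleN1r homdl.1// dab -[X in _ + X]scale1r -scalerDl addNr.
by rewrite scale0r.
Qed.

Let dl_invK a : A a -> dl_inv A dl (dl a) = a.
Proof.
move=> Aa; rewrite /dl_inv; case: xgetP => [b _ [Ab dab]|no].
  exact: dl_inj.
by case: (no a).
Qed.

Let cdlA : closed_subspace dlA.
Proof.
apply: isometric_image_closed => // a Aa.
exact (ci_opnorm cidl Aa (bA Aa) (bdl Aa)).
Qed.

Let lin_dl_inv : linear_on dlA (dl_inv A dl).
Proof.
move=> c _ _ [a Aa <-] [b Ab <-]; rewrite -homdl.1// !dl_invK//.
exact: closed_lin.
Qed.

Let bdl_inv b : dlA b -> bounded_op (dl_inv A dl b).
Proof. by move=> [a Aa <-]; rewrite dl_invK//; exact: bA. Qed.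

(** The matrix of preimages has the same norm, [dl] being completely isometric. *)
Let cc_dl_inv : completely_contractive dlA (dl_inv A dl).
Proof.
move=> n b Bb.
have Aa i j : A (map_mx (dl_inv A dl) b i j).
  by rewrite mxE; have [a Aa <-] := Bb i j; rewrite dl_invK.
rewrite -(cidl Aa).
suff -> : map_mx dl (map_mx (dl_inv A dl) b) = b by [].
apply/matrixP => i j; rewrite !mxE.
by have [a Aa' <-] := Bb i j; rewrite dl_invK.
Qed.

Let E1 := tensmap (@tens R G W) (@tens R G H) dlA K (dl_inv A dl) id.
Let E2 := tensmap (@tens R G H) (@tens R G W) A K dl id.
Let CK := mintens (@tens R G (ell2 R G)) C K.
Let E3 := tensmap (@tens2 R G G H) (@tens2 R G G W) A CK dl (@flip R G).

Let E1_spec : bounded_linear_on AK E1 /\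
  forall a k, dlA a -> K k -> E1 (tens a k) = tens (dl_inv A dl a) k.
Proof. by apply: tensmap_cc. Qed.

Let E2_spec : bounded_linear_on (mintens (@tens R G H) A K) E2 /\
  forall a k, A a -> K k -> E2 (tens a k) = tens (dl a) k.
Proof. by apply: tensmap_cc => //; [exact: homdl.1|exact: ci_cc]. Qed.

Let bCK0 := mintens_bounded bC bK.

Let bCK : CK `<=` @bounded_op R _ := clspan_bounded bCK0.

Let D3 := mintens (@tens2 R G G H) A CK.

Let bD30 := mintens2_bounded bA bCK.

Let tens2_swap (S : op W) (b : op (L2 G (ell2 R G))) : bounded_op S -> bounded_op b ->
  conj_by (perm2 (@flip_pair G)) (perm2 (@flip_pair G)) (tens2 S b) =
  tens2 S (conj_by (perm2 (@flip_pair G)) (perm2 (@flip_pair G)) b).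
Proof.
move=> bS bb; have bF := blin_perm2 R[i]^o (can_inj (@flip_pairK G)).
rewrite /conj_by -(tens2_id_perm2 W (@flip_pairK G) (@flip_pairK G)).
rewrite (tens2_comp bidW bS bF bb).
by rewrite (tens2_comp (bounded_comp bidW bS) bidW (bounded_comp bF bb) bF).
Qed.

(** [delta_lambda \otimes Sigma] is realized as [delta_lambda \otimes id], given by [tens2_cc],
    followed by conjugation with the swap of the last two legs. *)
Let E3_spec : bounded_linear_on D3 E3 /\
  forall a b, A a -> CK b -> E3 (tens2 a b) = tens2 (dl a) (flip b).
Proof.
have [Phi [blPhi ePhi]] := tens2_cc cA homdl.1 bdl (ci_cc cidl) bCK.
have bPhi X : D3 X -> bounded_op (Phi X) by case: blPhi => _ [M h] /h[].
have bl3 := bl_comp blPhi bPhi (bl_conj (swap_isometric G W)).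
apply: (tensmap_spec bl3) => a b Aa Cb.
rewrite -[LHS]/(conj_by (perm2 (@flip_pair G)) (perm2 (@flip_pair G))
  (Phi (tens2 a b))) ePhi//.
by rewrite (flipE Cb) tens2_swap//; [exact: bdl|exact: bCK].
Qed.

Let stable_conj X :
  conj_by (perm2 (@shearUV G)) (perm2 (@shearU G)) (E3 (E2 (E1 X))) =
  stable_coaction A dl X.
Proof. by rewrite /stable_coaction tens2_opU tens2_adj_opU. Qed.

(** The first two maps undo and redo [delta_lambda], so the operator is unchanged; associativity
    lets it be read in [A \otimes (C \otimes K)], where the third map is defined. *)
Let E21_elem a s p q : A a -> dl a = tens a (lreg s) ->
  E2 (E1 (elem a s p q)) = tens2 a (tens (lreg s) (mat_unit p q)).
Proof.
move=> Aa da; rewrite (tens2_tens (bA Aa) (bl s) (bE p q)) /elem -da.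
rewrite E1_spec.2; [|by exists a|exact: KE].
by rewrite dl_invK// E2_spec.2.
Qed.

Let CK_elem s p q : CK (tens (@lreg R G s) (mat_unit p q)).
Proof.
apply: (@sub_clspan _ _ [set T | exists a b, [/\ C a, K b & T = tens a b]]).
by exists (lreg s), (mat_unit p q); split=> //; exact: reduced_alg_lreg.
Qed.

Let E321_elem a s p q : A a -> dl a = tens a (lreg s) ->
  E3 (E2 (E1 (elem a s p q))) = tens (tens (dl a) (mat_unit p q)) (lreg s).
Proof.
move=> Aa da; rewrite E21_elem// E3_spec.2// (flipE (CK_elem s p q)).
by rewrite (swap_tens (bl s) (bE p q)) (tens2_tens (bdl Aa) (bE p q) (bl s)).
Qed.

(** On the last two legs, conjugation sends [e_q \otimes e_k] through [e_q \otimes e_(q k)] and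
    [e_p \otimes e_(s q k)] to [e_p \otimes e_(p^-1 s q k)]. *)
Let shear_tens (S : op W) s p q : bounded_op S ->
  conj_by (perm2 (@shearUV G)) (perm2 (@shearU G))
    (tens (tens S (mat_unit p q)) (lreg s)) =
  tens (tens S (mat_unit p q)) (lreg (p^-1 * (s * q))%g).
Proof.
move=> bS; have bSE := bounded_tens bS (bE p q).
apply/funext => y; apply: L2_ext => k; apply: L2_ext => h.
rewrite (tens_lregE _ _ _ bSE) (tens_mat_unitE _ _ _ _ bS).
rewrite -[LHS]/(perm2 (@shearUV G) (tens (tens S (mat_unit p q)) (lreg s)
  (perm2 (@shearU G) y)) k h).
rewrite (perm2E _ _ _ (can_inj (@shearUVK G))) /=.
rewrite (tens_lregE _ _ _ bSE) (tens_mat_unitE _ _ _ _ bS).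
case: eqP => // ->; rewrite (perm2E _ _ _ (can_inj (@shearUK G))) /=.
by congr (S (y _ _)); rewrite !invgM invgK !mulgA.
Qed.

Let stable_elem a s p q : A a -> dl a = tens a (lreg s) ->
  stable_coaction A dl (elem a s p q) =
  tens (elem a s p q) (lreg (p^-1 * (s * q))%g).
Proof.
move=> Aa da; rewrite -stable_conj E321_elem// shear_tens; last exact: bdl.
by rewrite da.
Qed.

(** Each factor is controlled only on its own domain, so the images are followed along the
    composition. That the second image lies in [A \otimes (C \otimes K)] is seen on homogeneous
    generators. *)
Let bl_stable : bounded_linear_on AK (stable_coaction A dl).
Proof.
have [bl1 e1] := E1_spec; have [bl2 e2] := E2_spec; have [bl3 e3] := E3_spec.
have bAK0 := mintens_bounded dlA_bounded bK.
have bAK1 := mintens_bounded bA bK.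
have m1 X : AK X -> mintens (@tens R G H) A K (E1 X).
  apply: (bl_clspan_sub bAK0 (smallest_closed bAK1) bl1) => _ [b [k [Bb Kk ->]]].
  rewrite e1//; have [a Aa <-] := Bb; rewrite dl_invK//.
  apply: (@sub_clspan _ _ [set T | exists a b, [/\ A a, K b & T = tens a b]]).
  by exists a, k.
have bl21 := bl_comp bl1 m1 bl2.
have m2 X : AK X -> D3 ((E2 \o E1) X).
  move: X; rewrite AKE; rewrite AKE in bl21.
  have cD3 : closed_subspace D3 := smallest_closed bD30.
  apply: (bl_clspan_sub bSK cD3 bl21).
  move=> _ [a [s [p [q [Aa da ->]]]]].
  rewrite -[X in D3 X]/(E2 (E1 (elem a s p q))) E21_elem//.
  apply: (@sub_clspan _ _ [set T | exists a b, [/\ A a, CK b & T = tens2 a b]]).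
  by exists a, (tens (lreg s) (mat_unit p q)).
have bl321 := bl_comp bl21 m2 bl3.
have b321 X : AK X -> bounded_op ((E3 \o (E2 \o E1)) X).
  by case: bl321 => _ [M h] /h[].
have UVU := isometric_inverses_sym (shear_isometric G W).
have bl4 := bl_comp bl321 b321 (bl_conj UVU).
have cAK : closed_subspace AK by rewrite AKE.
by apply: (bl_eqfun cAK _ bl4) => X _; rewrite -stable_conj.
Qed.

(* Up to conjugation by [V], the coaction on the stabilization is the bidual
   coaction. *)
Let transported (X : op W2) : op W3 :=
  conj_by (amp V) (amp V') (dual_coaction (conj_by V' V X)).

Let ampVV' : isometric_inverses (@amp R G _ _ V) (amp V').
Proof. exact: isometric_inverses_amp. Qed.

Let bl_transported : bounded_linear_on (@bounded_op R W2) transported.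
Proof.
apply: bl_comp (bl_comp (bl_conj V'V) _ (bl_dual_coaction G W)) _ (bl_conj ampVV').
  by move=> X; exact: bounded_conj_by.
by move=> X bX; apply: bounded_dual_coaction; exact: bounded_conj_by.
Qed.

Let amp_conj (X : op W2) (T : op (ell2 R G)) : bounded_op X -> bounded_op T ->
  conj_by (amp V) (amp V') (tens X T) = tens (conj_by V V' X) T.
Proof.
move=> bX bT; rewrite /conj_by -(tens_id G bV) -(tens_id G bV').
rewrite (tens_comp bV bX bid bT).
by rewrite (tens_comp (bounded_comp bV bX) bV' (bounded_comp bid bT) bid).
Qed.

(** This gives the coaction on the stabilization its multiplicativity and complete isometry, both
    inherited from [dual_coaction] and unitary conjugations. *)
Let stableE X : AK X -> stable_coaction A dl X = transported X.
Proof.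
have b1 := bl_stable; have b2 := bl_sub bAK bl_transported.
move: X; rewrite AKE; rewrite AKE in b1 b2.
apply: (bl_eq bSK b1 b2) => _ [a [s [p [q [Aa da ->]]]]].
rewrite stable_elem// /transported -[conj_by V' V _]/(gen a s p q) dual_gen//.
rewrite amp_conj; [|exact: bgen|exact: bl].
by rewrite /gen (conj_byK V'V).
Qed.

Lemma stable_reduced_coaction : reduced_coaction AK (stable_coaction A dl).
Proof.
have AKb X : clspan SK X -> AK X by rewrite AKE.
rewrite AKE; apply: homogeneous_reduced_coaction => //.
- split=> [|S T KS KT]; first by rewrite -AKE; exact: bl_stable.1.
  have KST := algSK.2 _ _ KS KT.
  rewrite !stableE; [|exact: AKb..].
  have [bS bT] := (bAK (AKb _ KS), bAK (AKb _ KT)).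
  rewrite /transported (conj_by_comp V'V).
  rewrite dual_coaction_comp; [|exact: bounded_conj_by..].
  exact: conj_by_comp ampVV' _ _.
- apply: (ci_eq (fun X KX => stableE (AKb X KX))).
  apply: ci_comp (ci_sub _ (ci_conj V'V)) _
    (ci_comp (ci_dual_coaction (H := W)) _ (ci_conj ampVV')).
  + exact: clspan_bounded bSK.
  + by move=> X /(clspan_bounded bSK); exact: bounded_conj_by.
  + by move=> X; exact: bounded_dual_coaction.
- by move=> X /AKb; case: bl_stable => _ [M h] /h[].
- move=> _ [a [s [p [q [Aa da ->]]]]]; exists (p^-1 * (s * q))%g.
  exact: stable_elem.
Qed.

Lemma duality_map_equivariant (X : op W2) : AGG X ->
  stable_coaction A dl (duality_map X) =
  tensmap (@tens R G W2) (@tens R G W2) AGG C duality_map id (bidual_coaction X).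
Proof.
have [[linP _] ciP imP] := duality_map_iso.
have cAGG : closed_subspace AGG by rewrite AGGE.
have bP Y : AGG Y -> bounded_op (duality_map Y).
  by move=> /bAGG; exact: bounded_conj_by VV' Y.
set Th := tensmap _ _ _ _ _ _.
have [blT eT] : bounded_linear_on (mintens (@tens R G W2) AGG C) Th /\
    forall a b, AGG a -> C b -> Th (tens a b) = tens (duality_map a) b.
  exact: tensmap_cc cAGG linP bP (ci_cc ciP) bC.
move: Th blT eT => Th blT eT.
have [ciB [_ homB memB _ _]] := bidual_reduced_coaction.
have bB Y : AGG Y -> bounded_op (bidual_coaction Y).
  by move=> /bAGG bY; rewrite bidual_coactionE//; exact: bounded_dual_coaction.
have blB := ci_bl bAGG homB.1 bB ciB.
have blP := ci_bl bAGG linP bP ciP.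
have PAK Y : AGG Y -> AK (duality_map Y) by move=> BY; rewrite -imP; exists Y.
have b1 := bl_comp blP PAK bl_stable.
have b2 := bl_comp blB memB blT.
have sub Y : SB Y -> AGG Y by rewrite AGGE; exact: sub_clspan.
move: X; rewrite AGGE; rewrite AGGE in b1 b2.
apply: (bl_eq bSB b1 b2) => Y SY; have BY := sub _ SY.
move: SY => [a [s [p [q [Aa da eY]]]]].
have PY : duality_map Y = elem a s p q by rewrite eY; exact: conj_byK V'V _.
rewrite -[LHS]/(stable_coaction A dl (duality_map Y)) PY stable_elem//.
rewrite -[RHS]/(Th (bidual_coaction Y)) (bidual_coactionE (bAGG BY)).
have dY : dual_coaction Y = tens Y (lreg (p^-1 * (s * q))%g).
  by rewrite eY; exact: dual_gen.
rewrite dY (eT _ _ BY (@reduced_alg_lreg R G _)) PY.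
reflexivity.
Qed.

End Duality.

Theorem theorem3p3 (R : realType) (G : groupType)
    (Y : choiceType) (u : G -> op (ell2 R Y)) (hu : full_group_rep u)
    (H : hilbertType R) (A : set (op H)) (hA : operator_algebra A)
    (delta : op H -> op (L2 Y H)) (hdelta : coaction u A delta)
    (hnormal : normal_coaction u A delta) :
  let dl : op H -> op (L2 G H) := delta_lambda u A delta in
  let AGG : set (op (L2 G (L2 G H))) := double_crossed_product A dl in
  let AK : set (op (L2 G (L2 G H))) := stabilization A dl in
  let t : op (L2 G (L2 G H)) -> op (ell2 R G) -> op (L2 G (L2 G (L2 G H))) :=
    @tens R G (L2 G (L2 G H)) in
  [/\ reduced_coaction AGG (@bidual_coaction R G H),
      reduced_coaction AK (stable_coaction A dl)
    & exists Psi : op (L2 G (L2 G H)) -> op (L2 G (L2 G H)),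
        completely_isometric_iso AGG AK Psi /\
        forall x : op (L2 G (L2 G H)), AGG x ->
          stable_coaction A dl (Psi x) =
          tensmap t t AGG (@reduced_alg R G) Psi id (bidual_coaction x)].
Proof.
move=> dl AGG AK t.
have [homdl bdl spanA] := spectral_decomposition hu.1 hA hdelta hnormal.
split.
- exact: bidual_reduced_coaction hA homdl bdl hnormal spanA.
- exact: stable_reduced_coaction hA homdl bdl hnormal spanA.
- exists (@duality_map R G H); split.
    exact: duality_map_iso hA homdl bdl hnormal spanA.
  exact: duality_map_equivariant hA homdl bdl hnormal spanA.
Qed.
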